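(* For every $\eta\in\mathrm{Curr}(S)$, $\delta_\eta=\delta_\eta^g$. This common value is finite if and only if $\eta$ is filling, and the map $\eta\mapsto\delta_\eta$ restricted to the set $\mathcal{F}$ of filling currents is continuous.
   Context: Let $S$ be a closed orientable surface of genus at least $2$ with a fixed hyperbolic metric, $S=\mathbb{H}^2/\Gamma_0$ with $\Gamma_0$ discrete cocompact. $\mathrm{Curr}(S)$ is the set of $\Gamma_0$-invariant locally finite Borel measures on the space of unoriented geodesics of $\mathbb{H}^2$, with the weak-* topology; $i$ is Bonahon's continuous bilinear intersection form. $\mathcal{C}$ is the set of free homotopy classes of (nontrivial) closed curves on $S$, each viewed as a current (sum of Dirac masses on the lifts of its closed geodesic). A current $\eta$ is filling if every geodesic of $\mathbb{H}^2$ meets transversally some geodesic in the support of $\eta$; $\mathcal{F}$ is the set of filling currents. For distinct $x,y\in\mathbb{H}^2$: $g_{(xy)}$ is the geodesic through $x,y$; $G(x)$ the set of geodesics through $x$; $T(x,y)$ the set of geodesics meeting the open segment $(x,y)$ transversally and not through $x$ or $y$; $T[x,y]:=(T(x,y)\cup G(x)\cup G(y))\setminus\{g_{(xy)}\}$; $d_\eta(x,y):=\eta(T[x,y])$, $d_\eta(x,x):=0$. Fix $o\in\mathbb{H}^2$. The metric critical exponent is $\delta_\eta:=\limsup_{R\to\infty}\frac1R\log\operatorname{Card}\{\gamma\in\Gamma_0: d_\eta(\gamma o,o)\le R\}$ and the geodesic critical exponent is $\delta^g_\eta:=\limsup_{R\to\infty}\frac1R\log\operatorname{Card}\{c\in\mathcal{C}: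 i(\eta,c)\le R\}$ (with value $+\infty$ if the sets are infinite). *)

(* Defs.v *)
(* Model: hyperbolic plane = Klein (projective) disk model  { z in R^2 | |z| < 1 }.
   Geodesics = Euclidean chords; a geodesic is encoded by its unique angle pair
   (a,b) with 0 <= a < b < 2 pi, its endpoints being (cos a, sin a), (cos b, sin b).
   Isometries (orientation preserving) = SO^+(2,1) acting projectively. *)
From HB Require Import structures.
From mathcomp Require Import all_boot all_order all_algebra.
From mathcomp Require Import finmap all_classical all_reals all_analysis.
Set Implicit Arguments. Unset Strict Implicit. Unset Printing Implicit Defensive.
Import Order.TTheory GRing.Theory Num.Theory numFieldNormedType.Exports.
Local Open Scope classical_set_scope.
Local Open Scope ring_scope.

Section Defs.
Variable R : realType.

Definition pt := (R * R)%type.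
Definition n2 (z : pt) : R := z.1 ^+ 2 + z.2 ^+ 2.
Definition psub (z w : pt) : pt := (z.1 - w.1, z.2 - w.2).
Definition lerp (z w : pt) (t : R) : pt :=
  ((1 - t) * z.1 + t * w.1, (1 - t) * z.2 + t * w.2).
Definition disk : set pt := [set z | n2 z < 1].
Definition bpt (a : R) : pt := (cos a, sin a).

Definition Geo : set (R * R) := [set w | 0 <= w.1 /\ w.1 < w.2 /\ w.2 < 2 * pi].
Definition endpts (w : R * R) : set pt := [set bpt w.1; bpt w.2].
Definition onGeo (w : R * R) (z : pt) : Prop :=
  disk z /\ exists t, 0 <= t <= 1 /\ z = lerp (bpt w.1) (bpt w.2) t.
Definition transverse (w w' : R * R) : Prop :=
  w <> w' /\ exists z, onGeo w z /\ onGeo w' z.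

Definition i0 : 'I_3 := ord0.
Definition i1 : 'I_3 := inord 1.
Definition i2 : 'I_3 := inord 2.
Definition Jform : 'M[R]_3 := diag_mx (\row_(i < 3) [:: 1; 1; -1]`_i).
Definition SO21p (M : 'M[R]_3) : Prop :=
  M^T *m Jform *m M = Jform /\ \det M = 1 /\ 0 < M i2 i2.
Definition hom (z : pt) : 'cV[R]_3 := \col_(i < 3) [:: z.1; z.2; 1]`_i.
Definition act (M : 'M[R]_3) (z : pt) : pt :=
  let v := M *m hom z in (v i0 0 / v i2 0, v i1 0 / v i2 0).

(* Gamma_0 : discrete, cocompact, torsion-free subgroup of SO^+(2,1)
   (so that S = H^2/Gamma_0 is a closed orientable hyperbolic surface) *)
Definition fuchsian_surface_group (G : set 'M[R]_3) : Prop :=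
  [/\ G `<=` SO21p,
      G 1%:M,
      (forall a b, G a -> G b -> G (a *m b)) &
      (forall a, G a -> G (invmx a))] /\
  [/\
      (forall a, G a -> exists2 e : R, 0 < e &
          forall b, G b -> (forall i j, `|b i j - a i j| < e) -> b = a),
      (* cocompact: translates of a compact subset of the disk cover it *)
      (exists2 r : R, r < 1 & forall z, disk z -> exists2 g, G g & n2 (act g z) <= r) &
      (forall a n, G a -> a ^+ n.+1 = 1%:M -> a = 1%:M)].

Definition gact (g : 'M[R]_3) (w w' : R * R) : Prop :=
  Geo w' /\ endpts w' = act g @` endpts w.

Definition near_geo (w w' : R * R) (e : R) : Prop :=
  (n2 (psub (bpt w'.1) (bpt w.1)) < e /\ n2 (psub (bpt w'.2) (bpt w.2)) < e) \/
  (n2 (psub (bpt w'.1) (bpt w.2)) < e /\ n2 (psub (bpt w'.2) (bpt w.1)) < e).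

Local Open Scope ereal_scope.

(* geodesic currents: Gamma-invariant locally finite Borel measures on the
   space of geodesics (measures on R*R concentrated on Geo) *)
Definition is_current (G : set 'M[R]_3) (eta : {measure set (R * R) -> \bar R}) : Prop :=
  [/\ eta (~` Geo) = 0,
      (forall e : R, (0 < e)%R ->
         eta [set w | Geo w /\ (e <= n2 (psub (bpt w.1) (bpt w.2)))%R] < +oo) &
      (forall g A, G g -> measurable A -> A `<=` Geo ->
         eta [set w | Geo w /\ exists2 w', A w' & gact g w w'] = eta A)].

Definition supp (eta : {measure set (R * R) -> \bar R}) (w : R * R) : Prop :=
  Geo w /\ forall e : R, (0 < e)%R -> 0 < eta [set w' | Geo w' /\ near_geo w w' e].
Definition filling (eta : {measure set (R * R) -> \bar R}) : Prop :=
  forall w, Geo w -> exists w', supp eta w' /\ transverse w w'.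

Definition Gthrough (x : pt) : set (R * R) := [set w | Geo w /\ onGeo w x].
Definition Topen (x y : pt) : set (R * R) :=
  [set w | Geo w /\ ~ onGeo w x /\ ~ onGeo w y /\
           exists t, (0 < t < 1)%R /\ onGeo w (lerp x y t)].
Definition gxy (x y : pt) : set (R * R) := [set w | Geo w /\ onGeo w x /\ onGeo w y].
Definition Tclosed (x y : pt) : set (R * R) :=
  (Topen x y `|` Gthrough x `|` Gthrough y) `\` gxy x y.
Definition d_eta (eta : {measure set (R * R) -> \bar R}) (x y : pt) : \bar R :=
  if x == y then 0 else eta (Tclosed x y).

(* intersection number i(eta, c) for the closed curve c = [g]: eta-measure of
   the geodesics meeting transversally a fundamental segment [x, g x) of the
   axis of g *)
Definition fixB (g : 'M[R]_3) : set pt := [set u | n2 u = 1%R /\ act g u = u].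
Definition onAxis (g : 'M[R]_3) (z : pt) : Prop :=
  disk z /\ exists p q, [/\ fixB g p, fixB g q, p <> q &
                          exists t, (0 <= t <= 1)%R /\ z = lerp p q t].
Definition axis_base (g : 'M[R]_3) : pt :=
  xget (0%R, 0%R) [set z | onAxis g z /\ forall z', onAxis g z' -> (n2 z <= n2 z')%R].
Definition inter (eta : {measure set (R * R) -> \bar R}) (g : 'M[R]_3) : \bar R :=
  let x := axis_base g in
  eta [set w | Geo w /\ endpts w <> fixB g /\
               exists t, (0 <= t < 1)%R /\ onGeo w (lerp x (act g x) t)].

(* free homotopy classes of nontrivial closed curves = conjugacy classes *)
Definition conjclass (G : set 'M[R]_3) (g : 'M[R]_3) : set 'M[R]_3 :=
  [set b *m g *m invmx b | b in G].

Definition ecard (T : choiceType) (A : set T) : \bar R :=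
  if pselect (finite_set A) then ((#|` fset_set A|)%fset%:R)%:E else +oo.
Definition elog (x : \bar R) : \bar R :=
  match x with
  | r%:E => if r == 0%R then -oo else (ln r)%:E
  | _ => +oo
  end.
Definition crit_exp (N : R -> \bar R) : \bar R :=
  ereal_inf [set ereal_sup [set elog (N r) * (r^-1)%:E | r in [set r | (M <= r)%R]]
            | M in [set M : R | (0 < M)%R]].

Definition delta_metric (G : set 'M[R]_3) (o : pt) (eta : {measure set (R * R) -> \bar R}) :=
  crit_exp (fun r => ecard [set g | G g /\ d_eta eta (act g o) o <= r%:E]).
Definition delta_geod (G : set 'M[R]_3) (eta : {measure set (R * R) -> \bar R}) :=
  crit_exp (fun r => ecard [set conjclass G g | g in
                            [set g | G g /\ g <> 1%:M /\ inter eta g <= r%:E]]).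

(* test functions for the weak-* topology: continuous compactly supported
   functions on the space of geodesics, written in angle coordinates *)
Definition test_fun (f : R -> R -> R) : Prop :=
  [/\ continuous (fun p : R * R => f p.1 p.2),
      (forall a b, f a b = f b a),
      (forall a b, f (a + 2 * pi)%R b = f a b) &
      exists2 e : R, (0 < e)%R &
        forall a b, (n2 (psub (bpt a) (bpt b)) < e)%R -> f a b = 0%R].
Definition pair_int (eta : {measure set (R * R) -> \bar R}) (f : R -> R -> R) : \bar R :=
  \int[eta]_(w in Geo) (f w.1 w.2)%:E.

End Defs.

(* Main.v *)
(** In the Klein disk the signed distance [eside x w] from a point [x] to a
    chord [w] is affine in [x], so that "[w] separates [x] from [y]" is a sign
    condition.  Hence d_eta is an invariant pseudo-metric, additive along
    segments up to a bounded error, and i(eta, c) is its stable length along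
    the powers of an element of the conjugacy class c.

    If eta is filling, compactness makes the orbit map proper for d_eta.
    Cutting segments into pieces of bounded d_eta-length bounds the growth of
    orbits exponentially.  Every element of the group becomes, after
    multiplication by one of finitely many elements, one whose axis meets a
    fixed ball; as a conjugacy class has at most linearly many such
    representatives of bounded length, elements and conjugacy classes have the
    same exponential growth.

    If eta is not filling, the points of a geodesic that the support of eta
    does not cross stay at bounded d_eta-distance, and following that geodesic
    gives infinitely many elements, and infinitely many classes, of bounded
    length: both exponents are infinite.

    For continuity, finitely many test functions, one for each possible step
    between neighbouring pieces of a segment, compare d_eta and d_eta' up to a
    factor close to 1. *)
Require Import Defs.
From HB Require Import structures.
From mathcomp Require Import all_boot all_order all_algebra.
From mathcomp Require Import finmap all_classical all_reals all_analysis.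
From mathcomp Require Import measurable_realfun ring lra.
Set Implicit Arguments. Unset Strict Implicit. Unset Printing Implicit Defensive.
Import Order.TTheory GRing.Theory Num.Theory numFieldNormedType.Exports.
Local Open Scope classical_set_scope.
Local Open Scope ring_scope.

(** * Coordinates in the Lorentz group of signature (2,1) *)

Section LorentzAlgebra.
Variable R : realType.
Implicit Types (M N g h : 'M[R]_3) (x y z u : pt R).

(** A current may have atoms, so [d_eta] is neither additive nor continuous along a segment. The
    half-open variant [hset] is exactly additive and matches the half-open fundamental segment in
    [inter]. It differs from [dset] only by geodesics through an endpoint, and cocompactness bounds
    their mass by that of the geodesics meeting one fixed ball. All errors and jumps are thus
    controlled by a single constant [cst r eta].

    The hyperbolic distance is replaced by [cx g], the entry [g i2 i2]: it is the hyperbolic cosine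
    of the distance from the centre to its image, it bounds all entries of g, and its inverse square
    is [1 - n2 (act g org)].

    That every nontrivial element has an axis is derived from discreteness, cocompactness and
    torsion-freeness, by way of a uniform lower bound on displacements.

    For continuity, the error per piece is additive and does not depend on the length L of the
    pieces. A large L makes it relatively small, so a fixed tolerance on the test functions is
    enough and the precision enters only through the number of these functions. *)

Lemma sum_ord3 (V : nmodType) (F : 'I_3 -> V) :
  \sum_(i < 3) F i = F i0 + F i1 + F i2.
Proof.
rewrite !big_ord_recl big_ord0 addr0 addrA; congr (_ + F _ + F _); apply/val_inj => /=;
  by rewrite ?inordK.
Qed.

Lemma ord3P (P : 'I_3 -> Prop) : P i0 -> P i1 -> P i2 -> forall i, P i.
Proof.
move=> p0 p1 p2 [[|[|[|//]]] lti].
- by rewrite (_ : Ordinal _ = i0) //; exact/val_inj.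
- by rewrite (_ : Ordinal _ = i1) //; apply/val_inj; rewrite /= inordK.
- by rewrite (_ : Ordinal _ = i2) //; apply/val_inj; rewrite /= inordK.
Qed.

Lemma Jform_diag (i j : 'I_3) :
  Jform R i j = if i == j then (if i == i2 then -1 else 1) else 0.
Proof.
rewrite /Jform !mxE -val_eqE /=; case: eqVneq => //= _; rewrite ?mulr0n // mulr1n.
move: i; apply: ord3P; rewrite /i0 /i1 /i2 -?val_eqE /= ?inordK //.
Qed.

Lemma neq_ord3 : ((i0 == i1) = false) * ((i0 == i2) = false) * ((i1 == i2) = false)
  * ((i1 == i0) = false) * ((i2 == i0) = false) * ((i2 == i1) = false).
Proof. by rewrite /i0 /i1 /i2 -!val_eqE /= !inordK. Qed.

Lemma hom_coord z : (Defs.hom z i0 0 = z.1) * (Defs.hom z i1 0 = z.2) * (Defs.hom z i2 0 = 1).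
Proof. by rewrite /Defs.hom !mxE /i0 /i1 /i2 /= !inordK. Qed.

Lemma mul_hom M z i : (M *m Defs.hom z) i 0 = M i i0 * z.1 + M i i1 * z.2 + M i i2.
Proof. by rewrite mxE sum_ord3 !hom_coord mulr1. Qed.

Lemma mulmx3 M N i j : (M *m N) i j = M i i0 * N i0 j + M i i1 * N i1 j + M i i2 * N i2 j.
Proof. by rewrite mxE sum_ord3. Qed.

Lemma mulJ (M : 'M[R]_3) i j : (Jform R *m M) i j = (if i == i2 then -1 else 1) * M i j.
Proof.
rewrite mulmx3 !Jform_diag; move: i; apply: ord3P; rewrite ?eqxx ?neq_ord3;
ring.
Qed.

Lemma SO21_col M : SO21p M -> forall j k,
  M i0 j * M i0 k + M i1 j * M i1 k - M i2 j * M i2 k = Jform R j k.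
Proof.
move=> [MJM _] j k; move/matrixP: MJM => /(_ j k) <-.
rewrite -mulmxA mulmx3 !mulJ !mxE ?eqxx ?neq_ord3; ring.
Qed.

Lemma JJ : Jform R *m Jform R = 1%:M.
Proof.
apply/matrixP => i j; rewrite mulJ Jform_diag !mxE.
by case: (i == j); case: (i == i2); rewrite ?mulr0 ?mulrNN ?mulr1.
Qed.

Lemma SO21_inv M : SO21p M -> invmx M = Jform R *m M^T *m Jform R.
Proof.
move=> [MJM [detM _]].
have uM : M \in unitmx by rewrite unitmxE detM unitr1.
have e : (Jform R *m M^T *m Jform R) *m M = 1%:M.
  by rewrite -!mulmxA [M^T *m _]mulmxA MJM JJ.
by rewrite -[LHS]mul1mx -e mulmxK.
Qed.

Lemma SO21_unit M : SO21p M -> M \in unitmx.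
Proof. by move=> [_ [detM _]]; rewrite unitmxE detM unitr1. Qed.

Lemma SO21_invE M i j : SO21p M ->
  invmx M i j = (if i == i2 then -1 else 1) * M j i * (if j == i2 then -1 else 1).
Proof.
move=> sM; rewrite SO21_inv // mulmx3 !Jform_diag !mulJ !mxE.
move: j; apply: ord3P; rewrite ?eqxx ?neq_ord3; ring.
Qed.

(** Read off from [M *m invmx M = 1%:M], the inverse being J M^T J: rows obey the same relations as
    columns. *)
Lemma SO21_row M : SO21p M -> forall j k,
  M j i0 * M k i0 + M j i1 * M k i1 - M j i2 * M k i2 = Jform R j k.
Proof.
move=> sM j k; have := mulmxV (SO21_unit sM) => /matrixP /(_ j k).
rewrite Jform_diag mulmx3 !SO21_invE // !mxE ?neq_ord3 ?eqxx /=.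
case: (j =P k) => [<-|_]; move: j k; do 2?[apply: ord3P]; rewrite ?eqxx ?neq_ord3 /= => //;
rewrite ?mulr1n ?mulr0n => ?; nra.
Qed.

Lemma det3 M : \det M =
  M i0 i0 * (M i1 i1 * M i2 i2 - M i1 i2 * M i2 i1)
  - M i0 i1 * (M i1 i0 * M i2 i2 - M i1 i2 * M i2 i0)
  + M i0 i2 * (M i1 i0 * M i2 i1 - M i1 i1 * M i2 i0).
Proof.
rewrite (expand_det_row _ i0) sum_ord3 /cofactor.
rewrite !(expand_det_row _ ord0) !big_ord_recl !big_ord0 /cofactor !det_mx11 !mxE /=.
have [l0 l1 l2] : [/\ lift i0 (0 : 'I_2) = i1, lift i0 (1 : 'I_2) = i2 & lift i1 (0 : 'I_2) = i0].
  by split; apply/val_inj; rewrite /= ?inordK.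
have [l3 l4 l5] : [/\ lift i1 (1 : 'I_2) = i2, lift i2 (0 : 'I_2) = i0 & lift i2 (1 : 'I_2) = i1].
  by split; apply/val_inj; rewrite /= ?inordK.
have m1 : lift (0 : 'I_2) 0 = 1 :> 'I_2 by apply/val_inj.
have m0 : lift (lift ord0 ord0 : 'I_2) 0 = 0 :> 'I_2 by apply/val_inj.
have m3 : lift (0 : 'I_2) (ord0 : 'I_1) = 1 by apply/val_inj.
rewrite /bump /= !inordK // ?m0 ?m1 ?m3.
rewrite ?l0 ?l1 ?l2 ?l3 ?l4 ?l5; ring.
Qed.

End LorentzAlgebra.

(** * The projective action on the Klein disk *)

Section DiskAction.
Variable R : realType.
Implicit Types (M N g h : 'M[R]_3) (p q x y z u : pt R).

Definition org : pt R := (0, 0).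
(** Minus the Lorentz product of the lifts (x,1) and (y,1). On the closed disk it is nonnegative and
    vanishes only when x = y is on the circle. *)
Definition bil x y : R := 1 - x.1 * y.1 - x.2 * y.2.
(** Third coordinate of g (z,1): the denominator of the action, with the cocycle relation
    [vc_mul]. *)
Definition vc g z : R := g i2 i0 * z.1 + g i2 i1 * z.2 + g i2 i2.
(** Hyperbolic cosine of the distance from the centre to its image; it measures the size of g
    throughout. *)
Definition cx g : R := g i2 i2.
(** Determinant of the three lifts, that is, twice the signed area of the triangle. *)
Definition dt p q z : R :=
  (q.1 - p.1) * (z.2 - p.2) - (q.2 - p.2) * (z.1 - p.1).

Lemma bilxx z : bil z z = 1 - n2 z.
Proof. rewrite /bil /n2; ring. Qed.

Lemma bilC x y : bil x y = bil y x.
Proof. rewrite /bil; ring. Qed.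

Lemma n2_psub x y : n2 (psub x y) = 2 * bil x y - bil x x - bil y y.
Proof. rewrite /n2 /psub /bil /=; ring. Qed.

Lemma n2_ge0 z : 0 <= n2 z.
Proof. by rewrite addr_ge0 ?sqr_ge0. Qed.

Lemma n2_eq0 z : n2 z = 0 -> z = org.
Proof.
case: z => a b /eqP; rewrite /n2 /= paddr_eq0 ?sqr_ge0 // !sqrf_eq0.
by move=> /andP[/eqP -> /eqP ->].
Qed.

Lemma psub_eq0 x y : n2 (psub x y) = 0 -> x = y.
Proof.
by case: x y => [a b] [c d] /n2_eq0 [/eqP + /eqP]; rewrite !subr_eq0 => /eqP -> /eqP ->.
Qed.

Lemma n2_org : n2 org = 0.
Proof. by rewrite /n2 /= expr0n addr0. Qed.

Lemma disk_org : disk org.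
Proof. by rewrite /disk /= n2_org. Qed.

Lemma actE g z : act g z =
  ((g i0 i0 * z.1 + g i0 i1 * z.2 + g i0 i2) / vc g z,
   (g i1 i0 * z.1 + g i1 i1 * z.2 + g i1 i2) / vc g z).
Proof. by rewrite /act !mul_hom. Qed.

Lemma cx_gt0 g : SO21p g -> 0 < cx g.
Proof. by case=> _ []. Qed.

Lemma row3 g : SO21p g -> g i2 i0 ^+ 2 + g i2 i1 ^+ 2 = cx g ^+ 2 - 1.
Proof.
by move=> sg; have := SO21_row sg i2 i2; rewrite Jform_diag !eqxx /cx => ?; nra.
Qed.

Lemma col3 g : SO21p g -> g i0 i2 ^+ 2 + g i1 i2 ^+ 2 = cx g ^+ 2 - 1.
Proof.
by move=> sg; have := SO21_col sg i2 i2; rewrite Jform_diag !eqxx /cx => ?; nra.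
Qed.

Lemma cx_ge1 g : SO21p g -> 1 <= cx g.
Proof.
move=> sg; have := row3 sg; have := cx_gt0 sg.
have := sqr_ge0 (g i2 i0); have := sqr_ge0 (g i2 i1); nra.
Qed.

Lemma cauchy2 (a b c d : R) : (a * c + b * d) ^+ 2 <= (a ^+ 2 + b ^+ 2) * (c ^+ 2 + d ^+ 2).
Proof. by have := sqr_ge0 (a * d - b * c); nra. Qed.

(** By [row3] the spatial part of the last row is shorter than [cx g]; Cauchy-Schwarz keeps the
    denominator positive up to the circle. *)
Lemma vc_gt0 g z : SO21p g -> n2 z <= 1 -> 0 < vc g z.
Proof.
move=> sg z1; rewrite /vc.
have := cauchy2 (g i2 i0) (g i2 i1) z.1 z.2; rewrite (row3 sg) -/(n2 z).
have := cx_ge1 sg; rewrite /cx; set s := _ + _ * z.2; set c := g i2 i2 => c1 s2.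
have c2 : 0 <= c ^+ 2 - 1 by nra.
have : s ^+ 2 < c ^+ 2 by have := n2_ge0 z; nra.
by nra.
Qed.

(** g preserves the Lorentz form on lifts; returning to the affine chart divides by the two
    denominators. *)
Lemma bil_act g x y : SO21p g -> n2 x <= 1 -> n2 y <= 1 ->
  bil (act g x) (act g y) * (vc g x * vc g y) = bil x y.
Proof.
move=> sg x1 y1.
have vx := lt0r_neq0 (vc_gt0 sg x1); have vy := lt0r_neq0 (vc_gt0 sg y1).
rewrite !actE.
have -> (a b c d : R) : bil (a / vc g x, b / vc g x) (c / vc g y, d / vc g y)
    * (vc g x * vc g y) = vc g x * vc g y - a * c - b * d.
  by rewrite /bil /=; field; rewrite vx vy.
transitivity (- (x.1 * y.1 * Jform R i0 i0 + x.1 * y.2 * Jform R i0 i1 + x.1 * Jform R i0 i2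
  + x.2 * y.1 * Jform R i1 i0 + x.2 * y.2 * Jform R i1 i1 + x.2 * Jform R i1 i2
  + y.1 * Jform R i2 i0 + y.2 * Jform R i2 i1 + Jform R i2 i2)).
  by rewrite -!(SO21_col sg) /vc; ring.
by rewrite !Jform_diag ?eqxx ?neq_ord3 /bil; ring.
Qed.

Lemma n2_act g z : SO21p g -> n2 z <= 1 ->
  (1 - n2 (act g z)) * vc g z ^+ 2 = 1 - n2 z.
Proof. by move=> sg z1; rewrite -!bilxx -(bil_act sg z1 z1) expr2. Qed.

Lemma n2_act_le1 g z : SO21p g -> n2 z <= 1 -> n2 (act g z) <= 1.
Proof.
move=> sg z1; have := n2_act sg z1; have := vc_gt0 sg z1.
set v := vc g z => v0 e; rewrite -subr_ge0 -(pmulr_lge0 _ (exprn_gt0 2 v0)) e.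
by rewrite subr_ge0.
Qed.

Lemma disk_le1 z : disk z -> n2 z <= 1.
Proof. exact: ltW. Qed.

Lemma disk_act g z : SO21p g -> disk z -> disk (act g z).
Proof.
move=> sg dz; have z1 := disk_le1 dz; have := n2_act sg z1; have := vc_gt0 sg z1.
rewrite /disk /= in dz *.
set v := vc g z => v0 e; rewrite -subr_gt0 -(pmulr_lgt0 _ (exprn_gt0 2 v0)) e.
by rewrite subr_gt0.
Qed.

Lemma circ_act g z : SO21p g -> n2 z = 1 -> n2 (act g z) = 1.
Proof.
move=> sg dz; have z1 : n2 z <= 1 by rewrite dz.
have := n2_act sg z1; have := vc_gt0 sg z1.
rewrite dz subrr => v0 /eqP; rewrite mulf_eq0 expf_eq0 /= (gt_eqF v0) orbF subr_eq0.
by move=> /eqP <-.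
Qed.

(** The determinant of three lifts is multiplied by [\det g], which is 1. *)
Lemma dt_act g p q z : SO21p g -> n2 p <= 1 -> n2 q <= 1 -> n2 z <= 1 ->
  dt (act g p) (act g q) (act g z) * (vc g p * vc g q * vc g z) = dt p q z.
Proof.
move=> sg p1 q1 z1.
have vp := lt0r_neq0 (vc_gt0 sg p1); have vq := lt0r_neq0 (vc_gt0 sg q1).
have vz := lt0r_neq0 (vc_gt0 sg z1).
have := sg.2.1; rewrite det3 => d1.
rewrite -[RHS]mul1r -d1 !actE /dt /=.
have -> (a b c d a' b' : R) : ((c / vc g q - a / vc g p) * (b' / vc g z - b / vc g p)
    - (d / vc g q - b / vc g p) * (a' / vc g z - a / vc g p)) * (vc g p * vc g q * vc g z)
  = c * b' * vc g p - c * b * vc g z - a * b' * vc g q - d * a' * vc g p + d * a * vc g z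
    + b * a' * vc g q.
  by field; rewrite vp vq vz.
by rewrite /vc; ring.
Qed.

Lemma vc_mul g h z : SO21p h -> n2 z <= 1 ->
  vc (g *m h) z = vc g (act h z) * vc h z.
Proof.
move=> sh z1; have vz := lt0r_neq0 (vc_gt0 sh z1).
rewrite actE.
have -> (a b : R) : vc g (a / vc h z, b / vc h z) * vc h z
    = g i2 i0 * a + g i2 i1 * b + g i2 i2 * vc h z by rewrite {1}/vc /=; field.
by rewrite /vc !mulmx3; ring.
Qed.

Lemma SO21_mul g h : SO21p g -> SO21p h -> SO21p (g *m h).
Proof.
move=> sg sh; split; last split.
- by rewrite trmx_mul -!mulmxA (mulmxA _ g h) (mulmxA _ (_ *m g)) (mulmxA g^T) sg.1 !mulmxA sh.1.
- by rewrite det_mulmx sg.2.1 sh.2.1 mulr1.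
- have o1 : n2 org <= 1 by rewrite n2_org ler01.
  have := vc_mul g sh o1.
  rewrite {1}/vc /= !mulr0 !add0r => ->.
  by rewrite mulr_gt0 ?vc_gt0 // n2_act_le1.
Qed.

Lemma act_mul g h z : SO21p g -> SO21p h -> n2 z <= 1 ->
  act (g *m h) z = act g (act h z).
Proof.
move=> sg sh z1; have vz := lt0r_neq0 (vc_gt0 sh z1).
have vhz := lt0r_neq0 (vc_gt0 sg (n2_act_le1 sh z1)).
rewrite [act g _]actE [act (g *m h) _]actE vc_mul //.
have [A1 A2] : (act h z).1 * vc h z = h i0 i0 * z.1 + h i0 i1 * z.2 + h i0 i2 /\
    (act h z).2 * vc h z = h i1 i0 * z.1 + h i1 i1 * z.2 + h i1 i2.
  by rewrite actE /= !mulfVK.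
have num i : (g *m h) i i0 * z.1 + (g *m h) i i1 * z.2 + (g *m h) i i2 =
    (g i i0 * (act h z).1 + g i i1 * (act h z).2 + g i i2) * vc h z.
  rewrite !mulrDl -[_ * _ * vc h z]mulrA -[_ * _.2 * vc h z]mulrA A1 A2 /vc !mulmx3.
  by ring.
by rewrite !num -!mulf_div divff // !mulr1.
Qed.

Lemma mx1E (i j : 'I_3) : (1%:M : 'M[R]_3) i j = (i == j)%:R.
Proof. by rewrite mxE. Qed.

Lemma act1 z : act 1%:M z = z.
Proof.
case: z => a b; rewrite actE /vc /= !mx1E ?eqxx ?neq_ord3.
by rewrite !mul1r !mul0r !addr0 !add0r divr1 divr1.
Qed.

Lemma SO21_V g : SO21p g -> SO21p (invmx g).
Proof.
move=> sg; split; last split.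
- have gJ := sg.1.
  rewrite -{1}gJ trmx_inv.
  rewrite !mulmxA mulVmx ?unitmx_tr ?SO21_unit // mul1mx -!mulmxA.
  by rewrite mulmxV ?SO21_unit // mulmx1.
- by rewrite det_inv sg.2.1 invr1.
- rewrite SO21_invE // eqxx; have := cx_gt0 sg; rewrite /cx; nra.
Qed.

Lemma actK g z : SO21p g -> n2 z <= 1 -> act (invmx g) (act g z) = z.
Proof. by move=> sg z1; rewrite -act_mul ?mulVmx ?SO21_unit ?act1 //; exact: SO21_V. Qed.

Lemma actVK g z : SO21p g -> n2 z <= 1 -> act g (act (invmx g) z) = z.
Proof. by move=> sg z1; rewrite -act_mul ?mulmxV ?SO21_unit ?act1 //; exact: SO21_V. Qed.

Lemma cxV g : SO21p g -> cx (invmx g) = cx g.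
Proof. by move=> sg; rewrite /cx SO21_invE // eqxx; ring. Qed.

Lemma vc_org g : vc g org = cx g.
Proof. by rewrite /vc /= !mulr0 !add0r. Qed.

(** Up to the signs of the form, the last row of g is [cx g] times the lift of [act (invmx g) org].
    Bounds on [vc] thus reduce to bounds on [bil]. *)
Lemma vcE g z : SO21p g -> vc g z = cx g * bil (act (invmx g) org) z.
Proof.
move=> sg; rewrite actE vc_org cxV //= !mulr0 !add0r !SO21_invE // ?eqxx ?neq_ord3.
have c0 := lt0r_neq0 (cx_gt0 sg).
by rewrite /bil /vc /=; rewrite /cx in c0 *; field.
Qed.

Lemma bil_bounds x y : n2 x <= 1 -> n2 y <= 1 ->
  bil x y <= 2 /\ (1 - n2 x) / 2 <= bil x y.
Proof.
move=> x1 y1; have c := cauchy2 x.1 x.2 y.1 y.2; rewrite -/(n2 x) -/(n2 y) in c.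
have x0 := n2_ge0 x; have y0 := n2_ge0 y; rewrite /bil -addrA -opprD.
set s := _ + _ in c *; have : s ^+ 2 <= n2 x by nra.
by move=> s2; split; nra.
Qed.

Lemma vc_le g z : SO21p g -> n2 z <= 1 -> vc g z <= 2 * cx g.
Proof.
move=> sg z1; rewrite vcE // mulrC ler_pM2r ?cx_gt0 //.
apply: (bil_bounds _ z1).1; apply: n2_act_le1; first exact: SO21_V.
by rewrite n2_org ler01.
Qed.

Lemma vc_ge g z : SO21p g -> n2 z <= 1 -> cx g * (1 - n2 z) / 2 <= vc g z.
Proof.
move=> sg z1; rewrite vcE // -mulrA ler_pM2l ?cx_gt0 // bilC.
apply: (bil_bounds z1 _).2; apply: n2_act_le1; first exact: SO21_V.
by rewrite n2_org ler01.
Qed.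

Lemma n2_act_org g : SO21p g -> cx g ^+ 2 * (1 - n2 (act g org)) = 1.
Proof.
move=> sg; have := @n2_act g org sg; rewrite n2_org vc_org subr0 mulrC; apply.
exact: ler01.
Qed.

(** At x = [act (invmx g) org] one has 1 - |x|^2 = [(cx g)^-2]; the resulting bound is uniform up to
    the circle, unlike [vc_ge]. *)
Lemma vc_geV g z : SO21p g -> n2 z <= 1 -> 1 <= 2 * cx g * vc g z.
Proof.
move=> sg z1; rewrite vcE //.
have gi := SO21_V sg; have := n2_act_org gi; rewrite cxV // => e.
have a1 : n2 (act (invmx g) org) <= 1 by apply: n2_act_le1 => //; rewrite n2_org ler01.
have [_ b] := bil_bounds a1 z1.
have c0 := cx_gt0 sg; nra.
Qed.

Lemma entry_le g i j : SO21p g -> `|g i j| <= cx g.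
Proof.
move=> sg; have c1 := cx_ge1 sg; rewrite -(@ler_pXn2r _ 2) ?nnegrE ?normr_ge0 ?(le_trans ler01 c1) //.
rewrite real_normK ?num_real //.
have := row3 sg; have := col3 sg.
have := SO21_col sg j j; rewrite Jform_diag eqxx.
have q (k l : 'I_3) := sqr_ge0 (g k l).
move: (q i0 j) (q i1 j) (q i2 i0) (q i2 i1) (q i0 i2) (q i1 i2).
rewrite /cx; move: i j; apply: ord3P; apply: ord3P; rewrite ?eqxx ?neq_ord3 => *; nra.
Qed.

(** Properness of the action in quantitative form: carrying a point of one ball into another bounds
    the size of g. Conversely, by [n2_bound], a bounded g cannot bring a point very near the circle
    back to a fixed ball. *)
Lemma cx_bound g z (a b : R) : SO21p g -> n2 z <= a -> n2 (act g z) <= b -> a < 1 -> b < 1 ->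
  cx g ^+ 2 * ((1 - b) * (1 - a) ^+ 2) <= 4.
Proof.
move=> sg za gzb a1 b1.
have z1 : n2 z <= 1 by lra.
have := n2_act sg z1; have := vc_ge sg z1; have := vc_gt0 sg z1; have c0 := cx_gt0 sg.
set v := vc g z; set c := cx g => v0 vge e.
have ca : c * (1 - a) <= 2 * v by nra.
have : (1 - b) * v ^+ 2 <= 1 by have := n2_ge0 z; have := sqr_ge0 v; nra.
have ca0 : 0 <= c * (1 - a) by rewrite mulr_ge0 ?(ltW c0) // subr_ge0 ltW.
have sq : (c * (1 - a)) ^+ 2 <= (2 * v) ^+ 2 by rewrite ler_pXn2r ?nnegrE // (le_trans ca0).
have b0 : 0 <= 1 - b by rewrite subr_ge0 ltW.
have := ler_wpM2l b0 sq; rewrite !exprMn; nra.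
Qed.

Lemma n2_bound g z (b : R) : SO21p g -> n2 z <= 1 -> n2 (act g z) <= b -> b <= 1 ->
  1 - b <= 4 * cx g ^+ 2 * (1 - n2 z).
Proof.
move=> sg z1 gzb b1.
have := n2_act sg z1; have := vc_geV sg z1; have := vc_gt0 sg z1; have c0 := cx_gt0 sg.
set v := vc g z; set c := cx g => v0 vge e.
have : 1 <= (2 * c * v) ^+ 2 by nra.
rewrite -e; have : 1 - b <= 1 - n2 (act g z) by lra.
set u := 1 - n2 _ => bu; have u0 : 0 <= u by lra.
by rewrite !exprMn; nra.
Qed.

Lemma lerp0 x y : lerp x y 0 = x.
Proof. by case: x y => [a b] [c d]; rewrite /lerp /=; congr (_, _); ring. Qed.

Lemma lerp1 x y : lerp x y 1 = y.
Proof. by case: x y => [a b] [c d]; rewrite /lerp /=; congr (_, _); ring. Qed.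

Lemma n2_lerp x y (t : R) :
  n2 (lerp x y t) = (1 - t) * n2 x + t * n2 y - t * (1 - t) * n2 (psub x y).
Proof. by rewrite /n2 /lerp /psub /=; ring. Qed.

Lemma n2_lerp_le x y (t a : R) : 0 <= t <= 1 -> n2 x <= a -> n2 y <= a ->
  n2 (lerp x y t) <= a.
Proof.
move=> /andP[t0 t1] xa ya; rewrite n2_lerp; have := n2_ge0 (psub x y).
have : 0 <= t * (1 - t) by nra.
by nra.
Qed.

Lemma disk_lerp x y (t : R) : 0 <= t <= 1 -> disk x -> disk y -> disk (lerp x y t).
Proof.
rewrite /disk /= => t01 dx dy.
have : n2 (lerp x y t) <= Num.max (n2 x) (n2 y) by rewrite n2_lerp_le // le_max lexx ?orbT.
by move=> /le_lt_trans; apply; rewrite gt_max dx dy.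
Qed.

Lemma vc_lerp g x y (t : R) : vc g (lerp x y t) = (1 - t) * vc g x + t * vc g y.
Proof. by rewrite /vc /lerp /=; ring. Qed.

(** Projective maps preserve segments; the weights live on the lifts and are rescaled by the
    denominators. *)
Lemma act_lerp g x y (t : R) : SO21p g -> 0 <= t <= 1 -> n2 x <= 1 -> n2 y <= 1 ->
  act g (lerp x y t) = lerp (act g x) (act g y) (t * vc g y / vc g (lerp x y t)).
Proof.
move=> sg t01 x1 y1.
have vx := lt0r_neq0 (vc_gt0 sg x1); have vy := lt0r_neq0 (vc_gt0 sg y1).
have vl := lt0r_neq0 (vc_gt0 sg (n2_lerp_le t01 x1 y1)).
rewrite !actE /lerp /=; rewrite -/(lerp x y t) vc_lerp in vl *.
by congr (_, _); field; rewrite vx vy vl.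
Qed.

Lemma act_lerp_ex g x y (t : R) : SO21p g -> 0 <= t <= 1 -> n2 x <= 1 -> n2 y <= 1 ->
  exists2 s, 0 <= s <= 1 & act g (lerp x y t) = lerp (act g x) (act g y) s.
Proof.
move=> sg t01 x1 y1; eexists; last exact: act_lerp.
have vx := vc_gt0 sg x1; have vy := vc_gt0 sg y1.
have vl := vc_gt0 sg (n2_lerp_le t01 x1 y1).
move/andP: t01 => [t0 t1].
rewrite divr_ge0 ?(ltW vl) ?mulr_ge0 ?(ltW vy) //= ler_pdivrMr // mul1r vc_lerp.
by rewrite lerDr mulr_ge0 ?(ltW vx) // subr_ge0.
Qed.

Lemma org_le1 : n2 org <= 1.
Proof. by rewrite n2_org ler01. Qed.

Lemma cx_submul g h : SO21p g -> SO21p h -> cx (g *m h) <= 2 * cx g * cx h.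
Proof.
move=> sg sh; have := vc_mul g sh org_le1; rewrite !vc_org => ->.
by rewrite ler_pM2r ?cx_gt0 //; apply: vc_le => //; apply: n2_act_le1 => //; exact: org_le1.
Qed.

End DiskAction.
Arguments org {R}.
Arguments org_le1 {R}.

(** * Chords, their side functions and the action on them *)

Section Geodesics.
Variable R : realType.
Implicit Types (g h : 'M[R]_3) (p q x y z u : pt R) (w : R * R) (t : R).

(* The signed Euclidean distance from [x] to the chord [w]. *)
Definition eside x w : R :=
  cos ((w.2 - w.1) / 2) - x.1 * cos ((w.1 + w.2) / 2) - x.2 * sin ((w.1 + w.2) / 2).
(** Half the Euclidean length of the chord. *)
Definition hsin w : R := sin ((w.2 - w.1) / 2).

Lemma eside_lerp x y t w : eside (lerp x y t) w = (1 - t) * eside x w + t * eside y w.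
Proof. by rewrite /eside /lerp /=; ring. Qed.

Lemma half_angles w : exists m d : R, [/\ w = (m - d, m + d), d = (w.2 - w.1) / 2 &
   m = (w.1 + w.2) / 2].
Proof.
by case: w => a b; exists ((a + b) / 2), ((b - a) / 2); split=> //=; congr (_, _); field.
Qed.

(** Base times height: this ties the side function to [dt], whose behaviour under the group is
    known. *)
Lemma dt_eside w x : dt (bpt w.1) (bpt w.2) x = 2 * hsin w * eside x w.
Proof.
rewrite /hsin /eside; have [m [d [-> /= _ _]]] := half_angles w.
have -> : (m + d - (m - d)) / 2 = d by field.
have -> : (m - d + (m + d)) / 2 = m by field.
rewrite /dt /bpt /= !cosB !sinB !cosD !sinD.
have e1 := cos2Dsin2 m; have e2 : sin m ^+ 2 = 1 - cos m ^+ 2 by rewrite -e1; ring.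
set c := cos m in e2 *; set s := sin m in e2 *.
transitivity (2 * sin d * ((c ^+ 2 + s ^+ 2) * cos d - x.1 * c - x.2 * s)); first by ring.
by rewrite e2; ring.
Qed.

Lemma n2_bpt (a : R) : n2 (bpt a) = 1.
Proof. by rewrite /n2 /= cos2Dsin2. Qed.

Lemma n2_bpt_le (a : R) : n2 (bpt a) <= 1.
Proof. by rewrite n2_bpt. Qed.

Lemma chord_sin (a b : R) : n2 (psub (bpt a) (bpt b)) = 4 * sin ((b - a) / 2) ^+ 2.
Proof.
have [m [d [[-> ->] /= _ _]]] := half_angles (a, b).
have -> : (m + d - (m - d)) / 2 = d by field.
rewrite /n2 /psub /bpt /= cosB sinB cosD sinD.
have e1 := cos2Dsin2 m; have e2 : sin m ^+ 2 = 1 - cos m ^+ 2 by rewrite -e1; ring.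
transitivity (4 * sin d ^+ 2 * (cos m ^+ 2 + sin m ^+ 2)); first by ring.
by rewrite e1 mulr1.
Qed.

Lemma chord_cos (a b : R) : n2 (psub (bpt a) (bpt b)) = 4 * (1 - eside org (a, b) ^+ 2).
Proof.
rewrite chord_sin /eside /= !mul0r !subr0; have := cos2Dsin2 ((b - a) / 2).
by set c := cos _; set s := sin _ => e; lra.
Qed.

Lemma hsin_gt0 w : Geo w -> 0 < hsin w.
Proof.
move=> [w0 [w12 w2]]; apply: sin_gt0_pi; apply/andP; split.
  by rewrite divr_gt0 // subr_gt0.
by rewrite ltr_pdivrMr // mulrC; lra.
Qed.

Lemma eside_end w : eside (bpt w.1) w = 0 /\ eside (bpt w.2) w = 0.
Proof.
rewrite /eside; have [m [d [-> /= _ _]]] := half_angles w.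
have -> : (m + d - (m - d)) / 2 = d by field.
have -> : (m - d + (m + d)) / 2 = m by field.
have e1 := cos2Dsin2 m; have e2 : sin m ^+ 2 = 1 - cos m ^+ 2 by rewrite -e1; ring.
split; rewrite ?cosB ?sinB ?cosD ?sinD.
  transitivity ((1 - (cos m ^+ 2 + sin m ^+ 2)) * cos d); first by ring.
  by rewrite e2; ring.
transitivity ((1 - (cos m ^+ 2 + sin m ^+ 2)) * cos d); first by ring.
by rewrite e2; ring.
Qed.

Lemma dt0_lerp p q z : p <> q -> dt p q z = 0 -> exists t, z = lerp p q t.
Proof.
move=> pq d0; have n0 : n2 (psub p q) != 0 by apply/eqP => /psub_eq0.
have nE : n2 (psub p q) = (p.1 - q.1) ^+ 2 + (p.2 - q.2) ^+ 2 by [].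
exists (((z.1 - p.1) * (q.1 - p.1) + (z.2 - p.2) * (q.2 - p.2)) / n2 (psub p q)).
set a := z.1 - p.1; set b := z.2 - p.2; set c := q.1 - p.1; set d := q.2 - p.2.
have d0' : c * b - d * a = 0 by rewrite -d0.
have nE' : n2 (psub p q) = c ^+ 2 + d ^+ 2 by rewrite nE /c /d; ring.
have [e1 e2] : (a * c + b * d) * c = a * n2 (psub p q) /\ (a * c + b * d) * d = b * n2 (psub p q).
  rewrite nE'; split.
    transitivity (a * (c ^+ 2 + d ^+ 2) + d * (c * b - d * a)); first by ring.
    by rewrite d0' mulr0 addr0.
  transitivity (b * (c ^+ 2 + d ^+ 2) - c * (c * b - d * a)); first by ring.
  by rewrite d0' mulr0 subr0.
rewrite [LHS]surjective_pairing /lerp; congr (_, _).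
  transitivity (p.1 + (a * c + b * d) * c / n2 (psub p q)); last by rewrite /c; ring.
  by rewrite e1 mulfK // /a; ring.
transitivity (p.2 + (a * c + b * d) * d / n2 (psub p q)); last by rewrite /d; ring.
by rewrite e2 mulfK // /b; ring.
Qed.

Lemma chord_in_disk p q t : n2 p = 1 -> n2 q = 1 -> disk (lerp p q t) -> 0 < t < 1.
Proof.
move=> p1 q1; rewrite /disk /= n2_lerp p1 q1; have := n2_ge0 (psub p q).
move=> n0 lt1; have t1 : 0 < t * (1 - t) by rewrite ltNge; apply/negP => ?; nra.
by apply/andP; split; nra.
Qed.

Lemma bpt_neq w : Geo w -> bpt w.1 <> bpt w.2.
Proof.
move=> /hsin_gt0 w0 e; have := chord_sin w.1 w.2.
rewrite e; have -> : n2 (psub (bpt w.2) (bpt w.2)) = 0.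
  by rewrite /n2 /psub /= !subrr expr0n addr0.
by move/esym/eqP; rewrite mulf_eq0 sqrf_eq0 -/(hsin w) (gt_eqF w0) orbF pnatr_eq0.
Qed.

Lemma onGeoP w x : Geo w -> onGeo w x <-> disk x /\ eside x w = 0.
Proof.
move=> gw; split=> [[dx [t [_ xE]]]|[dx e0]].
  by split=> //; rewrite xE eside_lerp !(eside_end w).1 !(eside_end w).2; ring.
have dt0 : dt (bpt w.1) (bpt w.2) x = 0 by rewrite dt_eside e0 mulr0.
have [t xE] := dt0_lerp (bpt_neq gw) dt0.
split=> //; exists t; split=> //.
have /andP[t0 t1] : 0 < t < 1 by apply: (chord_in_disk (n2_bpt w.1) (n2_bpt w.2)); rewrite -xE.
by rewrite !ltW.
Qed.

Lemma eside0_endpts w u : Geo w -> n2 u = 1 -> eside u w = 0 -> endpts w u.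
Proof.
move=> gw u1 eu; have dt0 : dt (bpt w.1) (bpt w.2) u = 0 by rewrite dt_eside eu mulr0.
have [t uE] := dt0_lerp (bpt_neq gw) dt0; move: u1; rewrite uE n2_lerp !n2_bpt.
have np : n2 (psub (bpt w.1) (bpt w.2)) != 0 by apply/eqP => /psub_eq0; exact: bpt_neq.
move=> e; have /eqP : t * (1 - t) * n2 (psub (bpt w.1) (bpt w.2)) = 0 by lra.
rewrite !mulf_eq0 (negbTE np) orbF => /orP[/eqP ->|].
  by left; rewrite lerp0.
by rewrite subr_eq0 => /eqP <-; right; rewrite lerp1.
Qed.

Lemma angle_ex u : n2 u = 1 -> exists a, [/\ 0 <= a, a < 2 * pi & bpt a = u].
Proof.
case: u => c s; rewrite /n2 /= => cs.
have c1 : -1 <= c <= 1 by have := sqr_ge0 s; nra.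
have [/andP[a0 api] ca] := acos_def c1.
have : sin (acos c) ^+ 2 = s ^+ 2 by have := cos2Dsin2 (acos c); rewrite ca; lra.
move=> /eqP; rewrite eqf_sqr => ss.
have p0 := pi_gt0 R.
have [s0|s0] := leP 0 s.
  exists (acos c); split=> //; first by lra.
  rewrite /bpt ca; congr (_, _).
  have sa := sin_ge0_pi (introT andP (conj a0 api)).
  by move: ss => /orP[/eqP //|/eqP e]; lra.
exists (2 * pi - acos c).
have sa := sin_ge0_pi (introT andP (conj a0 api)).
have sE : sin (acos c) = - s by move: ss => /orP[/eqP e|/eqP //]; lra.
have an0 : acos c != 0 by apply/eqP => e; move: sE; rewrite e sin0; lra.
have ap : 0 < acos c by rewrite lt0r an0.
split; [lra|lra|].
have -> : 2 * pi - acos c = - acos c + pi *+ 2 by rewrite mulr2n; lra.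
by rewrite /bpt cosD2pi sinD2pi cosN sinN ca sE opprK.
Qed.

Lemma geo_ex p q : n2 p = 1 -> n2 q = 1 -> p <> q -> exists2 w, Geo w & endpts w = [set p; q].
Proof.
move=> /angle_ex [a [a0 a1 <-]] /angle_ex [b [b0 b1 <-]] pq.
have [ab|ba|ab] := ltgtP a b.
- by exists (a, b).
- by exists (b, a) => //; rewrite /endpts setUC.
- by case: pq; rewrite ab.
Qed.

Lemma set2_eq (T : Type) (a b c d : T) : [set a; b] = [set c; d] ->
  (a = c /\ b = d) \/ (a = d /\ b = c).
Proof.
move=> e.
have : [set c; d] a by rewrite -e; left.
have : [set c; d] b by rewrite -e; right.
have : [set a; b] c by rewrite e; left.
have : [set a; b] d by rewrite e; right.
by rewrite /=; intuition congruence.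
Qed.

Lemma image_set2 (T U : Type) (f : T -> U) (a b : T) : f @` [set a; b] = [set f a; f b].
Proof. by rewrite image_setU !image_set1. Qed.

Lemma act_inj g x y : SO21p g -> n2 x <= 1 -> n2 y <= 1 -> act g x = act g y -> x = y.
Proof. by move=> sg x1 y1 e; rewrite -(actK sg x1) e actK. Qed.

Lemma gact_ex g w : SO21p g -> Geo w -> exists w', gact g w w'.
Proof.
move=> sg gw.
have [w' gw' e] : exists2 w', Geo w' & endpts w' = [set act g (bpt w.1); act g (bpt w.2)].
  apply: geo_ex; rewrite ?circ_act ?n2_bpt // => /act_inj.
  by move=> /(_ sg (n2_bpt_le _) (n2_bpt_le _)); exact: bpt_neq.
by exists w'; split=> //; rewrite e image_set2.
Qed.

Lemma gact_endpts g w w' : SO21p g -> gact g w w' ->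
  (bpt w'.1 = act g (bpt w.1) /\ bpt w'.2 = act g (bpt w.2)) \/
  (bpt w'.1 = act g (bpt w.2) /\ bpt w'.2 = act g (bpt w.1)).
Proof. by move=> sg [_]; rewrite /endpts image_set2; exact: set2_eq. Qed.

Lemma dtC p q z : dt q p z = - dt p q z.
Proof. by rewrite /dt; ring. Qed.

Lemma gact_hsin g w w' : SO21p g -> gact g w w' ->
  hsin w' ^+ 2 * (vc g (bpt w.1) * vc g (bpt w.2)) = hsin w ^+ 2.
Proof.
move=> sg gw.
have H (a b : R * R) : hsin a ^+ 2 = bil (bpt a.1) (bpt a.2) / 2.
  have := chord_sin a.1 a.2; rewrite n2_psub !bilxx !n2_bpt -/(hsin a) subrr !subr0 => e.
  by lra.
rewrite !H //.
have <- := bil_act sg (n2_bpt_le w.1) (n2_bpt_le w.2).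
by case: (gact_endpts sg gw) => -[-> ->]; rewrite ?[bil (act g (bpt w.2)) _]bilC; ring.
Qed.

(** The sign s records whether g exchanges the order of the endpoint angles. It is common to all x,
    so products of two side functions keep their sign. *)
Lemma gact_eside g w w' : SO21p g -> Geo w -> gact g w w' ->
  exists2 s : R, s = 1 \/ s = -1 &
  forall x, n2 x <= 1 -> exists2 k, 0 < k & eside x w = s * k * eside (act g x) w'.
Proof.
move=> sg gw gw'; have w0 := hsin_gt0 gw; have w0' := hsin_gt0 gw'.1.
have p0 := vc_gt0 sg (n2_bpt_le w.1); have q0 := vc_gt0 sg (n2_bpt_le w.2).
have [s s1 sE] : exists2 s : R, s = 1 \/ s = -1 & forall x,
    dt (act g (bpt w.1)) (act g (bpt w.2)) x = s * dt (bpt w'.1) (bpt w'.2) x.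
  case: (gact_endpts sg gw') => -[-> ->].
    by exists 1; [left|move=> x; rewrite mul1r].
  by exists (-1); [right|move=> x; rewrite mulN1r -dtC].
exists s => // x x1.
exists (hsin w' / hsin w * (vc g (bpt w.1) * vc g (bpt w.2) * vc g x)).
  by rewrite mulr_gt0 ?divr_gt0 // !mulr_gt0 // vc_gt0.
have := dt_act sg (n2_bpt_le w.1) (n2_bpt_le w.2) x1.
rewrite sE !dt_eside => e.
apply: (@mulfI _ (2 * hsin w)); first by rewrite mulf_neq0 ?pnatr_eq0 ?gt_eqF.
by rewrite -e; field; rewrite gt_eqF.
Qed.

Lemma gact_eside_sqr g w w' x : SO21p g -> Geo w -> gact g w w' -> n2 x <= 1 ->
  eside x w ^+ 2 = eside (act g x) w' ^+ 2 * (vc g (bpt w.1) * vc g (bpt w.2) * vc g x ^+ 2).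
Proof.
move=> sg gw gw' x1; have w0 := hsin_gt0 gw.
apply: (@mulfI _ (4 * hsin w ^+ 2)); first by rewrite mulf_neq0 ?pnatr_eq0 // expf_neq0 // gt_eqF.
have sE : dt (act g (bpt w.1)) (act g (bpt w.2)) (act g x) ^+ 2
    = (2 * hsin w' * eside (act g x) w') ^+ 2.
  rewrite -dt_eside; case: (gact_endpts sg gw') => -[-> ->] //.
  by rewrite [in RHS]dtC sqrrN.
transitivity ((2 * hsin w * eside x w) ^+ 2); first by ring.
rewrite -dt_eside -(dt_act sg (n2_bpt_le w.1) (n2_bpt_le w.2) x1) exprMn sE.
by rewrite -(gact_hsin sg gw'); ring.
Qed.

Lemma measurable_eside x : measurable_fun setT (eside x).
Proof.
have mc : measurable_fun setT (cos : R -> R) by exact: continuous_measurable_fun (@continuous_cos R).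
have ms : measurable_fun setT (sin : R -> R) by exact: continuous_measurable_fun (@continuous_sin R).
have m1 : measurable_fun setT (fun w : R * R => (w.2 - w.1) / 2).
  by apply: measurable_funM => //; apply: measurable_funB.
have m2 : measurable_fun setT (fun w : R * R => (w.1 + w.2) / 2).
  by apply: measurable_funM => //; apply: measurable_funD.
rewrite /eside; apply: measurable_funB; first apply: measurable_funB.
- exact: (measurableT_comp mc m1).
- by apply: measurable_funM => //; exact: (measurableT_comp mc m2).
- by apply: measurable_funM => //; exact: (measurableT_comp ms m2).
Qed.

Lemma mset_le (f g : R * R -> R) : measurable_fun setT f -> measurable_fun setT g ->
  measurable [set w | f w <= g w].
Proof. by move=> mf mg; rewrite -[X in measurable X]setTI; exact: measurable_fun_le. Qed.

Lemma mset_lt (f g : R * R -> R) : measurable_fun setT f -> measurable_fun setT g ->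
  measurable [set w | f w < g w].
Proof.
move=> mf mg; rewrite (_ : [set _ | _] = ~` [set w | g w <= f w]).
  by apply: measurableC; exact: mset_le.
by apply/seteqP; split=> w /=; [move=> h; apply/negP; rewrite -ltNge|move/negP; rewrite -ltNge].
Qed.

Lemma mset_eq (f g : R * R -> R) : measurable_fun setT f -> measurable_fun setT g ->
  measurable [set w | f w = g w].
Proof.
move=> mf mg; rewrite (_ : [set _ | _] = [set w | g w <= f w] `&` [set w | f w <= g w]).
  by apply: measurableI; exact: mset_le.
by apply/seteqP; split=> w /=; [move=> ->|move=> [a b]; apply/eqP; rewrite eq_le a b].
Qed.

Lemma measurable_Geo : measurable (@Geo R).
Proof.
rewrite (_ : @Geo R = [set w : R * R | 0 <= w.1] `&` ([set w | w.1 < w.2] `&` [set w | w.2 < 2 * pi])) //.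
apply: measurableI; first exact: mset_le.
by apply: measurableI; apply: mset_lt.
Qed.

End Geodesics.

(** * Sets of geodesics cut by a segment *)

Section CutSets.
Variable R : realType.
Implicit Types (g h : 'M[R]_3) (p q x y z u : pt R) (w : R * R) (t a : R).

(** The segment is taken with x and without y, and geodesics containing it are left out. This
    half-open convention gives exact additivity. *)
Definition hset x y : set (R * R) := [set w | Geo w /\
  (eside x w * eside y w < 0 \/ (eside x w = 0 /\ eside y w <> 0))].
(** The set [Tclosed x y] in terms of side functions, see [TclosedE]. *)
Definition dset x y : set (R * R) := [set w | Geo w /\
  eside x w * eside y w <= 0 /\ ~ (eside x w = 0 /\ eside y w = 0)].
(** For 0 <= a < 1, the geodesics meeting the closed ball [n2 <= a]: at the centre, the side
    function is up to sign the distance to the chord. *)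
Definition bset a : set (R * R) := [set w | Geo w /\ eside org w ^+ 2 <= a].

Lemma measurable_bset a : measurable (bset a).
Proof.
apply: measurableI; first exact: measurable_Geo.
by apply: mset_le => //; apply: measurable_funX; exact: measurable_eside.
Qed.

Lemma measurable_dset x y : measurable (dset x y).
Proof.
apply: measurableI; first exact: measurable_Geo.
have mx := measurable_eside x; have my := measurable_eside y.
apply: measurableI; first by apply: mset_le => //; apply: measurable_funM.
by apply: measurableC; apply: measurableI; apply: mset_eq.
Qed.

Lemma measurable_hset x y : measurable (hset x y).
Proof.
apply: measurableI; first exact: measurable_Geo.
have mx := measurable_eside x; have my := measurable_eside y.
apply: measurableU; first by apply: mset_lt => //; apply: measurable_funM.
by apply: measurableI; [|apply: measurableC]; apply: mset_eq.
Qed.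

Lemma eside0_org z w : eside z w = 0 -> eside org w ^+ 2 <= n2 z.
Proof.
rewrite /eside /= !mul0r !subr0 => /eqP; rewrite subr_eq0 subr_eq => /eqP ->.
have := cauchy2 z.1 z.2 (cos ((w.1 + w.2) / 2)) (sin ((w.1 + w.2) / 2)).
by rewrite cos2Dsin2 mulr1 addrC.
Qed.

Lemma cross_lerp x y w : eside x w * eside y w <= 0 -> ~ (eside x w = 0 /\ eside y w = 0) ->
  exists2 t, 0 <= t <= 1 & eside (lerp x y t) w = 0.
Proof.
set a := eside x w; set b := eside y w => ab n0.
have [a0|a0] := eqVneq a 0.
  by exists 0; rewrite ?lexx ?ler01 // lerp0.
have [b0|b0] := eqVneq b 0.
  by exists 1; rewrite ?lexx ?ler01 // lerp1.
have d0 : a - b != 0.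
  apply/eqP => e; have eb : a = b by lra.
  by move: ab; rewrite eb -expr2 => ab; case/negP: a0; rewrite eb -sqrf_eq0 eq_le ab sqr_ge0.
exists (a / (a - b)); last by rewrite eside_lerp -/a -/b; field.
have [ap|am] := ltP 0 a.
  have bm : b <= 0 by rewrite leNgt; apply/negP => ?; nra.
  have abp : 0 < a - b by lra.
  by apply/andP; split; [apply: divr_ge0; lra|rewrite ler_pdivrMr //; lra].
have am' : a < 0 by rewrite lt_neqAle a0.
have bp : 0 <= b by rewrite leNgt; apply/negP => ?; nra.
have abp : 0 < b - a by lra.
have -> : a / (a - b) = (- a) / (b - a) by field; rewrite d0 gt_eqF.
have na : 0 <= - a by lra.
by apply/andP; split; [apply: divr_ge0 => //; exact: ltW|rewrite ler_pdivrMr //; lra].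
Qed.

Lemma lerp_cross x y t w : 0 <= t <= 1 -> eside (lerp x y t) w = 0 -> eside x w * eside y w <= 0.
Proof.
rewrite eside_lerp => /andP[t0 t1]; set a := eside x w; set b := eside y w => e.
rewrite leNgt; apply/negP => ab.
have [t00|t00] := eqVneq t 0; first by rewrite t00 in e; nra.
have tp : 0 < t by rewrite lt0r t00.
have : (1 - t) * a ^+ 2 + t * (a * b) = 0 by rewrite -(mulr0 a) -e; ring.
by have := sqr_ge0 a; nra.
Qed.

Lemma dset_bset x y a : n2 x <= a -> n2 y <= a -> dset x y `<=` bset a.
Proof.
move=> xa ya w [gw [xy n0]]; split=> //.
have [t t01 e] := cross_lerp xy n0.
by apply: le_trans (eside0_org e) _; exact: n2_lerp_le.
Qed.

Lemma hset_dset x y : hset x y `<=` dset x y.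
Proof.
move=> w [gw [xy|[x0 y0]]]; split=> //; split; [exact: ltW| |by rewrite x0 mul0r|by case].
by move=> [x0 y0]; rewrite x0 mul0r ltxx in xy.
Qed.

(** What the closed set has in excess passes through y, hence meets the ball of y. *)
Lemma dset_hset x y : dset x y `<=` hset x y `|` dset y y `|` bset (n2 y).
Proof.
move=> w [gw [xy n0]].
have [y0|y0] := eqVneq (eside y w) 0; first by right; split=> //; exact: eside0_org.
left; left; split=> //; have [x0|x0] := eqVneq (eside x w) 0.
  by right; split=> //; apply/eqP.
by left; rewrite lt_neqAle mulf_neq0.
Qed.

Lemma dsetC x y : dset x y = dset y x.
Proof.
by apply/seteqP; split=> w [gw [xy n0]]; split=> //; rewrite mulrC; split=> //; move=> [? ?]; apply: n0.
Qed.

(** If the values a, b, c at x, y, z had ab > 0 and bc > 0, then (ab)(bc) = (ac) b^2 would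
    contradict ac <= 0. *)
Lemma dset_tri x y z : dset x z `<=` dset x y `|` dset y z.
Proof.
move=> w [gw]; rewrite /dset /setU /=.
set a := eside x w; set b := eside y w; set c := eside z w => -[ac n0].
have [b0|b0] := eqVneq b 0.
  have [a0|a0] := eqVneq a 0.
    right; rewrite b0 mul0r; split=> //; split=> // -[_ c0]; exact: n0.
  by left; rewrite b0 mulr0; split=> //; split=> // -[/eqP]; rewrite (negbTE a0).
have [ab|ab] := leP (a * b) 0.
  by left; split=> //; split=> // -[_ /eqP]; rewrite (negbTE b0).
right; split=> //; split; last by move=> [/eqP]; rewrite (negbTE b0).
rewrite leNgt; apply/negP => bc; have : 0 < (a * b) * (b * c) by rewrite mulr_gt0.
rewrite (_ : _ * _ = (a * c) * b ^+ 2); last by ring.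
by have := sqr_ge0 b; nra.
Qed.

(** A geodesic crossing exactly at the intermediate point is counted in the second half only. *)
Lemma hset_add x z t : 0 <= t <= 1 -> let y := lerp x z t in
  hset x z = hset x y `|` hset y z /\ hset x y `&` hset y z = set0.
Proof.
move=> /andP[t0 t1] y.
have yE w : eside y w = (1 - t) * eside x w + t * eside z w by rewrite eside_lerp.
have [t00|t00] := eqVneq t 0.
  have -> : y = x by rewrite /y t00 lerp0.
  have -> : hset x x = set0.
    rewrite -subset0 => w [gw [|[-> //]]]; have := sqr_ge0 (eside x w); rewrite expr2 => ? ?; lra.
  by rewrite set0U set0I.
have [t11|t11] := eqVneq t 1.
  have -> : y = z by rewrite /y t11 lerp1.
  have -> : hset z z = set0.
    rewrite -subset0 => w [gw [|[-> //]]]; have := sqr_ge0 (eside z w); rewrite expr2 => ? ?; lra.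
  by rewrite setU0 setI0.
have tp : 0 < t by rewrite lt0r t00.
have tp1 : 0 < 1 - t by rewrite subr_gt0 lt_neqAle t11.
split; last first.
  rewrite -subset0 => w [[gw xy] [_ yz]]; move: xy yz; rewrite yE.
  set a := eside x w; set b := eside z w; set c := (_ + _).
  have cE : c = (1 - t) * a + t * b by [].
  case=> [ac|[a0 c0]] [cb|[c00 b0]].
  - have : (1 - t) * (a * c) + t * (c * b) = c ^+ 2 by rewrite cE; ring.
    by have := sqr_ge0 c; nra.
  - by rewrite c00 mulr0 ltxx in ac.
  - have : t * b ^+ 2 = c * b by rewrite cE a0; ring.
    by have := sqr_ge0 b; nra.
  - by [].
apply/seteqP; split=> w.
  move=> [gw]; rewrite /hset /setU /= yE.
  set a := eside x w; set b := eside z w; set c := (_ + _).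
  have cE : c = (1 - t) * a + t * b by [].
  have [c0|c0] := eqVneq c 0.
    case=> [ab|[a0 b0]].
      by right; split=> //; right; split=> // b0; rewrite b0 mulr0 ltxx in ab.
    case: b0; apply/eqP; have : t * b == 0 by rewrite -c0 cE a0 mulr0 add0r.
    by rewrite mulf_eq0 (negbTE t00).
  case=> [ab|[a0 b0]]; last by left; split=> //; right; split=> //; apply/eqP.
  have [ac|ac] := ltP (a * c) 0; first by left; split=> //; left.
  right; split=> //; left.
  have : (c * b) * a ^+ 2 <= 0 by have := sqr_ge0 a; nra.
  have a2 : 0 < a ^+ 2 by rewrite lt0r sqr_ge0 sqrf_eq0 andbT; apply/eqP => a0; rewrite a0 mul0r ltxx in ab.
  rewrite pmulr_lle0 // lt_neqAle => ->; rewrite andbT mulf_neq0 //.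
  by apply/eqP => b0; rewrite b0 mulr0 ltxx in ab.
rewrite /hset /setU /= yE.
set a := eside x w; set b := eside z w; set c := (_ + _).
have cE : c = (1 - t) * a + t * b by [].
case=> -[gw h]; split=> //.
  case: h => [ac|[a0 c0]].
    left; have : (1 - t) * a ^+ 2 + t * (a * b) < 0 by move: ac; rewrite cE; nra.
    by have := sqr_ge0 a; nra.
  right; split=> // b0; apply: c0; rewrite cE a0 b0; ring.
case: h => [cb|[c0 b0]].
  left; have : (1 - t) * (a * b) + t * b ^+ 2 < 0 by move: cb; rewrite cE; nra.
  by have := sqr_ge0 b; nra.
left; have e : (1 - t) * (a * b) = - (t * b ^+ 2).
  have : c * b = 0 by rewrite c0 mul0r.
  by rewrite cE; nra.
have : 0 < t * b ^+ 2 by rewrite mulr_gt0 // lt0r sqr_ge0 sqrf_eq0 andbT; apply/eqP.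
by nra.
Qed.

Lemma gact_sign g w w' x y : SO21p g -> Geo w -> gact g w w' -> n2 x <= 1 -> n2 y <= 1 ->
  [/\ (eside (act g x) w' * eside (act g y) w' < 0) = (eside x w * eside y w < 0),
      (eside (act g x) w' * eside (act g y) w' <= 0) = (eside x w * eside y w <= 0),
      (eside (act g x) w' = 0) <-> (eside x w = 0) &
      (eside (act g y) w' = 0) <-> (eside y w = 0)].
Proof.
move=> sg gw gw' x1 y1; have [s s1 H] := gact_eside sg gw gw'.
have [k k0 ->] := H _ x1; have [l l0 ->] := H _ y1.
set a := eside _ w'; set b := eside _ w'.
have ss : s * s = 1 by case: s1 => ->; rewrite ?mulr1 ?mulrNN ?mulr1.
have s0 : s != 0 by apply/eqP => e; move: ss; rewrite e mulr0 => /eqP; rewrite eq_sym oner_eq0.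
have -> : s * k * a * (s * l * b) = (k * l) * (a * b).
  by transitivity ((s * s) * (k * l) * (a * b)); [ring|rewrite ss mul1r].
have kl : 0 < k * l by rewrite mulr_gt0.
rewrite (pmulr_rlt0 _ kl) (pmulr_rle0 _ kl); split=> //.
  split=> [->|/eqP]; first by rewrite mulr0.
  by rewrite !mulf_eq0 (negbTE s0) (gt_eqF k0) => /eqP.
split=> [->|/eqP]; first by rewrite mulr0.
by rewrite !mulf_eq0 (negbTE s0) (gt_eqF l0) => /eqP.
Qed.

(** Phrased through geodesics whose g-image lies in a given set, the shape in which [is_current]
    expresses invariance. *)
Lemma hset_act g x y : SO21p g -> n2 x <= 1 -> n2 y <= 1 ->
  [set w | Geo w /\ exists2 w', hset (act g x) (act g y) w' & gact g w w'] = hset x y.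
Proof.
move=> sg x1 y1; apply/seteqP; split=> w.
  move=> [gw [w' [gw' h] ww']]; split=> //.
  have [e1 _ e2 e3] := gact_sign sg gw ww' x1 y1; rewrite -e1.
  by case: h => [?|[? ?]]; [left|right; split; [apply/e2|move/e3]].
move=> [gw h]; split=> //; have [w' ww'] := gact_ex sg gw; exists w' => //; split; first exact: ww'.1.
have [e1 _ e2 e3] := gact_sign sg gw ww' x1 y1; rewrite e1.
by case: h => [?|[? ?]]; [left|right; split; [apply/e2|move/e3]].
Qed.

Lemma dset_act g x y : SO21p g -> n2 x <= 1 -> n2 y <= 1 ->
  [set w | Geo w /\ exists2 w', dset (act g x) (act g y) w' & gact g w w'] = dset x y.
Proof.
move=> sg x1 y1; apply/seteqP; split=> w.
  move=> [gw [w' [gw' [h n0]] ww']]; split=> //.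
  have [_ e1 e2 e3] := gact_sign sg gw ww' x1 y1; rewrite -e1; split=> //.
  by move=> [/e2 ? /e3 ?]; exact: n0.
move=> [gw [h n0]]; split=> //; have [w' ww'] := gact_ex sg gw; exists w' => //; split; first exact: ww'.1.
have [_ e1 e2 e3] := gact_sign sg gw ww' x1 y1; rewrite e1; split=> //.
by move=> [/e2 ? /e3 ?]; exact: n0.
Qed.

Lemma TclosedE x y : disk x -> disk y -> Tclosed x y = dset x y.
Proof.
move=> dx dy; apply/seteqP; split=> w.
  move=> [h ng].
  have gw : Geo w by case: h => [[[]|[]]|[]].
  split=> //; split; last first.
    by move=> [x0 y0]; apply: ng; split=> //; split; apply/(onGeoP _ gw).
  case: h => [[[_ [_ [_ [t [t01 ot]]]]]|[_ ox]]|[_ oy]].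
  - have [_ e] := (onGeoP _ gw).1 ot; apply: lerp_cross e.
    by move/andP: t01 => [? ?]; rewrite !ltW.
  - by have [_ ->] := (onGeoP _ gw).1 ox; rewrite mul0r.
  - by have [_ ->] := (onGeoP _ gw).1 oy; rewrite mulr0.
move=> [gw [xy n0]]; split; last first.
  by move=> [_ [/(onGeoP _ gw) [_ ?] /(onGeoP _ gw) [_ ?]]]; exact: n0.
have [x0|x0] := eqVneq (eside x w) 0; first by left; right; split=> //; apply/(onGeoP _ gw).
have [y0|y0] := eqVneq (eside y w) 0; first by right; split=> //; apply/(onGeoP _ gw).
left; left; split=> //; split; first by move/(onGeoP _ gw) => [_ /eqP]; rewrite (negbTE x0).
split; first by move/(onGeoP _ gw) => [_ /eqP]; rewrite (negbTE y0).
have [t t01 e] := cross_lerp xy n0; exists t; split; last first.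
  by apply/(onGeoP _ gw); split=> //; exact: disk_lerp.
move/andP: t01 => [t0 t1]; rewrite !lt_neqAle t0 t1 !andbT; apply/andP; split; apply/eqP => te.
  by move: e; rewrite -te lerp0 => /eqP; rewrite (negbTE x0).
by move: e; rewrite te lerp1 => /eqP; rewrite (negbTE y0).
Qed.

End CutSets.

(** * The pseudo-metric of a current and its half-open variant *)

Section CutMetrics.
Variable R : realType.
Variables (G : set 'M[R]_3) (r : R).
Hypothesis fG : fuchsian_surface_group G.
Hypothesis r1 : 1 / 2 <= r < 1.
Hypothesis cob : forall z, disk z -> exists2 g, G g & n2 (act g z) <= r.
Implicit Types (g h : 'M[R]_3) (p q x y z u : pt R) (w : R * R) (t a : R).

Lemma G_SO g : G g -> SO21p g. Proof. by case: fG => -[H _ _ _] _ /H. Qed.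
Lemma G_1 : G 1%:M. Proof. by case: fG => -[]. Qed.
Lemma G_M g h : G g -> G h -> G (g *m h). Proof. by case: fG => -[_ _ H _] _; exact: H. Qed.
Lemma G_V g : G g -> G (invmx g). Proof. by case: fG => -[_ _ _ H] _; exact: H. Qed.

Lemma G_disk g z : G g -> disk z -> disk (act g z).
Proof. by move=> /G_SO; exact: disk_act. Qed.

Section OneCurrent.
Variable eta : {measure set (R * R) -> \bar R}.

Definition hh x y : R := fine (eta (hset x y)).
Definition dd x y : R := fine (eta (dset x y)).
Definition mb a : R := fine (eta (bset a)).

Hypothesis ceta : is_current G eta.

(** By [chord_cos], meeting a ball means that the endpoints are at distance bounded below, which is
    the local finiteness condition. *)
Lemma bset_fin a : a < 1 -> (eta (bset a) < +oo)%E.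
Proof.
move=> a1; have [_ lf _] := ceta; have e0 : 0 < 4 * (1 - a) by lra.
have := lf _ e0; set A := (X in eta X) ; suff -> : bset a = A by [].
apply/seteqP; split=> w -[gw h]; split=> //; move: h; rewrite chord_cos -surjective_pairing; lra.
Qed.

Lemma sub_bset_fin a A : a < 1 -> measurable A -> A `<=` bset a -> eta A \is a fin_num.
Proof.
move=> a1 mA Aa; rewrite ge0_fin_numE //; apply: le_lt_trans (bset_fin a1).
by rewrite le_measure // inE //; exact: measurable_bset.
Qed.

Lemma dset_fin x y : disk x -> disk y -> eta (dset x y) \is a fin_num.
Proof.
move=> dx dy; apply: (@sub_bset_fin (Num.max (n2 x) (n2 y))).
- by rewrite gt_max dx dy.
- exact: measurable_dset.
- by apply: dset_bset; rewrite le_max lexx ?orbT.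
Qed.

Lemma hset_fin x y : disk x -> disk y -> eta (hset x y) \is a fin_num.
Proof.
move=> dx dy; apply: (@sub_bset_fin (Num.max (n2 x) (n2 y))).
- by rewrite gt_max dx dy.
- exact: measurable_hset.
- apply: subset_trans (@hset_dset _ _ _) _.
  by apply: dset_bset; rewrite le_max lexx ?orbT.
Qed.

Lemma hh_ge0 x y : 0 <= hh x y. Proof. exact: fine_ge0. Qed.
Lemma dd_ge0 x y : 0 <= dd x y. Proof. exact: fine_ge0. Qed.
Lemma mb_ge0 a : 0 <= mb a. Proof. exact: fine_ge0. Qed.

Lemma hh_le_dd x y : disk x -> disk y -> hh x y <= dd x y.
Proof.
move=> dx dy; apply: fine_le; rewrite ?hset_fin ?dset_fin //.
rewrite le_measure ?inE //; [exact: measurable_hset|exact: measurable_dset|exact: hset_dset].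
Qed.

Lemma dd_le_mb a x y : a < 1 -> n2 x <= a -> n2 y <= a -> dd x y <= mb a.
Proof.
move=> a1 xa ya; apply: fine_le.
- apply: dset_fin; rewrite /disk /=; lra.
- by rewrite (@sub_bset_fin a) //; exact: measurable_bset.
- rewrite le_measure ?inE //; [exact: measurable_dset|exact: measurable_bset|exact: dset_bset].
Qed.

Lemma dd_sym x y : dd x y = dd y x.
Proof. by rewrite /dd dsetC. Qed.

Lemma dd_tri x y z : disk x -> disk y -> disk z -> dd x z <= dd x y + dd y z.
Proof.
move=> dx dy dz; rewrite /dd -fineD ?dset_fin //; apply: fine_le.
- exact: dset_fin.
- by rewrite fin_numD !dset_fin.
have m1 := measurable_dset x y; have m2 := measurable_dset y z.
apply: le_trans (measureU2 eta m1 m2).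
rewrite le_measure ?inE //; [exact: measurable_dset|exact: measurableU|exact: dset_tri].
Qed.

Lemma hh_add x z t : disk x -> disk z -> 0 <= t <= 1 ->
  hh x z = hh x (lerp x z t) + hh (lerp x z t) z.
Proof.
move=> dx dz t01; have dy := disk_lerp t01 dx dz.
have [e1 e2] := hset_add x z t01.
rewrite /hh -fineD ?hset_fin // e1 measureU //; exact: measurable_hset.
Qed.

Lemma hh_act g x y : G g -> disk x -> disk y -> hh (act g x) (act g y) = hh x y.
Proof.
move=> Gg dx dy; have [_ _ inv] := ceta; rewrite /hh.
have := inv g (hset (act g x) (act g y)) Gg (@measurable_hset _ _ _).
rewrite hset_act ?disk_le1 //; last exact: G_SO.
by move=> -> // w [].
Qed.

Lemma dd_act g x y : G g -> disk x -> disk y -> dd (act g x) (act g y) = dd x y.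
Proof.
move=> Gg dx dy; have [_ _ inv] := ceta; rewrite /dd.
have := inv g (dset (act g x) (act g y)) Gg (@measurable_dset _ _ _).
rewrite dset_act ?disk_le1 //; last exact: G_SO.
by move=> -> // w [].
Qed.

Lemma dd_xx x : dd x x = 0.
Proof.
rewrite /dd (_ : dset x x = set0) ?measure0 // -subset0 => w [_ []].
rewrite -expr2 => h n0; apply: n0; suff /eqP : eside x w == 0 by [].
by rewrite -sqrf_eq0 eq_le h sqr_ge0.
Qed.

(** By invariance y may be moved into the fundamental ball; the geodesics through it then belong to
    [bset r], whatever x and y are. *)
Lemma dd_le_hh x y : disk x -> disk y -> dd x y <= hh x y + mb r.
Proof.
move=> dx dy; have [g Gg gy] := cob dy.
rewrite -(dd_act Gg dx dy) -(hh_act Gg dx dy).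
have dgx := G_disk Gg dx; have dgy := G_disk Gg dy.
set X := act g x in dgx *; set Y := act g y in dgy gy *.
have rb : eta (bset r) \is a fin_num.
  by rewrite (@sub_bset_fin r) //; [move/andP: r1 => []|exact: measurable_bset].
rewrite /dd /hh /mb -fineD ?hset_fin //; apply: fine_le; rewrite ?dset_fin //.
  by rewrite fin_numD hset_fin.
apply: le_trans (measureU2 eta (measurable_hset X Y) (measurable_bset r)).
rewrite le_measure ?inE //; [exact: measurable_dset|apply: measurableU|].
- exact: measurable_hset.
- exact: measurable_bset.
move=> w /dset_hset [[|[gw []]]|[gw b]]; [by left| |by right; split=> //; exact: le_trans gy].
rewrite -expr2 => h n0; exfalso; apply: n0; suff /eqP : eside Y w == 0 by [].
by rewrite -sqrf_eq0 eq_le h sqr_ge0.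
Qed.

Lemma d_etaE x y : disk x -> disk y -> d_eta eta x y = (dd x y)%:E.
Proof.
move=> dx dy; rewrite /d_eta; case: eqP => [->|_]; first by rewrite dd_xx.
by rewrite TclosedE // /dd fineK // dset_fin.
Qed.

End OneCurrent.
End CutMetrics.

(** * Finiteness of bounded parts of the group and freeness of its action *)

Section Discreteness.
Variable R : realType.
Variables (G : set 'M[R]_3) (r : R).
Hypothesis fG : fuchsian_surface_group G.
Hypothesis r1 : 1 / 2 <= r < 1.
Hypothesis cob : forall z, disk z -> exists2 g, G g & n2 (act g z) <= r.
Implicit Types (g h : 'M[R]_3) (p q x y z u : pt R) (w : R * R) (t a : R).

(** Discreteness at the identity is applied to [invmx g *m h]; the bound on [cx] bounds the entries
    of [invmx g], so each of the three products in an entry stays below e / 4. *)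
Lemma separated (B : R) : exists2 d : R, 0 < d & forall g h, G g -> G h -> cx g <= B ->
  (forall i j, `|g i j - h i j| < d) -> h = g.
Proof.
have [_ [disc _ _]] := fG; have [e e0 He] := disc _ (G_1 fG).
exists (e / (4 * (1 + `|B|))); first by rewrite divr_gt0 // mulr_gt0 //; have := normr_ge0 B; lra.
move=> g h Gg Gh gB gh.
have B0 : 0 < 1 + `|B| by have := normr_ge0 B; lra.
have cB : cx g <= 1 + `|B| by have := ler_norm B; lra.
have sg := G_SO fG Gg.
have : invmx g *m h = 1%:M.
  apply: He; first by apply: G_M => //; exact: G_V.
  move=> i j; rewrite -(mulVmx (SO21_unit sg)).
  have -> : (invmx g *m h) i j - (invmx g *m g) i j = (invmx g *m (h - g)) i j.
    by rewrite mulmxBr; move: (_ *m h) (_ *m g) => M1 M2; rewrite [in RHS]mxE [in RHS]mxE.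
  rewrite mulmx3.
  have b k : `|invmx g i k * (h - g) k j| < (1 + `|B|) * (e / (4 * (1 + `|B|))).
    rewrite normrM; have le1 : `|invmx g i k| <= 1 + `|B|.
      by apply: le_trans (entry_le _ _ (SO21_V sg)) _; rewrite cxV.
    have lt2 : `|(h - g) k j| < e / (4 * (1 + `|B|)).
      by rewrite mxE [X in _ + X]mxE distrC.
    by apply: le_lt_trans (ler_wpM2r (normr_ge0 _) le1) _; rewrite ltr_pM2l.
  have E : (1 + `|B|) * (e / (4 * (1 + `|B|))) = e / 4 by field; rewrite gt_eqF.
  rewrite E in b; apply: le_lt_trans (ler_normD _ _) _.
  have := ler_normD (invmx g i i0 * (h - g) i0 j) (invmx g i i1 * (h - g) i1 j).
  have := b i0; have := b i1; have := b i2; lra.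
by move=> e1; rewrite -[h]mul1mx -(mulmxV (SO21_unit sg)) -mulmxA e1 mulmx1.
Qed.

(** Pigeonhole: the entries lie in a bounded interval cut into cells of the separation length d, and
    an element is determined by the cells of its entries. *)
Lemma finite_cx (B : R) : exists s : seq 'M[R]_3, forall g, G g -> cx g <= B -> g \in s.
Proof.
have [d d0 sep] := separated B.
pose B' := 1 + `|B|.
have B0 : 0 < B' by have := normr_ge0 B; rewrite /B'; lra.
have BB : B <= B' by have := ler_norm B; rewrite /B'; lra.
pose N := Num.truncn (2 * B' / d).
pose f g : {ffun 'I_3 * 'I_3 -> 'I_N.+1} := [ffun ij => inord (Num.truncn ((g ij.1 ij.2 + B') / d))].
pose S := [set g | G g /\ cx g <= B].
(* The value [None] outside S makes S the preimage of a finite set under a map that is injective on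
   it. *)
pose F g := if `[< S g >] then Some (f g) else None.
have finj g h : S g -> S h -> f g = f h -> g = h.
  move=> [Gg gB] [Gh hB] e; apply/esym/(sep g h Gg Gh gB) => i j.
  have lo (k : 'M[R]_3) : S k -> 0 <= (k i j + B') / d <= 2 * B' / d.
    move=> [Gk kB]; have := entry_le i j (G_SO fG Gk); rewrite ler_norml => /andP[k1 k2].
    by apply/andP; split; [apply: divr_ge0; [lra|exact: ltW]|rewrite ler_pM2r ?invr_gt0 //; lra].
  have tb (k : 'M[R]_3) : S k -> (Num.truncn ((k i j + B') / d) < N.+1)%N.
    by move=> Sk; rewrite ltnS; apply: le_truncn; case/andP: (lo _ Sk).
  have := congr1 (fun u : {ffun _ -> _} => val (u (i, j))) e.
  rewrite !ffunE /= !inordK; [|by apply: tb..].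
  have /andP[l1 _] := lo g (conj Gg gB); have /andP[l2 _] := lo h (conj Gh hB).
  have /andP[] := truncn_itv l1; have /andP[] := truncn_itv l2.
  move=> + + + + te; rewrite te; set n := Num.truncn _.
  rewrite -natr1; set m := n%:R.
  rewrite !ltr_pdivrMr // !ler_pdivlMr // => a1 a2 a3 a4.
  rewrite ltr_norml; apply/andP; split; nra.
have : finite_set S.
  rewrite (_ : S = F @^-1` [set x | x <> None]).
    apply: finite_preimage; last exact: finite_finset.
    move=> g h; rewrite !inE /= /F; case: asboolP => //; case: asboolP => // Sh Sg _ _ [].
    exact: finj.
  by apply/seteqP; split=> g /=; rewrite /F; case: asboolP.
by move=> /finite_seqP[s sE]; exists s => g Gg gB; have : S g by []; rewrite sE.
Qed.

Lemma finite_unif (T : eqType) (s : seq T) (P : T -> R -> Prop) :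
  (forall i a b, P i a -> b <= a -> P i b) -> (forall i, i \in s -> exists2 e, 0 < e & P i e) ->
  exists2 e, 0 < e & forall i, i \in s -> P i e.
Proof.
move=> anti; elim: s => [|x s IH] H; first by exists 1.
have [e e0 He] := IH (fun j js => H j (@mem_behead _ (x :: s) j js)).
have [e' e0' He'] := H x (mem_head _ _).
exists (Num.min e e'); first by rewrite lt_min e0 e0'.
move=> y; rewrite inE => /orP[/eqP ->|ys].
  by apply: anti He' _; rewrite ge_min lexx orbT.
by apply: anti (He _ ys) _; rewrite ge_min lexx.
Qed.

Definition gpow g n : 'M[R]_3 := iter n (mulmx g) 1%:M.

Lemma gpowS g n : gpow g n.+1 = g *m gpow g n. Proof. by []. Qed.

Lemma gpowD g n m : gpow g (n + m) = gpow g n *m gpow g m.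
Proof. by elim: n => [|n IH]; rewrite ?mul1mx // addSn !gpowS IH mulmxA. Qed.

Lemma gpowE g n : gpow g n = g ^+ n.
Proof. by elim: n => [|n IH]; rewrite ?expr0 // gpowS IH exprS mulmxE. Qed.

Lemma G_pow g n : G g -> G (gpow g n).
Proof. by move=> Gg; elim: n => [|n IH]; [exact: G_1|exact: G_M]. Qed.

(** All powers of g fix z, so their sizes are bounded and two of them coincide; g is torsion, hence
    trivial. *)
Lemma fix_disk g z : G g -> disk z -> act g z = z -> g = 1%:M.
Proof.
move=> Gg dz gz; have sg := G_SO fG Gg.
have gnz n : act (gpow g n) z = z.
  elim: n => [|n IH]; first exact: act1.
  by rewrite gpowS act_mul ?disk_le1 ?IH //; exact: (G_SO fG (G_pow n Gg)).
pose D := (1 - n2 z) ^+ 3.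
have D0 : 0 < D by rewrite exprn_gt0 // subr_gt0.
have cb n : cx (gpow g n) <= 4 / D.
  have sn := G_SO fG (G_pow n Gg).
  have := @cx_bound _ (gpow g n) z (n2 z) (n2 z) sn (lexx _); rewrite gnz => /(_ (lexx _) dz dz).
  rewrite -exprS -/D => h; rewrite ler_pdivlMr //.
  have := cx_ge1 sn; nra.
have [s sP] := finite_cx (4 / D).
have [inj|ninj] := pselect (injective (fun n => gpow g n)).
  exfalso; apply: infinite_nat; rewrite (_ : setT = (fun n => gpow g n) @^-1` [set` s]).
    by apply: finite_preimage; [move=> a b _ _; exact: inj|apply/finite_seqP; exists s].
  by apply/seteqP; split=> // n _ /=; apply: sP => //; exact: G_pow.
have [n [m [nm e]]] : exists n m, (n < m)%N /\ gpow g n = gpow g m.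
  apply: contrapT => H; apply: ninj => n m e.
  by have [h|h|//] := ltngtP n m; exfalso; apply: H; [exists n, m|exists m, n].
have [_ [_ _ tf]] := fG; apply: (tf g (m - n).-1 Gg).
rewrite prednK ?subn_gt0 // -gpowE.
have un : gpow g n \in unitmx := SO21_unit (G_SO fG (G_pow n Gg)).
have : gpow g n *m gpow g (m - n) = gpow g n *m 1%:M.
  by rewrite mulmx1 -gpowD subnKC // ltnW.
by move=> /(congr1 (mulmx (invmx (gpow g n)))); rewrite !mulmxA mulVmx // !mul1mx.
Qed.

End Discreteness.

(** * Uniform constants from compactness of the closed disk *)

Section Covering.
Variable R : realType.
Implicit Types (p x y z u : R * R).

Lemma sq2_cvg (T : Type) (F : set_system T) (FF : Filter F) (f1 f2 : T -> R) (a b : R) :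
  f1 @ F --> a -> f2 @ F --> b -> (f1 x ^+ 2 + f2 x ^+ 2) @[x --> F] --> a ^+ 2 + b ^+ 2.
Proof.
move=> c1 c2; apply: cvgD.
  by apply: (@cvg_comp _ _ _ f1 (fun u : R => u ^+ 2) _ (nbhs a)); [|exact: exprn_continuous].
by apply: (@cvg_comp _ _ _ f2 (fun u : R => u ^+ 2) _ (nbhs b)); [|exact: exprn_continuous].
Qed.

Lemma coord_cvg (x y : R * R) :
  [/\ s.1.1 @[s --> (x, y)] --> x.1, s.1.2 @[s --> (x, y)] --> x.2,
      s.2.1 @[s --> (x, y)] --> y.1 & s.2.2 @[s --> (x, y)] --> y.2].
Proof.
have f1 : fst @ (nbhs (x, y)) --> nbhs x by exact: cvg_fst.
have f2 : snd @ (nbhs (x, y)) --> nbhs y by exact: cvg_snd.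
by split; [apply: cvg_comp f1 _; exact: cvg_fst|apply: cvg_comp f1 _; exact: cvg_snd
  |apply: cvg_comp f2 _; exact: cvg_fst|apply: cvg_comp f2 _; exact: cvg_snd].
Qed.

(** The compact box contains pairs outside the disk; near these the property holds vacuously, as
    [n2 > 1] is an open condition. *)
Lemma cball_cover (P : R * R -> R * R -> R -> Prop) :
  (forall x y (a b : R), P x y a -> b <= a -> P x y b) ->
  (forall x y, n2 x <= 1 -> n2 y <= 1 -> exists2 e : R, 0 < e &
     \forall s \near (x, y), n2 s.1 <= 1 -> n2 s.2 <= 1 -> P s.1 s.2 e) ->
  exists2 e : R, 0 < e & forall x y, n2 x <= 1 -> n2 y <= 1 -> P x y e.
Proof.
move=> anti loc.
pose J : set R := [set` `[-1, 1]%R].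
pose K : set ((R * R) * (R * R)) := (J `*` J) `*` (J `*` J).
have cJ : compact J := @segment_compact _ _ _.
have cK : compact K by apply: compact_setX; apply: compact_setX.
pose Q (e : R) (s : (R * R) * (R * R)) := n2 s.1 <= 1 -> n2 s.2 <= 1 -> P s.1 s.2 e.
have loc' s : K s -> \forall s' \near s & e \near (0^'+ : set_system R), Q e s'.
  case: s => x y _; have [c1 c2 c3 c4] := coord_cvg x y.
  have [x1|x1] := leP (n2 x) 1; last first.
    have H : \forall s \near (x, y), 1 < n2 s.1.
      have c : n2 s.1 @[s --> (x, y)] --> n2 x by exact: sq2_cvg.
      by move/cvgr_gt: c; apply.
    near=> s e.
    have h' : 1 < n2 s.1 by near: s.
    by move=> h; rewrite ltNge h in h'.
  have [y1|y1] := leP (n2 y) 1; last first.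
    have H : \forall s \near (x, y), 1 < n2 s.2.
      have c : n2 s.2 @[s --> (x, y)] --> n2 y by exact: sq2_cvg.
      by move/cvgr_gt: c; apply.
    near=> s e.
    have h' : 1 < n2 s.2 by near: s.
    by move=> _ h; rewrite ltNge h in h'.
  have [e0 e0p H] := loc _ _ x1 y1.
  near=> s e.
  have h' : n2 s.1 <= 1 -> n2 s.2 <= 1 -> P s.1 s.2 e0 by near: s.
  have ee : e <= e0 by near: e; exact: nbhs_right_le.
  by move=> s1 s2; exact: anti (h' s1 s2) ee.
move/compact_near_coveringP: cK => /(_ R (0^'+) Q _ loc') H.
have [e [e0 He]] := filter_ex (filterI (nbhs_right_gt (0 : R)) H).
exists e => // x y x1 y1.
have box z : n2 z <= 1 -> (J `*` J) z.
  rewrite /n2 /J => z1; split; rewrite /= in_itv /=; have := sqr_ge0 z.1; have := sqr_ge0 z.2;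
  by move=> ? ?; apply/andP; split; nra.
by apply: (He (x, y)) => //; split; exact: box.
Unshelve. all: by end_near.
Qed.

End Covering.

(** * Uniform displacement and absence of parabolic elements *)

Section Hyperbolic.
Variable R : realType.
Implicit Types (g h k : 'M[R]_3) (p q x y z u : pt R) (t a b c : R).

Lemma affine_continuous a b c : continuous (fun z : R * R => a * z.1 + b * z.2 + c).
Proof.
move=> z; apply: cvgD; last exact: cvg_cst.
by apply: cvgD; apply: cvgM; [exact: cvg_cst|exact: cvg_fst|exact: cvg_cst|exact: cvg_snd].
Qed.

Lemma act_cvg h x : SO21p h -> n2 x <= 1 ->
  ((act h z).1 @[z --> (x : R * R)] --> (act h x).1) /\
  ((act h z).2 @[z --> (x : R * R)] --> (act h x).2).
Proof.
move=> sh x1; have v0 := lt0r_neq0 (vc_gt0 sh x1).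
have cv : vc h z @[z --> (x : R * R)] --> vc h x by exact: affine_continuous.
split.
  rewrite (_ : (fun z => (act h z).1) = fun z => (h i0 i0 * z.1 + h i0 i1 * z.2 + h i0 i2) / vc h z).
    rewrite actE /=; apply: cvgM; first exact: affine_continuous.
    exact: cvgV.
  by apply/funext => z; rewrite actE.
rewrite (_ : (fun z => (act h z).2) = fun z => (h i1 i0 * z.1 + h i1 i1 * z.2 + h i1 i2) / vc h z).
  rewrite actE /=; apply: cvgM; first exact: affine_continuous.
  exact: cvgV.
by apply/funext => z; rewrite actE.
Qed.

Lemma displacement_cvg h x : SO21p h -> n2 x <= 1 ->
  n2 (psub (act h z) z) @[z --> (x : R * R)] --> n2 (psub (act h x) x).
Proof.
move=> sh x1; have [c1 c2] := act_cvg sh x1; rewrite /n2 /psub /=.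
apply: cvgD.
  by apply: (@cvg_comp _ _ _ (fun z : R * R => (act h z).1 - z.1) (fun u : R => u ^+ 2) _
    (nbhs ((act h x).1 - x.1))); [apply: cvgB => //; exact: cvg_fst|exact: exprn_continuous].
by apply: (@cvg_comp _ _ _ (fun z : R * R => (act h z).2 - z.2) (fun u : R => u ^+ 2) _
    (nbhs ((act h x).2 - x.2))); [apply: cvgB => //; exact: cvg_snd|exact: exprn_continuous].
Qed.

(** Minus the Lorentz product of (x,1) and g (y,1), polynomial in both points. On the diagonal,
    divided by [bil z z], it is the hyperbolic cosine of the displacement of z. *)
Definition nform g x y : R := vc g y
  - x.1 * (g i0 i0 * y.1 + g i0 i1 * y.2 + g i0 i2)
  - x.2 * (g i1 i0 * y.1 + g i1 i1 * y.2 + g i1 i2).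

Lemma nformE g x y : SO21p g -> n2 y <= 1 -> nform g x y = bil x (act g y) * vc g y.
Proof.
move=> sg y1; have v0 := lt0r_neq0 (vc_gt0 sg y1).
rewrite /nform actE /bil /= !mulrBl mul1r.
by congr (_ - _ - _); field.
Qed.

Lemma nform_lerp g x y t : nform g (lerp x y t) (lerp x y t) =
  (1 - t) ^+ 2 * nform g x x + t * (1 - t) * (nform g x y + nform g y x) + t ^+ 2 * nform g y y.
Proof. by rewrite /nform /vc /lerp /=; ring. Qed.

(** The reversed Cauchy-Schwarz inequality of Lorentz geometry with its remainder, which detects
    Euclidean displacement. *)
Lemma rev_cauchy z u : bil z u ^+ 2 = bil z z * bil u u + (1 - n2 z) * n2 (psub z u)
  + (z.1 * (u.1 - z.1) + z.2 * (u.2 - z.2)) ^+ 2.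
Proof. by rewrite /bil /n2 /psub /=; ring. Qed.

Lemma vc1 z : vc 1%:M z = 1.
Proof. by rewrite /vc !mx1E !eqxx !neq_ord3 /= !mul0r !add0r. Qed.

Lemma vcVK k z : SO21p k -> n2 z <= 1 -> vc (invmx k) (act k z) * vc k z = 1.
Proof. by move=> sk z1; rewrite -vc_mul // mulVmx ?SO21_unit // vc1. Qed.

Lemma nform_conj k g z : SO21p k -> SO21p g -> n2 z <= 1 ->
  nform (k *m g *m invmx k) (act k z) (act k z) * vc k z ^+ 2 = nform g z z.
Proof.
move=> sk sg z1; have sV := SO21_V sk; have kz1 := n2_act_le1 sk z1.
have skg := SO21_mul sk sg; have gz1 := n2_act_le1 sg z1.
rewrite !nformE //; last exact: SO21_mul.
rewrite act_mul // actK // act_mul // vc_mul // actK // vc_mul //.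
rewrite -(bil_act sk z1 gz1); have := vcVK sk z1.
set a := bil _ _; set b := vc k (act g z); set c := vc g z; set d := vc k z; set e := vc _ _.
by move=> ed; transitivity (a * (d * b) * c * (e * d)); [ring|rewrite ed mulr1].
Qed.

Section Group.
Variables (G : set 'M[R]_3) (r : R).
Hypothesis fG : fuchsian_surface_group G.
Hypothesis r1 : 1 / 2 <= r < 1.
Hypothesis cob : forall z, disk z -> exists2 g, G g & n2 (act g z) <= r.

Lemma G_conj k g : G k -> G g -> G (k *m g *m invmx k).
Proof. by move=> Gk Gg; apply: G_M (G_V fG Gk) => //; exact: G_M. Qed.

Lemma displacement_gap h : G h -> h <> 1%:M -> exists2 e, 0 < e &
  forall z, n2 z <= r -> e <= n2 (psub (act h z) z).
Proof.
move=> Gh h1; have sh := G_SO fG Gh; have [_ rlt1] := andP r1.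
pose P (x y : R * R) (e : R) := n2 x <= r -> e <= n2 (psub (act h x) x).
have [||e e0 H] := @cball_cover _ P.
- by move=> x y a b Pa ba /Pa; exact: le_trans.
- move=> x y x1 y1; have [xr|xr] := leP (n2 x) r; last first.
    exists 1 => //.
    have [c1 c2 _ _] := coord_cvg x y.
    have : \forall s \near (x, y), r < n2 s.1.
      have c : n2 s.1 @[s --> (x, y)] --> n2 x by exact: sq2_cvg.
      by move/cvgr_gt: c; apply.
    by apply: filterS => s h' _ _ h''; rewrite ltNge h'' in h'.
  have d0 : 0 < n2 (psub (act h x) x).
    rewrite lt0r n2_ge0 andbT; apply/eqP => /psub_eq0 hx; apply: h1.
    by apply: (fix_disk fG Gh _ hx); rewrite /disk /=; lra.
  exists (n2 (psub (act h x) x) / 2); first by rewrite divr_gt0.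
  have : \forall s \near (x, y), n2 (psub (act h x) x) / 2 < n2 (psub (act h s.1) s.1).
    have c : (fun s : (R * R) * (R * R) => n2 (psub (act h s.1) s.1)) @ (x, y) --> n2 (psub (act h x) x).
      apply: (@cvg_comp _ _ _ fst (fun z : R * R => n2 (psub (act h z) z)) _ (nbhs x)); first exact: cvg_fst.
      exact: displacement_cvg.
    by move/cvgr_gt: c; apply; lra.
  by apply: filterS => s h' _ _ _; exact: ltW.
exists e => // z zr; apply: (H z z) => //; lra.
Qed.

(** Conjugation brings z into the fundamental ball. Only finitely many elements move some point of
    that ball by a small amount, and each has its own gap there. *)
Lemma disp_gap : exists2 e, 0 < e & forall g, G g -> g <> 1%:M -> forall z, disk z ->
  (1 + e) * bil z z <= nform g z z.
Proof.
have [_ rlt1] := andP r1.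
(* An h whose displacement ratio at some point of the ball is below 2 satisfies [cx h <= B]. *)
pose B := 8 / (1 - r) ^+ 2.
have r0 : 0 < 1 - r by lra.
have B0 : 0 < B by rewrite divr_gt0 // exprn_gt0.
have [s sP] := finite_cx fG B.
pose P h (e : R) := G h -> h <> 1%:M -> forall z, n2 z <= r -> e <= n2 (psub (act h z) z).
have [||e0 e0p H] := @finite_unif _ _ s P.
- by move=> i a b Pa ba Gi i1 z zr; apply: le_trans ba (Pa _ _ _ zr).
- move=> i _; have [[Gi i1]|n] := pselect (G i /\ i <> 1%:M).
    by have [e ep He] := displacement_gap Gi i1; exists e => // _ _; exact: He.
  by exists 1 => // Gi i1; case: n.
(* By [vc_geV] and [cx h <= B] this makes 3e at most [e0 * vc h z ^+ 2], which beats (1 + e)^2 <= 1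
   + 3e. *)
pose e := Num.min 1 (e0 / (12 * B ^+ 2)).
have ep : 0 < e by rewrite lt_min ltr01 divr_gt0 // mulr_gt0 // exprn_gt0.
exists e => // g Gg g1.
have red z : n2 z <= r -> forall h, G h -> h <> 1%:M -> (1 + e) * bil z z <= nform h z z.
  move=> zr h Gh h1; have sh := G_SO fG Gh.
  have z1 : n2 z <= 1 by lra.
  have bz : 1 - r <= bil z z by rewrite bilxx; lra.
  have bz1 : bil z z <= 1 by rewrite bilxx; have := n2_ge0 z; lra.
  have [big|small] := leP (2 * bil z z) (nform h z z).
    have : e <= 1 by rewrite ge_min lexx.
    by nra.
  have v0 := vc_gt0 sh z1; have vg := vc_ge sh z1; have vV := vc_geV sh z1.
  have hz1 := n2_act_le1 sh z1.
  have [_ bl] := bil_bounds z1 hz1.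
  have c0 := cx_ge1 sh.
  have cB : cx h <= B.
    rewrite /B ler_pdivlMr ?exprn_gt0 //.
    move: small; rewrite nformE // => small.
    have q1 : cx h * (1 - r) / 2 <= vc h z by nra.
    have q2 : (1 - r) / 2 <= bil z (act h z) by lra.
    have q3 : (1 - r) / 2 * (cx h * (1 - r) / 2) <= bil z (act h z) * vc h z.
      apply: ler_pM => //; nra.
    by nra.
  have dz := H h (sP h Gh cB) Gh h1 z zr.
  have key : bil z z ^+ 2 + bil z z * (e0 * vc h z ^+ 2) <= nform h z z ^+ 2.
    rewrite nformE // exprMn (rev_cauchy z (act h z)).
    have E : bil (act h z) (act h z) * vc h z ^+ 2 = bil z z by rewrite expr2 bil_act.
    have -> : n2 (psub z (act h z)) = n2 (psub (act h z) z) by rewrite /n2 /psub /=; ring.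
    rewrite -bilxx; set A := bil z z in bz bz1 E *; set v2 := vc h z ^+ 2 in E *.
    have v20 : 0 <= v2 by rewrite sqr_ge0.
    set D := n2 _ in dz *; set S := (_ + _) ^+ 2; have S0 : 0 <= S by rewrite sqr_ge0.
    have F b : b * v2 = A -> (A * b + A * D + S) * v2 = A * A + A * D * v2 + S * v2.
      by move=> <-; ring.
    rewrite (F _ E).
    have : A * e0 * v2 <= A * D * v2 by rewrite ler_wpM2r // ler_wpM2l //; lra.
    have : 0 <= S * v2 by rewrite mulr_ge0.
    by nra.
  have vB : 1 <= 4 * B ^+ 2 * vc h z ^+ 2.
    have : 1 <= 2 * B * vc h z by nra.
    by nra.
  have eB : e * (12 * B ^+ 2) <= e0.
    have eb2 : e <= e0 / (12 * B ^+ 2) by rewrite /e ge_min lexx orbT.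
    by rewrite -ler_pdivlMr // mulr_gt0 // exprn_gt0.
  have e1 : e <= 1 by rewrite ge_min lexx.
  have nf0 : 0 <= nform h z z by rewrite nformE // mulr_ge0 // ?ltW //; lra.
  have l1 : 3 * e <= e0 * vc h z ^+ 2.
    have v20 := sqr_ge0 (vc h z).
    have : e * (12 * B ^+ 2) * vc h z ^+ 2 <= e0 * vc h z ^+ 2 by rewrite ler_wpM2r.
    by nra.
  rewrite -(@ler_pXn2r _ 2) ?nnegrE //; last by rewrite mulr_ge0 //; lra.
  apply: le_trans key; rewrite exprMn.
  have : bil z z ^+ 2 <= bil z z by nra.
  have : (1 + e) ^+ 2 <= 1 + 3 * e by nra.
  have : 3 * e * bil z z <= e0 * vc h z ^+ 2 * bil z z by rewrite ler_wpM2r //; lra.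
  have := sqr_ge0 (bil z z).
  by nra.
move=> z dz; have [k Gk kz] := cob dz; have sk := G_SO fG Gk; have sg := G_SO fG Gg.
have z1 := disk_le1 dz.
rewrite -(nform_conj sk sg z1).
have -> : (1 + e) * bil z z = (1 + e) * bil (act k z) (act k z) * vc k z ^+ 2.
  by rewrite -(bil_act sk z1 z1); ring.
rewrite ler_pM2r ?exprn_gt0 ?vc_gt0 //; apply: red => //; first exact: G_conj.
move=> e1; apply: g1.
have uk := SO21_unit sk.
have := congr1 (fun X => invmx k *m (X *m k)) e1.
by rewrite -!mulmxA mulVmx // mulmx1 mulmxA mulVmx // !mul1mx mulVmx.
Qed.

(** With multiplier 1 at the boundary point u, the displacement tends to 0 along the ray to u,
    against [disp_gap]. *)
Lemma no_parabolic g u : G g -> g <> 1%:M -> n2 u = 1 -> act g u = u -> vc g u = 1 -> False.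
Proof.
move=> Gg g1 u1 gu vu; have sg := G_SO fG Gg.
have [e e0 H] := disp_gap.
have c1 := cx_ge1 sg.
have D0 : 0 < cx g + e + 1 by lra.
(* At (1 - tau) u the gap fails as soon as tau (cx g - 1 + e) < 2e. *)
pose tau := e / (cx g + e + 1).
have tau0 : 0 < tau by rewrite divr_gt0.
have tau1 : tau < 1 by rewrite ltr_pdivrMr //; lra.
have tauE : tau * (cx g + e + 1) = e by rewrite mulfVK // gt_eqF.
have t01 : 0 <= 1 - tau <= 1 by lra.
have uo : n2 (@org R) <= 1 by rewrite n2_org ler01.
have u1' : n2 u <= 1 by rewrite u1.
have nz : n2 (lerp org u (1 - tau)) = (1 - tau) ^+ 2.
  have -> : n2 (lerp org u (1 - tau)) = (1 - tau) ^+ 2 * n2 u by rewrite /n2 /lerp /=; ring.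
  by rewrite u1 mulr1.
have dz : disk (lerp org u (1 - tau)) by rewrite /disk /= nz; nra.
have := H g Gg g1 _ dz; rewrite bilxx nz nform_lerp.
have -> : nform g org org = cx g by rewrite /nform vc_org /=; ring.
have -> : nform g org u = 1 by rewrite /nform vu /=; ring.
have -> : nform g u u = 0 by rewrite nformE // gu bilxx u1 subrr mul0r.
have -> : nform g u org = 1.
  rewrite nformE // -{1}gu; have := bil_act sg u1' uo.
  by rewrite vu mul1r => ->; rewrite /bil /=; ring.
by nra.
Qed.

End Group.
End Hyperbolic.

(** * Fixed points on the circle and their multipliers *)

Section Axes.
Variable R : realType.
Implicit Types (g h k : 'M[R]_3) (p q x y z u : pt R) (t a b c : R).

(** Odd dimension: g^T J (g - 1) = (1 - g)^T J gives det (g - 1) = det (1 - g) = - det (g - 1). *)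
Lemma eigenvector1 g : SO21p g -> exists a b c, ~ (a = 0 /\ b = 0 /\ c = 0) /\
  [/\ g i0 i0 * a + g i0 i1 * b + g i0 i2 * c = a,
      g i1 i0 * a + g i1 i1 * b + g i1 i2 * c = b &
      g i2 i0 * a + g i2 i1 * b + g i2 i2 * c = c].
Proof.
move=> sg.
have d0 : \det (g - 1%:M)^T == 0.
  rewrite det_tr.
  have e : g^T *m Jform R *m (g - 1%:M) = (1%:M - g)^T *m Jform R.
    by rewrite mulmxBr sg.1 mulmx1 raddfB /= trmx1 mulmxBl mul1mx.
  have := congr1 determinant e; rewrite !det_mulmx !det_tr sg.2.1 mul1r.
  have -> : 1%:M - g = -1 *: (g - 1%:M) by rewrite scaleN1r opprB.
  rewrite detZ.
  have dJ : \det (Jform R) != 0.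
    apply/eqP => dJ; have := congr1 determinant (JJ R).
    by rewrite det_mulmx dJ mulr0 det1 => /eqP; rewrite eq_sym oner_eq0.
  set D := \det (g - 1%:M); set J := \det (Jform R) in dJ * => e'.
  have : 2 * J * D = 0 by lra.
  by move=> /eqP; rewrite !mulf_eq0 (negbTE dJ) pnatr_eq0.
have [v v0 /(congr1 trmx)] := det0P d0; rewrite trmx_mul trmxK trmx0 mulmxBl mul1mx => /eqP.
rewrite subr_eq0 => /eqP gv.
exists (v 0 i0), (v 0 i1), (v 0 i2); split.
  move=> [e0 [e1 e2]]; case/negP: v0; apply/eqP/rowP; apply: ord3P; rewrite ?e0 ?e1 ?e2 mxE //.
by split; [move/matrixP: gv => /(_ i0 0)|move/matrixP: gv => /(_ i1 0)|move/matrixP: gv => /(_ i2 0)];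
   rewrite mxE sum_ord3 !mxE.
Qed.

Lemma bil0_eq x y : n2 x <= 1 -> n2 y <= 1 -> bil x y = 0 -> x = y.
Proof.
move=> x1 y1 b0; apply: psub_eq0; have := n2_psub x y; rewrite b0 !bilxx.
have := n2_ge0 (psub x y); lra.
Qed.

Lemma circ_perp a b c : c ^+ 2 < a ^+ 2 + b ^+ 2 -> exists p q,
  [/\ n2 p = 1, n2 q = 1, p <> q, a * p.1 + b * p.2 = c & a * q.1 + b * q.2 = c] /\
  forall u, n2 u = 1 -> a * u.1 + b * u.2 = c -> u = p \/ u = q.
Proof.
set N := a ^+ 2 + b ^+ 2 => cN.
have N0 : N != 0 by rewrite gt_eqF //; apply: le_lt_trans cN; exact: sqr_ge0.
pose s := Num.sqrt (N - c ^+ 2).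
have s2 : s ^+ 2 = N - c ^+ 2 by rewrite sqr_sqrtr // subr_ge0 ltW.
have s0 : 0 < s by rewrite sqrtr_gt0 subr_gt0.
exists ((c * a - s * b) / N, (c * b + s * a) / N), ((c * a + s * b) / N, (c * b - s * a) / N).
split.
- have cs (e : R) : e ^+ 2 = s ^+ 2 -> n2 ((c * a - e * b) / N, (c * b + e * a) / N) = 1.
    move=> es; rewrite /n2 /=.
    transitivity (((c * a - e * b) ^+ 2 + (c * b + e * a) ^+ 2) / N ^+ 2); first by field.
    have -> : (c * a - e * b) ^+ 2 + (c * b + e * a) ^+ 2 = (c ^+ 2 + e ^+ 2) * N.
      by rewrite /N; ring.
    by rewrite es s2; field.
  split=> //=.
  + exact: cs.
  + by have := cs (- s); rewrite sqrrN !mulNr opprK => ->.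
  + move=> [/(mulIf (invr_neq0 N0)) e1 /(mulIf (invr_neq0 N0)) e2].
    have b0 : b = 0 by apply: (mulfI (lt0r_neq0 s0)); rewrite mulr0; lra.
    have a0 : a = 0 by apply: (mulfI (lt0r_neq0 s0)); rewrite mulr0; lra.
    by move: N0; rewrite /N a0 b0 expr0n addr0 eqxx.
  + by transitivity (c * N / N); [rewrite /N; ring|rewrite mulfK].
  + by transitivity (c * N / N); [rewrite /N; ring|rewrite mulfK].
move=> [u1 u2]; rewrite /n2 /= => un uc.
pose m := a * u2 - b * u1.
have : m ^+ 2 = s ^+ 2.
  have : c ^+ 2 + m ^+ 2 = N * (u1 ^+ 2 + u2 ^+ 2) by rewrite -uc /m /N; ring.
  by rewrite un mulr1 s2; lra.
have e1 : u1 = (c * a - m * b) / N.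
  by rewrite -uc /m; transitivity (u1 * N / N); [rewrite mulfK|rewrite /N; ring].
have e2 : u2 = (c * b + m * a) / N.
  by rewrite -uc /m; transitivity (u2 * N / N); [rewrite mulfK|rewrite /N; ring].
move=> /eqP; rewrite eqf_sqr => /orP[] /eqP ms; [left|right]; rewrite e1 e2 ms //.
by rewrite !mulNr opprK.
Qed.

Section Group.
Variables (G : set 'M[R]_3) (r : R).
Hypothesis fG : fuchsian_surface_group G.
Hypothesis r1 : 1 / 2 <= r < 1.
Hypothesis cob : forall z, disk z -> exists2 g, G g & n2 (act g z) <= r.

(** By the type of the vector fixed by g: timelike gives a fixed point in the disk, excluded by
    freeness; lightlike gives a parabolic, excluded by [no_parabolic]; spacelike gives a polar line
    meeting the circle in two points, which g permutes. *)
Lemma hyperbolic0 g : G g -> g <> 1%:M -> exists p q,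
  [/\ n2 p = 1, n2 q = 1, p <> q, act g p = p & act g q = q].
Proof.
move=> Gg g1; have sg := G_SO fG Gg.
have [a [b [c [abc [ea eb ec]]]]] := eigenvector1 sg.
have inv u : n2 u <= 1 -> (a * (act g u).1 + b * (act g u).2 - c) * vc g u = a * u.1 + b * u.2 - c.
  move=> u1; have v0 := lt0r_neq0 (vc_gt0 sg u1).
  have -> : (a * (act g u).1 + b * (act g u).2 - c) * vc g u =
    a * (g i0 i0 * u.1 + g i0 i1 * u.2 + g i0 i2) + b * (g i1 i0 * u.1 + g i1 i1 * u.2 + g i1 i2)
    - c * (g i2 i0 * u.1 + g i2 i1 * u.2 + g i2 i2).
    by rewrite actE /= -/(vc g u); field.
  transitivity ((g i0 i0 * a + g i0 i1 * b + g i0 i2 * c) * (g i0 i0 * u.1 + g i0 i1 * u.2 + g i0 i2)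
    + (g i1 i0 * a + g i1 i1 * b + g i1 i2 * c) * (g i1 i0 * u.1 + g i1 i1 * u.2 + g i1 i2)
    - (g i2 i0 * a + g i2 i1 * b + g i2 i2 * c) * (g i2 i0 * u.1 + g i2 i1 * u.2 + g i2 i2)).
    by rewrite ea eb ec.
  transitivity (a * u.1 * Jform R i0 i0 + a * u.2 * Jform R i0 i1 + a * Jform R i0 i2
  + b * u.1 * Jform R i1 i0 + b * u.2 * Jform R i1 i1 + b * Jform R i1 i2
  + c * u.1 * Jform R i2 i0 + c * u.2 * Jform R i2 i1 + c * Jform R i2 i2).
    by rewrite -!(SO21_col sg); ring.
  by rewrite !Jform_diag ?eqxx ?neq_ord3; ring.
have fixed : c != 0 -> act g (a / c, b / c) = (a / c, b / c) /\ vc g (a / c, b / c) = 1.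
  move=> c0.
  have v1 : vc g (a / c, b / c) = 1.
    by rewrite /vc /=; transitivity ((g i2 i0 * a + g i2 i1 * b + g i2 i2 * c) / c);
       [field|rewrite ec divff].
  split=> //; rewrite actE v1 !divr1 /=; congr (_, _).
    by rewrite -{2}ea; field.
  by rewrite -{2}eb; field.
have cneq : a ^+ 2 + b ^+ 2 <= c ^+ 2 -> c != 0.
  move=> le; apply/eqP => c0; apply: abc; move: le; rewrite c0 expr0n /=.
  have := sqr_ge0 a; have := sqr_ge0 b => b2 a2 le.
  split; [|split=> //]; apply/eqP; rewrite -sqrf_eq0 eq_le; apply/andP; split; lra.
have n2E : c != 0 -> n2 (a / c, b / c) * c ^+ 2 = a ^+ 2 + b ^+ 2 by move=> c0; rewrite /n2 /=; field.
have [lt|gt|eq] := ltgtP (a ^+ 2 + b ^+ 2) (c ^+ 2).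
- have c0 := cneq (ltW lt); have [fx _] := fixed c0.
  case: g1; apply: (fix_disk fG Gg _ fx); rewrite /disk /=.
  have c2 : 0 < c ^+ 2 by rewrite lt0r sqr_ge0 sqrf_eq0 c0.
  by rewrite -(ltr_pM2r c2) n2E // mul1r.
- have [p [q [[p1 q1 pq ep eq] uniq]]] := circ_perp gt.
  have pq' u : n2 u = 1 -> a * u.1 + b * u.2 = c -> act g u = p \/ act g u = q.
    move=> u1 uc; apply: uniq; first exact: circ_act.
    have u1' : n2 u <= 1 by rewrite u1.
    have := inv u u1'; rewrite uc subrr => /eqP; rewrite mulf_eq0 (gt_eqF (vc_gt0 sg u1')) orbF.
    by rewrite subr_eq0 => /eqP.
  have p1' : n2 p <= 1 by rewrite p1.
  have q1' : n2 q <= 1 by rewrite q1.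
  have vv := bil_act sg p1' q1'.
  have b0 : bil p q != 0 by apply/eqP => /(bil0_eq p1' q1').
  have [gp|gp] := pq' _ p1 ep; have [gq|gq] := pq' _ q1 eq.
  + by case: pq; apply: (act_inj sg p1' q1'); rewrite gp gq.
  + by exists p, q.
  (* If g swaps p and q, their multipliers are inverse and the point of parameter l / (1 + l)
     between them is fixed. *)
  + exfalso; apply: g1; move: vv; rewrite gp gq [bil q p]bilC => vv.
    have vv1 : vc g p * vc g q = 1.
      by apply: (mulfI b0); rewrite vv mulr1.
    have l0 := vc_gt0 sg p1'; set l := vc g p in l0 vv1.
    have D0 : 1 + l != 0 by rewrite gt_eqF //; lra.
    pose t := l / (1 + l).
    have t0 : 0 < t by rewrite divr_gt0 //; lra.
    have t1 : t < 1 by rewrite ltr_pdivrMr //; lra.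
    have t01 : 0 <= t <= 1 by rewrite !ltW.
    have tE : t * (1 + l) = l by rewrite mulfVK.
    apply: (@fix_disk _ _ fG g (lerp p q t) Gg).
      rewrite /disk /= n2_lerp p1 q1.
      have : 0 < n2 (psub p q) by rewrite lt0r n2_ge0 andbT; apply/eqP => /psub_eq0.
      have tt : 0 < t * (1 - t) by rewrite mulr_gt0 // subr_gt0.
      by move=> np; have := mulr_gt0 tt np; lra.
    have vE : vc g (lerp p q t) = 1.
      rewrite vc_lerp -/l; apply: (mulfI (lt0r_neq0 l0)).
      have -> : l * ((1 - t) * l + t * vc g q) = (1 - t) * l ^+ 2 + t * (l * vc g q) by ring.
      by rewrite vv1 mulr1; nra.
    rewrite act_lerp // vE divr1 gp gq.
    have -> : t * vc g q = 1 - t.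
      apply: (mulfI (lt0r_neq0 l0)).
      have -> : l * (t * vc g q) = t * (l * vc g q) by ring.
      by rewrite vv1 mulr1; lra.
    by rewrite /lerp /=; congr (_, _); ring.
  + by case: pq; apply: (act_inj sg p1' q1'); rewrite gp gq.
- have c0 : c != 0 by apply: cneq; rewrite eq.
  have [fx vx] := fixed c0; exfalso.
  apply: (no_parabolic fG r1 cob Gg g1 _ fx vx).
  by apply: (mulIf (expf_neq0 2 c0)); rewrite n2E // mul1r.
Qed.

(** The two multipliers are inverse because [bil p q] is nonzero and preserved; were they 1, the
    midpoint would be fixed. The pair is ordered so that p is attracting. *)
Lemma hyperbolic g : G g -> g <> 1%:M -> exists p q l,
  [/\ n2 p = 1, n2 q = 1, p <> q & 1 < l] /\
  [/\ act g p = p, act g q = q, vc g p = l & vc g q = l^-1].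
Proof.
move=> Gg g1; have sg := G_SO fG Gg.
have [p [q [p1 q1 pq gp gq]]] := hyperbolic0 Gg g1.
have p1' : n2 p <= 1 by rewrite p1.
have q1' : n2 q <= 1 by rewrite q1.
have p0 := vc_gt0 sg p1'; have q0 := vc_gt0 sg q1'.
have vv : vc g p * vc g q = 1.
  have b0 : bil p q != 0 by apply/eqP => /(bil0_eq p1' q1').
  by apply: (mulfI b0); rewrite -{1}gp -{1}gq bil_act // mulr1.
have [lt|gt|e] := ltgtP 1 (vc g p).
- exists p, q, (vc g p); split=> //; split=> //.
  by apply: (mulfI (lt0r_neq0 p0)); rewrite vv divff // gt_eqF.
- exists q, p, (vc g q); split; first by split=> //; [exact/nesym|nra].
  by split=> //; apply: (mulfI (lt0r_neq0 q0)); rewrite mulrC vv divff // gt_eqF.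
- exfalso; apply: g1; apply: (@fix_disk _ _ fG g (lerp p q (1/2)) Gg).
    rewrite /disk /= n2_lerp p1 q1.
    have : 0 < n2 (psub p q) by rewrite lt0r n2_ge0 andbT; apply/eqP => /psub_eq0.
    by lra.
  have vq : vc g q = 1 by rewrite -vv -e mul1r.
  rewrite act_lerp // ?vc_lerp -?e ?vq ?gp ?gq; last by lra.
  by congr lerp; field.
Qed.

Lemma fixB_hyp g p q l : SO21p g -> n2 p = 1 -> n2 q = 1 -> 1 < l ->
  act g p = p -> act g q = q -> vc g p = l -> vc g q = l^-1 -> fixB g = [set p; q].
Proof.
move=> sg p1 q1 l1 gp gq vp vq; apply/seteqP; split=> u; last by move=> /= [->|->].
move=> [u1 gu] /=.
have [->|up] := eqVneq u p; first by left.
have [->|uq] := eqVneq u q; first by right.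
have u1' : n2 u <= 1 by rewrite u1.
have p1' : n2 p <= 1 by rewrite p1.
have q1' : n2 q <= 1 by rewrite q1.
have v1 (x : pt R) : n2 x <= 1 -> u != x -> act g x = x -> vc g u * vc g x = 1.
  move=> x1 /eqP ux gx; have b0 : bil u x != 0 by apply/eqP => /(bil0_eq u1' x1).
  by apply: (mulfI b0); rewrite -{1}gu -{1}gx bil_act // mulr1.
have := v1 _ p1' up gp; have := v1 _ q1' uq gq; rewrite vp vq.
have l0 : l != 0 by rewrite gt_eqF //; lra.
move=> /(congr1 (fun x : R => x * l)); rewrite mulfVK // mul1r => ->.
by move=> ?; exfalso; nra.
Qed.

(** If u is fixed by all, [vc g u] is a homomorphism with trivial kernel by [no_parabolic]. The
    group is then abelian and fixes both fixed points of one element, so it only translates along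
    one axis and cannot be cocompact. *)
Lemma no_common_fixed u : n2 u = 1 -> exists2 g, G g & act g u <> u.
Proof.
move=> u1; apply: contrapT => H.
have fixu g : G g -> act g u = u by move=> Gg; apply: contrapT => n; apply: H; exists g.
have u1' : n2 u <= 1 by rewrite u1.
have [f Gf f1] : exists2 f, G f & f <> 1%:M.
  apply: contrapT => n; have [r12 rlt1] := andP r1.
  have dz : disk (Num.sqrt ((1 + r) / 2), 0 : R).
    by rewrite /disk /n2 /= expr0n addr0 sqr_sqrtr; lra.
  have [g Gg] := cob dz; have -> : g = 1%:M by apply: contrapT => g1; apply: n; exists g.
  by rewrite act1 /n2 /= expr0n addr0 sqr_sqrtr; lra.
have vcomm g h : G g -> G h -> vc (g *m h) u = vc g u * vc h u.
  by move=> Gg Gh; rewrite vc_mul ?fixu //; exact: (G_SO fG Gh).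
have comm g h : G g -> G h -> g *m h = h *m g.
  move=> Gg Gh; have uhg := SO21_unit (G_SO fG (G_M fG Gh Gg)).
  have [c cE Gc] : exists2 c, (h *m g) *m c = g *m h & G c.
    exists (invmx (h *m g) *m (g *m h)); first by rewrite mulmxA mulmxV // mul1mx.
    by apply: G_M (G_M fG Gg Gh) => //; apply: G_V => //; exact: G_M.
  have [c1|c1] := pselect (c = 1%:M); first by rewrite -cE c1 mulmx1.
  exfalso; apply: (no_parabolic fG r1 cob Gc c1 u1 (fixu _ Gc)).
  have := congr1 (fun M => vc M u) cE.
  rewrite /= (vcomm _ _ (G_M fG Gh Gg) Gc) !vcomm // [vc h u * _]mulrC => /eqP.
  have v0 : vc g u * vc h u != 0.
    by rewrite mulf_neq0 // gt_eqF // vc_gt0 //; [exact: (G_SO fG Gg)|exact: (G_SO fG Gh)].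
  by rewrite -[X in _ == X]mulr1 (inj_eq (mulfI v0)) => /eqP.
have [p [q [l [[p1 q1 pq l1] [fp fq vp vq]]]]] := hyperbolic Gf f1.
have sf := G_SO fG Gf.
have fB := fixB_hyp sf p1 q1 l1 fp fq vp vq.
have pfix g x : G g -> n2 x = 1 -> act f x = x -> act g x = p \/ act g x = q.
  move=> Gg x1 fx; have x1' : n2 x <= 1 by rewrite x1.
  suff : fixB f (act g x) by rewrite fB.
  have sg := G_SO fG Gg.
  split; first exact: circ_act.
  by rewrite -act_mul // comm // act_mul // fx.
have upq : u = p \/ u = q by have : fixB f u; [split=> //; exact: fixu|rewrite fB].
have p1' : n2 p <= 1 by rewrite p1.
have q1' : n2 q <= 1 by rewrite q1.
have allfix g : G g -> act g p = p /\ act g q = q.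
  move=> Gg; have sg := G_SO fG Gg; case: upq => uE.
    have gp : act g p = p by rewrite -uE fixu.
    split=> //; case: (pfix g q Gg q1 fq) => // e; exfalso; apply: pq.
    by apply: (act_inj sg) => //; rewrite gp e.
  have gq : act g q = q by rewrite -uE fixu.
  split=> //; case: (pfix g p Gg p1 fp) => // e; exfalso; apply: pq.
  by apply: (act_inj sg) => //; rewrite gq e.
have vpq g : G g -> vc g p * vc g q = 1.
  move=> Gg; have [gp gq] := allfix g Gg; have sg := G_SO fG Gg.
  have b0 : bil p q != 0 by apply/eqP => /(bil0_eq p1' q1').
  by apply: (mulfI b0); rewrite -{1}gp -{1}gq bil_act // mulr1.
(* [bil p z * bil q z / bil z z] is invariant under [G], bounded on the compact
   ball given by cocompactness, but unbounded on the disk. *)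
have inv g z : G g -> disk z ->
  bil p (act g z) * bil q (act g z) * bil z z = bil p z * bil q z * bil (act g z) (act g z).
  move=> Gg dz; have [gp gq] := allfix g Gg; have sg := G_SO fG Gg; have z1 := disk_le1 dz.
  rewrite -(bil_act sg z1 z1) -(bil_act sg p1' z1) -(bil_act sg q1' z1) gp gq.
  transitivity (bil p (act g z) * bil q (act g z) * bil (act g z) (act g z) * vc g z ^+ 2
     * (vc g p * vc g q)); last by ring.
  by rewrite vpq // mulr1; ring.
have [_ rlt1] := andP r1.
have bnd z : disk z -> bil p z * bil q z * (1 - r) <= 4 * bil z z.
  move=> dz; have [g Gg gz] := cob dz; have := inv g z Gg dz.
  have gz1 : n2 (act g z) <= 1 by lra.
  have z1 := disk_le1 dz.
  have [b1 b1'] := bil_bounds p1' gz1; have [b2 b2'] := bil_bounds q1' gz1.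
  have [_ b3] := bil_bounds p1' z1; have [_ b4] := bil_bounds q1' z1.
  rewrite p1 subrr mul0r in b3 b1'; rewrite q1 subrr mul0r in b4 b2'.
  have := bilxx (act g z); set w := act g z in gz gz1 b1 b1' b2 b2' * => bw.
  have bz : 0 < bil z z by rewrite bilxx subr_gt0.
  have : bil p w * bil q w <= 4 by nra.
  have := mulr_ge0 b3 b4; nra.
(* Among three points of the circle, one differs from p and q. *)
have [e [e1 ep eq]] : exists e : pt R, [/\ n2 e = 1, e <> p & e <> q].
  have [a|a] := pselect (p = (1, 0) \/ q = (1, 0)); last first.
    exists (1, 0); split; [by rewrite /n2 /=; ring| |]; move=> e; apply: a; [left|right]; by rewrite e.
  have [b|b] := pselect (p = (0, 1) \/ q = (0, 1)); last first.
    exists (0, 1); split; [by rewrite /n2 /=; ring| |]; move=> e; apply: b; [left|right]; by rewrite e.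
  exists (-1, 0); split; first by rewrite /n2 /=; ring.
    move=> e; rewrite -e in a b.
    by case: a => [[]|qa]; [lra|]; case: b => [[]|qb]; [lra|move: qa; rewrite qb => -[]; lra].
  move=> e; rewrite -e in a b.
  by case: a => [pa|[]]; [|lra]; case: b => [pb|[]]; [move: pa; rewrite pb => -[]; lra|lra].
have e1' : n2 e <= 1 by rewrite e1.
have be : 0 < bil p e * bil q e.
  have [_ b3] := bil_bounds p1' e1'; have [_ b4] := bil_bounds q1' e1'.
  rewrite p1 subrr mul0r in b3; rewrite q1 subrr mul0r in b4.
  rewrite lt0r mulr_ge0 // andbT mulf_neq0 //; apply/eqP.
    by move=> /(bil0_eq p1' e1') /esym.
  by move=> /(bil0_eq q1' e1') /esym.
set A := bil p e * bil q e in be.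
have Al : A <= 4.
  have [b1 b1'] := bil_bounds p1' e1'; have [b2 b2'] := bil_bounds q1' e1'.
  rewrite p1 subrr mul0r in b1'; rewrite q1 subrr mul0r in b2'.
  by rewrite /A; nra.
(* Near e, [bil z z] is at most 2 tau while the numerator stays above A / 4; this tau violates
   [bnd]. *)
pose tau := A * (1 - r) / 32.
have tau0 : 0 < tau by rewrite divr_gt0 // mulr_gt0 // subr_gt0.
have tau1 : tau < 1 / 2.
  by rewrite /tau; have [r12 _] := andP r1; nra.
have dz : disk (lerp org e (1 - tau)).
  rewrite /disk /=; have -> : n2 (lerp org e (1 - tau)) = (1 - tau) ^+ 2 * n2 e.
    by rewrite /n2 /lerp /=; ring.
  by rewrite e1; nra.
have := bnd _ dz; rewrite bilxx.
have -> : n2 (lerp org e (1 - tau)) = (1 - tau) ^+ 2 * n2 e by rewrite /n2 /lerp /=; ring.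
rewrite e1 mulr1.
have bl x : bil x (lerp org e (1 - tau)) = tau + (1 - tau) * bil x e.
  by rewrite /bil /lerp /=; ring.
rewrite !bl.
have [b1 b1'] := bil_bounds p1' e1'; have [b2 b2'] := bil_bounds q1' e1'.
rewrite p1 subrr mul0r in b1'; rewrite q1 subrr mul0r in b2'.
have l2 : (1 - tau) ^+ 2 * A <= (tau + (1 - tau) * bil p e) * (tau + (1 - tau) * bil q e).
  have : 0 <= (1 - tau) * bil p e by rewrite mulr_ge0 //; lra.
  have : 0 <= (1 - tau) * bil q e by rewrite mulr_ge0 //; lra.
  by rewrite /A; nra.
have l3 : A / 4 <= (1 - tau) ^+ 2 * A.
  have q4 : 1 / 4 <= (1 - tau) ^+ 2 by nra.
  by have := ler_wpM2r (ltW be) q4; lra.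
have l4 : 8 * tau = A / 4 * (1 - r) by rewrite /tau; field.
move=> l5.
have : A / 4 * (1 - r) <= 4 * (1 - (1 - tau) ^+ 2).
  apply: le_trans l5; rewrite ler_wpM2r //; [lra|exact: le_trans l3 l2].
by nra.
Qed.

End Group.
End Axes.

(** * A closing lemma: making axes pass near the centre *)

Section Closing.
Variable R : realType.
Implicit Types (g h k : 'M[R]_3) (p q x y z u : pt R) (t a b c : R).

(** p is attracting and q repelling; their lifts are eigenvectors for l and l^-1, so log l is the
    translation length. *)
Definition hypdata k p q (l : R) : Prop :=
  [/\ n2 p = 1, n2 q = 1, p <> q & 1 < l] /\
  [/\ act k p = p, act k q = q, vc k p = l & vc k q = l^-1].

Lemma n2_psub_tri x y z u : n2 (psub x u) <=
  3 * (n2 (psub x y) + n2 (psub y z) + n2 (psub z u)).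
Proof.
have sq (a b c : R) : (a + b + c) ^+ 2 <= 3 * (a ^+ 2 + b ^+ 2 + c ^+ 2).
  have := sqr_ge0 (a - b); have := sqr_ge0 (b - c); have := sqr_ge0 (a - c); nra.
rewrite /n2 /psub /=.
have := sq (x.1 - y.1) (y.1 - z.1) (z.1 - u.1); have := sq (x.2 - y.2) (y.2 - z.2) (z.2 - u.2).
have -> : x.1 - y.1 + (y.1 - z.1) + (z.1 - u.1) = x.1 - u.1 by ring.
have -> : x.2 - y.2 + (y.2 - z.2) + (z.2 - u.2) = x.2 - u.2 by ring.
lra.
Qed.

Lemma psubC x y : n2 (psub x y) = n2 (psub y x).
Proof. by rewrite /n2 /psub /=; ring. Qed.

Lemma n2_psub_bil x y : n2 x <= 1 -> n2 y <= 1 -> n2 (psub x y) <= 2 * bil x y.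
Proof. by move=> x1 y1; rewrite n2_psub !bilxx; lra. Qed.

(** By [vcE], the multiplier l^-1 <= 1 of [invmx k] at p equals [cx k] times [bil] between k org and
    p, which bounds their distance; likewise for q. *)
Lemma fixed_near_orbit k p q l : SO21p k -> hypdata k p q l ->
  cx k * n2 (psub (act k org) p) <= 2 /\ cx k * n2 (psub (act (invmx k) org) q) <= 2.
Proof.
move=> sk [[p1 q1 pq l1] [kp kq vp vq]].
have p1' : n2 p <= 1 by rewrite p1.
have q1' : n2 q <= 1 by rewrite q1.
have c0 := cx_gt0 sk; have sV := SO21_V sk.
have l0 : 0 < l by lra.
have li : l^-1 <= 1 by rewrite invf_le1 //; lra.
split.
  have : vc (invmx k) p = l^-1.
    have E := vcVK sk p1'; rewrite kp vp in E.
    by apply: (mulIf (lt0r_neq0 l0)); rewrite E mulVf // lt0r_neq0.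
  rewrite (vcE _ sV) cxV // invmxK => e.
  have := n2_psub_bil (n2_act_le1 sk org_le1) p1'; nra.
move: vq; rewrite (vcE _ sk) => e.
have := n2_psub_bil (n2_act_le1 sV org_le1) q1'; nra.
Qed.

Lemma act_org_close g f : SO21p g -> SO21p f ->
  cx g * n2 (psub (act (g *m f) org) (act g org)) <= 2 * cx f.
Proof.
move=> sg sf; have sgf := SO21_mul sg sf.
have f1 := n2_act_le1 sf org_le1.
have := bil_act sg f1 org_le1; rewrite -(act_mul sg sf org_le1) vc_org.
have := vc_mul g sf org_le1; rewrite !vc_org => e1 e2.
have e3 : bil (act f org) org = 1 by rewrite /bil /=; ring.
rewrite e3 in e2.
have b := n2_psub_bil (n2_act_le1 sgf org_le1) (n2_act_le1 sg org_le1).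
have c1 := cx_ge1 sgf; have c2 := cx_ge1 sf; have c3 := cx_ge1 sg.
set B := bil _ _ in b e2; set N := n2 _ in b *.
have e4 : B * cx (g *m f) * cx g = cx f by rewrite e1 -[RHS]mul1r -e2; ring.
have B0 : 0 <= B by have := n2_ge0 (psub (act (g *m f) org) (act g org)); rewrite -/N; lra.
have : cx g * B <= cx f by rewrite -e4; have := mulr_ge0 (mulr_ge0 (ltW (cx_gt0 sg)) B0) (ltW (cx_gt0 sgf)); nra.
nra.
Qed.

Section Group.
Variables (G : set 'M[R]_3) (r : R).
Hypothesis fG : fuchsian_surface_group G.
Hypothesis r1 : 1 / 2 <= r < 1.
Hypothesis cob : forall z, disk z -> exists2 g, G g & n2 (act g z) <= r.

(** Every point is moved by some element: on the circle by [no_common_fixed], inside by freeness.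
    Compactness makes size and displacement uniform. *)
Lemma uniformly_moved : exists2 e : R, 0 < e & forall x, n2 x <= 1 ->
  exists f, [/\ G f, cx f * e <= 1 & e <= n2 (psub (act f x) x)].
Proof.
pose P (x y : R * R) (e : R) := exists f, [/\ G f, cx f * e <= 1 & e <= n2 (psub (act f x) x)].
have [||e e0 H] := @cball_cover _ P; last by exists e => // x x1; exact: (H x x).
- move=> x y a b [f [Gf c d]] ba; exists f; split=> //; last exact: le_trans d.
  by apply: le_trans c; rewrite ler_wpM2l // ltW // cx_gt0 //; exact: (G_SO fG).
move=> x y x1 y1.
have [f Gf fx] : exists2 f, G f & act f x <> x.
  have [e|ne] := eqVneq (n2 x) 1; first exact: (no_common_fixed fG r1 cob e).
  have dx : disk x by rewrite /disk /= lt_neqAle ne.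
  have e1 : n2 ((1, 0) : pt R) = 1 by rewrite /n2 /=; ring.
  have [f Gf f1] := no_common_fixed fG r1 cob e1.
  by exists f => // fx; apply: f1; rewrite (fix_disk fG Gf dx fx) act1.
have sf := G_SO fG Gf; have c0 := cx_gt0 sf.
have d0 : 0 < n2 (psub (act f x) x) by rewrite lt0r n2_ge0 andbT; apply/eqP => /psub_eq0.
exists (Num.min (n2 (psub (act f x) x) / 2) (cx f)^-1).
  by rewrite lt_min divr_gt0 //= invr_gt0.
have : \forall s \near (x, y), n2 (psub (act f x) x) / 2 < n2 (psub (act f s.1) s.1).
  have c : (fun s : (R * R) * (R * R) => n2 (psub (act f s.1) s.1)) @ (x, y) --> n2 (psub (act f x) x).
    apply: (@cvg_comp _ _ _ fst (fun z : R * R => n2 (psub (act f z) z)) _ (nbhs x)); first exact: cvg_fst.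
    exact: displacement_cvg.
  by move/cvgr_gt: c; apply; lra.
apply: filterS => s h' _ _; exists f; split=> //.
  by rewrite mulrC -ler_pdivlMr // mul1r ge_min lexx orbT.
by rewrite ge_min (ltW h').
Qed.

(** By [fixed_near_orbit], the axis of a large k passes near the centre once k org and k^-1 org are
    apart. If they are close for g, a bounded f moving g^-1 org away is used: g f^-1 replaces the
    second point by f g^-1 org and hardly changes the first ([act_org_close]). *)
Lemma closing : exists c0 B0 rho : R, [/\ 0 < B0, rho < 1 &
  forall g, G g -> c0 <= cx g -> exists f, [/\ G f, cx f <= B0, g *m f <> 1%:M &
    forall p q l, hypdata (g *m f) p q l -> n2 (lerp p q (1 / 2)) <= rho]].
Proof.
have [e e0 H] := uniformly_moved.
(* In squared distances: orbit points e / 9 apart and fixed points within e / 108 of them give a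
   chord of at least e / 54, whose midpoint has [n2] at most 1 - e / 216. *)
exists (432 / e ^+ 2 + 216 / e + 18 / e ^+ 2), (1 + e^-1), (1 - e / 216); split; [|by lra|].
  by rewrite addr_gt0 // invr_gt0.
move=> g Gg cg; have sg := G_SO fG Gg.
have e2 : 0 < e ^+ 2 by rewrite exprn_gt0.
have [c1 c2 c3] : [/\ 432 <= cx g * e ^+ 2, 216 <= cx g * e & 18 <= cx g * e ^+ 2].
  have q1 : 0 < 432 / e ^+ 2 by rewrite divr_gt0 ?ltr0n.
  have q2 : 0 < 216 / e by rewrite divr_gt0 ?ltr0n.
  have q3 : 0 < 18 / e ^+ 2 by rewrite divr_gt0 ?ltr0n.
  by split; rewrite -ler_pdivrMr //; lra.
have final k p q l : SO21p k -> 216 <= cx k * e ->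
    e / 9 <= n2 (psub (act k org) (act (invmx k) org)) -> hypdata k p q l ->
    n2 (lerp p q (1 / 2)) <= 1 - e / 216.
  move=> sk ck dk hk; have [a1 a2] := fixed_near_orbit sk hk.
  have := n2_psub_tri (act k org) p q (act (invmx k) org); rewrite (psubC q).
  have [[p1 q1 _ _] _] := hk; rewrite n2_lerp p1 q1.
  have cp := cx_gt0 sk.
  have small N : cx k * N <= 2 -> N * 108 <= e.
    by move=> h; rewrite -(ler_pM2l cp); nra.
  have := small _ a1; have := small _ a2; lra.
have nontriv k : e / 9 <= n2 (psub (act k org) (act (invmx k) org)) -> k <> 1%:M.
  move=> + k1; rewrite k1 invmx1 act1.
  have -> : n2 (psub (@org R) org) = 0 by rewrite /n2 /psub /=; ring.
  by move=> ?; lra.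
have [far|near'] := leP (e / 9) (n2 (psub (act g org) (act (invmx g) org))).
  exists 1%:M; rewrite mulmx1; split; [exact: G_1| | exact: nontriv|].
    by rewrite /cx mx1E eqxx lerDl invr_ge0 ltW.
  by move=> p q l; exact: final.
have sV := SO21_V sg.
have a1 : n2 (act (invmx g) org) <= 1 := n2_act_le1 sV org_le1.
have [f [Gf cf df]] := H _ a1; have sf := G_SO fG Gf; have sfV := SO21_V sf.
have sk := SO21_mul sg sfV; pose k := g *m invmx f.
have kV : act (invmx k) org = act f (act (invmx g) org).
  rewrite -(act_mul sf sV org_le1); congr (act _ org).
  have e1 : (f *m invmx g) *m k = 1%:M.
    by rewrite /k mulmxA -(mulmxA f) mulVmx ?SO21_unit // mulmx1 mulmxV // SO21_unit.
  by rewrite -[LHS]mul1mx -e1 mulmxK // SO21_unit.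
have ck : 216 <= cx k * e.
  have e1 : k *m f = g by rewrite /k -mulmxA mulVmx ?SO21_unit // mulmx1.
  have := vc_mul k sf org_le1; rewrite e1 !vc_org.
  have := vc_le sk (n2_act_le1 sf org_le1); rewrite -/k => v1 v2.
  have cfp := cx_gt0 sf; have ckp := cx_gt0 sk; rewrite -/k in ckp.
  have h1 : cx g <= 2 * cx k * cx f by rewrite v2 ler_pM2r.
  have h2 : cx g * e <= 2 * cx k.
    have h3 := ler_wpM2r (ltW e0) h1.
    have h4 : 2 * cx k * (cx f * e) <= 2 * cx k * 1 by rewrite ler_wpM2l // mulr_ge0 // ltW.
    by lra.
  have h3 := ler_wpM2r (ltW e0) h2; rewrite -mulrA -expr2 in h3; lra.
have dk : e / 9 <= n2 (psub (act k org) (act (invmx k) org)).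
  rewrite kV.
  have := n2_psub_tri (act f (act (invmx g) org)) (act k org) (act g org) (act (invmx g) org).
  have := act_org_close sg sfV; rewrite -/k cxV // => h1.
  rewrite (psubC (act f _) (act k org)).
  have h2 : n2 (psub (act k org) (act g org)) <= e / 9.
    have h3 : cx g * e * n2 (psub (act k org) (act g org)) <= 2.
      have := ler_wpM2r (ltW e0) h1; set N := n2 _; nra.
    have cp := cx_gt0 sg.
    have ce : 0 < cx g * e by rewrite mulr_gt0.
    rewrite -(ler_pM2l ce); apply: le_trans h3 _.
    have -> : cx g * e * (e / 9) = (cx g * e ^+ 2) / 9 by field.
    by lra.
  by lra.
exists (invmx f); rewrite -/k; split=> //.
- by apply: G_V.
- rewrite cxV //; have ei : 0 < e^-1 by rewrite invr_gt0.
  have : cx f <= e^-1 by rewrite -[e^-1]mul1r ler_pdivlMr.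
  by lra.
- exact: nontriv.
- by move=> p q l; exact: final.
Qed.

End Group.
End Closing.

(** * Parametrised axes and the intersection number *)

Section AxisGeometry.
Variable R : realType.
Implicit Types (g h k : 'M[R]_3) (p q x y z u : pt R) (t a b c l : R).

(** The projective class of (q,1) + tau (p,1). The element acts by tau -> l^2 tau, and log tau is
    twice the hyperbolic arc length. *)
Definition axpt p q (tau : R) : pt R := lerp q p (tau / (1 + tau)).

Lemma lerp_lerp x y a b t : lerp (lerp x y a) (lerp x y b) t = lerp x y ((1 - t) * a + t * b).
Proof. by rewrite /lerp /=; congr (_, _); ring. Qed.

Lemma lerpC x y t : lerp x y t = lerp y x (1 - t).
Proof. by rewrite /lerp /=; congr (_, _); ring. Qed.

Lemma act_axpt k p q l tau : SO21p k -> hypdata k p q l -> 0 < tau ->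
  act k (axpt p q tau) = axpt p q (l ^+ 2 * tau).
Proof.
move=> sk [[p1 q1 pq l1] [kp kq vp vq]] t0; rewrite /axpt.
have D0 : 0 < 1 + tau by lra.
have l0 : 0 < l by lra.
have t01 : 0 <= tau / (1 + tau) <= 1.
  by apply/andP; split; [apply: divr_ge0; lra|rewrite ler_pdivrMr //; lra].
have lt0 : 0 < l ^+ 2 * tau by rewrite mulr_gt0 // exprn_gt0.
rewrite act_lerp ?p1 ?q1 // kp kq vc_lerp vp vq; congr lerp.
by field; do ?[apply/andP; split]; apply: lt0r_neq0; nra.
Qed.

Lemma disk_axpt p q tau : n2 p = 1 -> n2 q = 1 -> p <> q -> 0 < tau -> disk (axpt p q tau).
Proof.
move=> p1 q1 pq t0; rewrite /disk /axpt /= n2_lerp p1 q1.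
have D0 : 0 < 1 + tau by lra.
have a0 : 0 < tau / (1 + tau) by rewrite divr_gt0.
have a1 : tau / (1 + tau) < 1 by rewrite ltr_pdivrMr //; lra.
have np : 0 < n2 (psub q p) by rewrite lt0r n2_ge0 andbT; apply/eqP => /psub_eq0 /esym.
set a := tau / _ in a0 a1 *.
have a1' : 0 < 1 - a by lra.
have : 0 < a * (1 - a) * n2 (psub q p) by rewrite mulr_gt0 // mulr_gt0.
lra.
Qed.

Lemma axpt_between p q (t1 t2 t3 : R) : 0 < t1 -> t1 <= t2 -> t2 <= t3 ->
  exists2 s, 0 <= s <= 1 & axpt p q t2 = lerp (axpt p q t1) (axpt p q t3) s.
Proof.
move=> t10 t12 t23; rewrite /axpt.
have mono (a b : R) : 0 < a -> a <= b -> a / (1 + a) <= b / (1 + b).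
  move=> a0 ab; have A0 : 0 < 1 + a by lra.
  have B0 : 0 < 1 + b by lra.
  by rewrite ler_pdivrMr // mulrAC ler_pdivlMr //; lra.
have t20 : 0 < t2 by lra.
have m1 := mono _ _ t10 t12; have m2 := mono _ _ t20 t23.
set a := t1 / _ in m1 *; set b := t2 / _ in m1 m2 *; set c := t3 / _ in m2 *.
have [ac|ac] := eqVneq a c.
  by exists 0; [rewrite lexx ler01|rewrite lerp0; congr lerp; apply/eqP; rewrite eq_le m1 {1}ac m2].
have ca : 0 < c - a by rewrite subr_gt0 lt_neqAle ac (le_trans m1 m2).
exists ((b - a) / (c - a)).
  by apply/andP; split; [apply: divr_ge0; lra|rewrite ler_pdivrMr //; lra].
by rewrite lerp_lerp; congr lerp; field; rewrite gt_eqF.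
Qed.

Lemma fixB_hypdata k p q l : SO21p k -> hypdata k p q l -> fixB k = [set p; q].
Proof. by move=> sk [[p1 q1 pq l1] [kp kq vp vq]]; exact: (@fixB_hyp _ k p q l). Qed.

Lemma axpt1 p q : axpt p q 1 = lerp p q (1 / 2).
Proof. by rewrite /axpt [RHS]lerpC; congr lerp; field. Qed.

(** The midpoint of a chord is its unique point nearest to the centre, so the choice made by [xget]
    is determined. *)
Lemma axis_baseE k p q l : SO21p k -> hypdata k p q l -> axis_base k = axpt p q 1.
Proof.
move=> sk hk; have fB := fixB_hypdata sk hk; have [[p1 q1 pq l1] _] := hk.
rewrite axpt1.
have np : 0 < n2 (psub p q) by rewrite lt0r n2_ge0 andbT; apply/eqP => /psub_eq0.
have onA z : onAxis k z -> exists2 t, 0 <= t <= 1 & z = lerp p q t.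
  move=> [dz [p' [q' []]]]; rewrite fB => /= -[->|->] [->|->] // _ [t [t01 ->]].
    by exists t.
  by exists (1 - t); [lra|rewrite lerpC].
have axm : onAxis k (lerp p q (1 / 2)).
  split; last first.
    exists p, q; split=> //; [by rewrite fB; left|by rewrite fB; right|exists (1 / 2); split=> //; lra].
  by rewrite -axpt1; apply: disk_axpt.
have minm : (forall z', onAxis k z' -> n2 (lerp p q (1 / 2)) <= n2 z').
  move=> z' /onA [t t01 ->]; rewrite !n2_lerp p1 q1; have := sqr_ge0 (t - 1 / 2); nra.
rewrite /axis_base.
have : [set z | onAxis k z /\ forall z', onAxis k z' -> n2 z <= n2 z'] (axis_base k).
  by apply: xgetPex; exists (lerp p q (1 / 2)).
rewrite -/(axis_base k) => -[/onA [t t01 ->]] /(_ _ axm); rewrite !n2_lerp p1 q1 => le.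
have : (t - 1 / 2) ^+ 2 <= 0 by nra.
by move=> sq; congr lerp; apply/eqP; rewrite -subr_eq0 -sqrf_eq0 eq_le sq sqr_ge0.
Qed.

(** The condition on [endpts] removes the axis itself, the only geodesic whose side function
    vanishes at both ends of the segment. *)
Lemma inter_hset (eta : {measure set (R * R) -> \bar R}) k p q l : SO21p k -> hypdata k p q l ->
  inter eta k = eta (hset (axpt p q 1) (act k (axpt p q 1))).
Proof.
move=> sk hk; rewrite /inter (axis_baseE sk hk) (fixB_hypdata sk hk).
have [[p1 q1 pq l1] _] := hk.
have l2 : 1 < l ^+ 2 by nra.
have ky := act_axpt sk hk ltr01; rewrite mulr1 in ky; rewrite ky.
set x := axpt p q 1; set y := axpt p q _.
have dx : disk x by exact: disk_axpt.
have dy : disk y by apply: disk_axpt => //; lra.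
have both w : Geo w -> (eside x w = 0 /\ eside y w = 0) <-> endpts w = [set p; q].
  move=> gw; split.
    rewrite /x /y /axpt !eside_lerp; set A := eside q w; set B := eside p w.
    move=> [e1 e2].
    have [A0 B0] : A = 0 /\ B = 0.
      have e1' : A + B = 0 by have := congr1 ( *%R 2) e1; rewrite mulr0 => <-; field.
      have n0 : 1 + l ^+ 2 != 0 by rewrite gt_eqF //; lra.
      have e2' : A + l ^+ 2 * B = 0.
        have := congr1 ( *%R (1 + l ^+ 2)) e2; rewrite mulr0 => <-; by field.
      have : (l ^+ 2 - 1) * B = 0 by lra.
      move=> /eqP; rewrite mulf_eq0 gt_eqF ?subr_gt0 //= => /eqP B0; split=> //; lra.
    have hp := eside0_endpts gw p1 B0; have hq := eside0_endpts gw q1 A0.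
    move: hp hq; rewrite /endpts /= => -[pE|pE] [qE|qE].
    - by case: pq; rewrite pE qE.
    - by rewrite -pE -qE.
    - by rewrite -pE -qE setUC.
    - by case: pq; rewrite pE qE.
  move=> ew; have hp : endpts w p by rewrite ew; left.
  have hq : endpts w q by rewrite ew; right.
  have e0 u : endpts w u -> eside u w = 0.
    by move=> [->|->]; have [] := eside_end w.
  by rewrite /x /y /axpt !eside_lerp !e0 // !mulr0 addr0.
congr (eta _); apply/seteqP; split=> w.
  move=> [gw [ne [t [/andP[t0 t1] ot]]]]; split=> //.
  have [_ e] := (onGeoP _ gw).1 ot.
  have n0 : ~ (eside x w = 0 /\ eside y w = 0) by move/(both w gw).
  have t01 : 0 <= t <= 1 by rewrite t0 ltW.
  have xy := lerp_cross t01 e.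
  have [x0|x0] := eqVneq (eside x w) 0; first by right; split=> // y0; exact: n0.
  left; rewrite lt_neqAle xy andbT mulf_neq0 //; apply/eqP => y0.
  move: e; rewrite eside_lerp y0 mulr0 addr0 => /eqP.
  by rewrite mulf_eq0 (negbTE x0) orbF subr_eq0 => /eqP te; rewrite -te ltxx in t1.
move=> hw; have [gw [xy n0]] := hset_dset hw; split=> //; split; first by move/(both w gw).
have [t t01 e] := cross_lerp xy n0; exists t; split; last first.
  by apply/(onGeoP _ gw); split=> //; exact: disk_lerp.
move/andP: t01 => [-> t1] /=; rewrite lt_neqAle t1 andbT; apply/eqP => te.
move: e; rewrite te lerp1 => y0; case: hw => _ [|[_ //]].
by rewrite y0 mulr0 ltxx.
Qed.

End AxisGeometry.

(** * Cutting segments into pieces of bounded length *)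

Section Breaking.
Variable R : realType.
Variables (G : set 'M[R]_3) (r : R).
Hypothesis fG : fuchsian_surface_group G.
Hypothesis r1 : 1 / 2 <= r < 1.
Hypothesis cob : forall z, disk z -> exists2 g, G g & n2 (act g z) <= r.
Variable eta : {measure set (R * R) -> \bar R}.
Hypothesis ceta : is_current G eta.
Implicit Types (g h k : 'M[R]_3) (p q x y z u : pt R) (s t a b c l : R).

Local Notation hE := (hh eta).
Local Notation dE := (dd eta).
Local Notation r' := ((1 + r) / 2).
(* The radius exceeds [r] so that points near the fundamental ball are covered too. *)
Definition cst (nu : {measure set (R * R) -> \bar R}) : R := mb nu ((1 + r) / 2).
Local Notation C := (cst eta).

Lemma r'1 : r' < 1. Proof. by have [? ?] := andP r1; lra. Qed.
Lemma ler' : r <= r'. Proof. by have [? ?] := andP r1; lra. Qed.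
Lemma rr0 : 0 <= r. Proof. by have [? ?] := andP r1; lra. Qed.

Lemma cst_ge0 : 0 <= C. Proof. exact: mb_ge0. Qed.

Lemma mb_le a b : a <= b -> b < 1 -> mb eta a <= mb eta b.
Proof.
move=> ab b1; have ma := @measurable_bset R a; have mb := @measurable_bset R b.
apply: fine_le.
- by apply: (sub_bset_fin ceta (a := a)) => //; lra.
- by apply: (sub_bset_fin ceta (a := b)).
- by rewrite le_measure ?inE // => w [gw h]; split=> //; exact: le_trans ab.
Qed.

Lemma ball_dd x y : n2 x <= r' -> n2 y <= r' -> dE x y <= C.
Proof. by move=> xr yr; apply: (dd_le_mb ceta) => //; exact: r'1. Qed.

Lemma dd_hh x y : disk x -> disk y -> dE x y <= hE x y + C.
Proof.
move=> dx dy; apply: le_trans (dd_le_hh fG r1 cob ceta dx dy) _.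
by rewrite lerD2l; apply: mb_le; [exact: ler'|exact: r'1].
Qed.

Lemma net_dd g x : G g -> disk x -> n2 (act (invmx g) x) <= r -> dE (act g org) x <= C.
Proof.
move=> Gg dx gx; have sg := G_SO fG Gg; have GV := G_V fG Gg.
have dgo := G_disk fG Gg (@disk_org R).
rewrite -(dd_act fG ceta GV dgo dx) actK //; last exact: org_le1.
by apply: ball_dd; [rewrite n2_org; have := rr0; have := ler'; lra|exact: le_trans gx ler'].
Qed.

Lemma hh_xx x : hE x x = 0.
Proof.
apply/eqP; rewrite eq_le hh_ge0 andbT -(dd_xx eta x).
rewrite /hh /dd (_ : dset x x = set0); last first.
  rewrite -subset0 => w [_ []]; rewrite -expr2 => h n0; apply: n0.
  suff /eqP : eside x w == 0 by [].
  by rewrite -sqrf_eq0 eq_le h sqr_ge0.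
by rewrite (_ : hset x x = set0) // -subset0 => w [_ []]; rewrite -?expr2 ?ltNge ?sqr_ge0 // => -[-> ].
Qed.

Lemma lerp_sub x y a b : b != 0 -> lerp x (lerp x y b) (a / b) = lerp x y a.
Proof. by move=> b0; rewrite /lerp /=; congr (_, _); field. Qed.

Lemma hh_sub x y a b : disk x -> disk y -> 0 <= a -> a <= b -> b <= 1 ->
  hE x (lerp x y b) = hE x (lerp x y a) + hE (lerp x y a) (lerp x y b).
Proof.
move=> dx dy a0 ab b1; have [b0|b0] := eqVneq b 0.
  have -> : a = 0 by lra.
  by rewrite b0 lerp0 hh_xx addr0.
have bp : 0 < b by rewrite lt0r b0; lra.
have db : disk (lerp x y b) by apply: disk_lerp => //; lra.
rewrite -(lerp_sub x y a b0); apply: (hh_add ceta) => //.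
by apply/andP; split; [apply: divr_ge0; lra|rewrite ler_pdivrMr //; lra].
Qed.

(** The element bringing the point of parameter t into the ball [n2 <= r] brings its neighbours into
    the larger ball [n2 <= r']. This bound survives atoms, where continuity fails. *)
Lemma locally_close x y t : disk x -> disk y -> 0 <= t <= 1 -> exists2 e, 0 < e &
  forall s, 0 <= s <= 1 -> `|s - t| < e -> dE (lerp x y s) (lerp x y t) <= C.
Proof.
move=> dx dy t01; have dt := disk_lerp t01 dx dy; have [g Gg gt] := cob dt.
have sg := G_SO fG Gg; have [r12 rlt1] := andP r1.
(* The condition [n2 (act g _) <= r'] cleared of denominators is [0 <= phi], with phi quadratic in
   s. *)
pose phi s := (1 - n2 (lerp x y s)) - (1 - r') * vc g (lerp x y s) ^+ 2.
pose N := n2 (psub x y); pose dv := vc g y - vc g x.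
pose b := - (n2 y - n2 x - N) - (1 - r') * (2 * vc g x * dv).
pose c := - N - (1 - r') * dv ^+ 2.
have phiE s : phi s - phi t = (s - t) * (b + c * (s + t)).
  by rewrite /phi !n2_lerp !vc_lerp -/N /b /c /dv; ring.
have phit : 0 < phi t.
  have := n2_act sg (disk_le1 dt); have := vc_gt0 sg (disk_le1 dt).
  rewrite /phi => v0 <-; set v := vc _ _ in v0 *; have v2 : 0 < v ^+ 2 by rewrite exprn_gt0.
  by rewrite -mulrBl mulr_gt0 //; lra.
have D0 : 0 < `|b| + 2 * `|c| + 1 by have := normr_ge0 b; have := normr_ge0 c; lra.
exists (phi t / (`|b| + 2 * `|c| + 1)); first by rewrite divr_gt0.
move=> s s01 st; have ds := disk_lerp s01 dx dy.
have phis : 0 <= phi s.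
  have : `|phi s - phi t| <= phi t.
    rewrite phiE normrM.
    have h1 : `|b + c * (s + t)| <= `|b| + 2 * `|c| + 1.
      apply: le_trans (ler_normD _ _) _; rewrite normrM.
      have h2 : `|s + t| <= 2 by rewrite ger0_norm; [lra|lra].
      by have := normr_ge0 c; nra.
    apply: le_trans (ler_wpM2l (normr_ge0 _) h1) _.
    by rewrite -ler_pdivlMr //; exact: ltW.
  by rewrite ler_norml => /andP[]; lra.
have gs : n2 (act g (lerp x y s)) <= r'.
  have := n2_act sg (disk_le1 ds); have := vc_gt0 sg (disk_le1 ds).
  move: phis; rewrite /phi; set v := vc _ _ => + v0 e; rewrite -e -mulrBl.
  by rewrite pmulr_lge0 ?exprn_gt0 //; lra.
rewrite -(dd_act fG ceta Gg ds dt); apply: ball_dd => //.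
by apply: le_trans gt ler'.
Qed.

(** The length is monotone along the segment but may jump: by at most C when reaching the supremum
    of the parameters of length at most L, and by at most C just beyond it. *)
Lemma hh_step x y (L : R) : disk x -> disk y -> 0 <= L -> L < hE x y ->
  exists2 s, 0 <= s <= 1 & L < hE x (lerp x y s) <= L + 2 * C.
Proof.
move=> dx dy L0 Lxy.
pose S := [set s : R | 0 <= s <= 1 /\ hE x (lerp x y s) <= L].
have S0 : S 0 by split; [rewrite lexx ler01|rewrite lerp0 hh_xx].
have ubS : ubound S 1 by move=> s [/andP[_ ?] _].
have hS : has_sup S by split; [exists 0|exists 1].
pose t := sup S.
have t0 : 0 <= t by apply: ub_le_sup S0; exists 1.
have t1 : t <= 1 by apply: ge_sup => //; exists 0.
have t01 : 0 <= t <= 1 by rewrite t0 t1.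
have dt := disk_lerp t01 dx dy.
have [e e0 He] := locally_close dx dy t01.
have [s1 Ss1 ts1] := sup_adherent e0 hS.
have [s101 hs1] := Ss1; have s1t : s1 <= t by apply: ub_le_sup => //; exists 1.
have ds1 := disk_lerp s101 dx dy.
have ht : hE x (lerp x y t) <= L + C.
  have [a1 a2] := andP s101.
  rewrite (hh_sub dx dy a1 s1t t1); apply: lerD => //.
  apply: le_trans (hh_le_dd ceta ds1 dt) _; apply: He => //.
  by rewrite -/t in ts1; rewrite ler0_norm; lra.
have C0 := cst_ge0.
have [te|tlt] := eqVneq t 1.
  exists 1; first by rewrite ler01 lexx.
  by move: ht; rewrite te lerp1 => ht; apply/andP; split; lra.
have tlt' : t < 1 by rewrite lt_neqAle tlt.
pose s2 := Num.min 1 (t + e / 2).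
have s2t : t < s2 by rewrite lt_min tlt' /=; lra.
have s21 : s2 <= 1 by rewrite ge_min lexx.
have s2e : s2 <= t + e / 2 by rewrite ge_min lexx orbT.
have s201 : 0 <= s2 <= 1 by apply/andP; split; lra.
exists s2 => //; apply/andP; split.
  rewrite ltNge; apply/negP => h; have : s2 <= t by apply: ub_le_sup; [exists 1|].
  by rewrite leNgt s2t.
have ds2 := disk_lerp s201 dx dy.
rewrite (hh_sub dx dy t0 (ltW s2t) s21).
have : hE (lerp x y t) (lerp x y s2) <= C.
  apply: le_trans (hh_le_dd ceta dt ds2) _; rewrite dd_sym; apply: He => //.
  by rewrite ger0_norm; lra.
by lra.
Qed.

(** A subdivision into n + 1 consecutive pieces; since trivial pieces can pad it ([chain_refl]),
    only an upper bound on their number matters. *)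
Fixpoint chain (Lm : R) (n : nat) x y : Prop :=
  if n is n'.+1 then exists2 s, 0 <= s <= 1 & hE x (lerp x y s) <= Lm /\ chain Lm n' (lerp x y s) y
  else hE x y <= Lm.

Lemma chain_refl Lm n x : 0 <= Lm -> chain Lm n x x.
Proof.
move=> L0; elim: n => [|n IH] /=; first by rewrite hh_xx.
by exists 0; rewrite ?lexx ?ler01 // lerp0 hh_xx.
Qed.

(** Each genuine cut uses up more than L of the additive length, so after n cuts at most L is
    left. *)
Lemma breaking (L : R) n x y : disk x -> disk y -> 0 <= L ->
  hE x y <= n.+1%:R * L -> chain (L + 2 * C) n x y.
Proof.
move=> dx + L0; have C0 := cst_ge0; elim: n x dx => [|n IH] x dx dy hxy.
  by rewrite mul1r in hxy; rewrite /=; lra.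
have [le|lt] := leP (hE x y) L.
  exists 1; first by rewrite ler01 lexx.
  by rewrite lerp1; split; [lra|apply: chain_refl; lra].
have [s s01 /andP[h1 h2]] := hh_step dx dy L0 lt.
exists s => //; split=> //; apply: IH => //; first exact: disk_lerp.
have := hh_add ceta dx dy s01; move: hxy; rewrite -natr1 mulrDl mul1r; lra.
Qed.

End Breaking.

(** * Powers of an element along its axis *)

Section Lengths.
Variable R : realType.
Variables (G : set 'M[R]_3) (r : R).
Hypothesis fG : fuchsian_surface_group G.
Hypothesis r1 : 1 / 2 <= r < 1.
Hypothesis cob : forall z, disk z -> exists2 g, G g & n2 (act g z) <= r.
Variable eta : {measure set (R * R) -> \bar R}.
Hypothesis ceta : is_current G eta.
Implicit Types (g h k : 'M[R]_3) (p q x y z u : pt R) (s t a b c l : R).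

Local Notation hE := (hh eta).
Local Notation dE := (dd eta).
Local Notation C := (cst r eta).

Lemma gpow_axpt k p q l n : G k -> hypdata k p q l ->
  act (gpow k n) (axpt p q 1) = axpt p q ((l ^+ 2) ^+ n).
Proof.
move=> Gk hk; have [[p1 q1 pq l1] _] := hk; have sk := G_SO fG Gk.
have L0 m : 0 < (l ^+ 2) ^+ m by rewrite !exprn_gt0 //; lra.
elim: n => [|n IH]; first by rewrite expr0 act1.
rewrite gpowS act_mul //; [|exact: (G_SO fG (G_pow fG n Gk))|].
  by rewrite IH (act_axpt sk hk) // [(l ^+ 2) ^+ n.+1]exprS.
by apply: disk_le1; apply: disk_axpt.
Qed.

(** Successive translates of the fundamental segment are aligned on the axis, where [hh] is additive
    and invariant. *)
Lemma hh_gpow k p q l n : G k -> hypdata k p q l ->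
  hE (axpt p q 1) (act (gpow k n) (axpt p q 1)) = n%:R * hE (axpt p q 1) (act k (axpt p q 1)).
Proof.
move=> Gk hk; have [[p1 q1 pq l1] _] := hk; have sk := G_SO fG Gk.
have L1 : 1 < l ^+ 2 by nra.
have L0 m : 0 < (l ^+ 2) ^+ m by rewrite !exprn_gt0 //; lra.
have dP tau : 0 < tau -> disk (axpt p q tau) by move=> ?; exact: disk_axpt.
elim: n => [|n IH]; first by rewrite act1 mul0r hh_xx.
have [s s01 sE] : exists2 s, 0 <= s <= 1 & axpt p q ((l ^+ 2) ^+ n) =
    lerp (axpt p q 1) (axpt p q ((l ^+ 2) ^+ n.+1)) s.
  apply: axpt_between => //; first by rewrite exprn_ege1 // ltW.
  by rewrite [(l ^+ 2) ^+ n.+1]exprS ler_peMl // ltW.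
rewrite (gpow_axpt _ Gk hk) (hh_add ceta _ _ s01) -?sE; try exact: dP.
rewrite -(gpow_axpt _ Gk hk) IH -natr1 mulrDl mul1r; congr (_ + _).
have -> : axpt p q ((l ^+ 2) ^+ n.+1) = act (gpow k n) (act k (axpt p q 1)).
  have GP := G_SO fG (G_pow fG n Gk).
  rewrite -act_mul ?disk_le1 //; last exact: dP.
  rewrite -(gpow_axpt _ Gk hk) -addn1 gpowD; congr act; congr (_ *m _).
  by rewrite gpowS /gpow /= mulmx1.
rewrite (hh_act fG ceta) //; [exact: G_pow|exact: dP|].
by apply: G_disk fG _ _ Gk (dP _ _).
Qed.

Lemma dd_gpow k x n : G k -> disk x -> dE x (act (gpow k n) x) <= n%:R * dE x (act k x).
Proof.
move=> Gk dx; have sk := G_SO fG Gk; elim: n => [|n IH]; first by rewrite act1 mul0r dd_xx.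
have Gn := G_pow fG n Gk; have dn := G_disk fG Gn dx; have dk := G_disk fG Gk dx.
rewrite gpowS act_mul ?disk_le1 //; last exact: (G_SO fG Gn).
apply: le_trans (dd_tri ceta dx dk (G_disk fG Gk dn)) _.
by rewrite (dd_act fG ceta Gk dx dn) -natr1 mulrDl mul1r; lra.
Qed.

(* The intersection number is the stable length of [dE] along powers. *)
Lemma inter_le_dd k p q l x : G k -> hypdata k p q l -> disk x ->
  hE (axpt p q 1) (act k (axpt p q 1)) <= dE x (act k x).
Proof.
move=> Gk hk dx; have [[p1 q1 pq l1] _] := hk.
set x0 := axpt p q 1; have d0 : disk x0 by exact: disk_axpt.
rewrite leNgt; apply/negP => lt.
set i := hE _ _ in lt; set d := dE _ _ in lt.
have bound n : n%:R * (i - d) <= 2 * dE x0 x.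
  have Gn := G_pow fG n Gk; have dn := G_disk fG Gn dx; have dn0 := G_disk fG Gn d0.
  have h1 := hh_gpow n Gk hk; rewrite -/x0 -/i in h1.
  have h2 := hh_le_dd ceta d0 dn0; rewrite h1 in h2.
  have h3 := dd_tri ceta d0 dx dn0; have h4 := dd_tri ceta dx dn dn0.
  have h5 := dd_gpow n Gk dx; rewrite -/d in h5.
  have := dd_act fG ceta Gn dx d0; rewrite (dd_sym eta x x0) => h6; rewrite h6 in h4.
  lra.
have id0 : 0 < i - d by lra.
pose n := (Num.truncn (2 * dE x0 x / (i - d))).+1.
have := bound n; rewrite -ler_pdivlMr // leNgt => /negP; apply.
have q0 : 0 <= 2 * dE x0 x / (i - d).
  by apply: divr_ge0; [rewrite mulr_ge0 // dd_ge0|exact: ltW].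
by have /andP[] := truncn_itv q0.
Qed.

Lemma interE k p q l : G k -> hypdata k p q l ->
  inter eta k = (hE (axpt p q 1) (act k (axpt p q 1)))%:E.
Proof.
move=> Gk hk; have sk := G_SO fG Gk; rewrite (inter_hset _ sk hk) /hh fineK //.
have [[p1 q1 pq l1] _] := hk; have d0 : disk (axpt p q 1) by exact: disk_axpt.
by apply: (hset_fin ceta) => //; exact: G_disk fG _ _ Gk d0.
Qed.

Lemma expr_archi (L tau : R) : 1 < L -> 1 <= tau -> exists n, L ^+ n <= tau < L ^+ n.+1.
Proof.
move=> L1 t1.
have bern n : 1 + n%:R * (L - 1) <= L ^+ n.
  elim: n => [|n IH]; first by rewrite mul0r addr0 expr0.
  rewrite exprS -natr1; have : 0 <= n%:R * (L - 1) by rewrite mulr_ge0 //; lra.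
  by move=> n0; nra.
have ex : exists n, L ^+ n <= tau by exists 0; rewrite expr0.
pose M := Num.truncn (tau / (L - 1)).
have L0 : 0 < L - 1 by lra.
have ub n : L ^+ n <= tau -> (n <= M)%N.
  move=> h; have h2 := le_trans (bern n) h.
  have : n%:R <= tau / (L - 1) by rewrite ler_pdivlMr //; lra.
  by move=> /le_truncn; rewrite natrK.
have [n h1 h2] := ex_maxnP ex ub; exists n; rewrite h1 ltNge /=; apply/negP => h3.
by have := h2 _ h3; rewrite ltnn.
Qed.

(** Powers of k tile its axis by fundamental segments. Commutation with k lets the translation be
    absorbed in a conjugator, see [conj_normalize]. *)
Lemma axis_translate k p q l tau : G k -> hypdata k p q l -> 0 < tau -> exists j, [/\ G j,
  j *m k = k *m j & exists2 s, 0 <= s <= 1 &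
  act j (axpt p q tau) = lerp (axpt p q 1) (act k (axpt p q 1)) s].
Proof.
move=> Gk hk t0; have [[p1 q1 pq l1] _] := hk; have sk := G_SO fG Gk.
have L1 : 1 < l ^+ 2 by nra.
have dP (u : R) : 0 < u -> disk (axpt p q u) by move=> ?; exact: disk_axpt.
have L0 m : 0 < (l ^+ 2) ^+ m by rewrite !exprn_gt0 //; lra.
have powE n (u : R) : 0 < u -> act (gpow k n) (axpt p q u) = axpt p q ((l ^+ 2) ^+ n * u).
  move=> u0; elim: n => [|n IH]; first by rewrite expr0 mul1r act1.
  rewrite gpowS act_mul //; [|exact: (G_SO fG (G_pow fG n Gk))|by apply: disk_le1; exact: dP].
  by rewrite IH (act_axpt sk hk) ?mulr_gt0 // [(l ^+ 2) ^+ n.+1]exprS mulrA.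
have comm n : gpow k n *m k = k *m gpow k n.
  by elim: n => [|n IH]; [rewrite /gpow /= mul1mx mulmx1|rewrite gpowS -mulmxA IH].
have kE : act k (axpt p q 1) = axpt p q (l ^+ 2) by rewrite (act_axpt sk hk) // mulr1.
rewrite kE.
have [t1|t1] := leP 1 tau.
  have [n /andP[n1 n2']] := expr_archi L1 t1.
  have Gn := G_pow fG n Gk; have sn := G_SO fG Gn; have un := SO21_unit sn.
  exists (invmx (gpow k n)); split; first exact: G_V.
    by rewrite -[RHS]mul1mx -{1}(mulVmx un) -mulmxA (mulmxA _ k) comm -(mulmxA k) mulmxV // mulmx1.
  have -> : act (invmx (gpow k n)) (axpt p q tau) = axpt p q (tau / (l ^+ 2) ^+ n).
    have q0 : 0 < tau / (l ^+ 2) ^+ n by rewrite divr_gt0.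
    rewrite -[RHS](actK sn) ?disk_le1 //; last exact: dP.
    by rewrite powE // mulrC mulfVK // lt0r_neq0.
  apply: axpt_between => //; first by rewrite ler_pdivlMr // mul1r.
  by rewrite ler_pdivrMr // -[_ * _]exprS ltW.
have ti : 1 <= tau^-1 by rewrite invf_ge1 // ltW.
have [n /andP[n1 n2']] := expr_archi L1 ti.
exists (gpow k n.+1); split; [exact: G_pow|exact: comm|].
rewrite powE //; apply: axpt_between => //.
  by rewrite -ler_pdivrMr // div1r ltW.
by rewrite [(l ^+ 2) ^+ n.+1]exprS -ler_pdivlMr //; apply: ler_wpM2l => //; exact: sqr_ge0.
Qed.

End Lengths.

(** * Transversality and stability of crossings *)

Section Filling.
Variable R : realType.
Implicit Types (g h k : 'M[R]_3) (p q x y z u : pt R) (w : R * R) (s t a b c l : R).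

Lemma bpt_inj a b : 0 <= a -> a < 2 * pi -> 0 <= b -> b < 2 * pi -> bpt a = bpt b -> a = b.
Proof.
move=> a0 a1 b0 b1 e.
have one c d : 0 <= c -> d < 2 * pi -> bpt c = bpt d -> c < d -> False.
  move=> c0 d1 ecd cd; have gw : Geo (c, d) by [].
  exact: (bpt_neq gw).
have [lt|gt|//] := ltgtP a b; exfalso; first exact: (one a b).
exact: (one b a).
Qed.

Lemma endpts_inj w w' : Geo w -> Geo w' -> endpts w = endpts w' -> w = w'.
Proof.
move=> gw gw' e; have [a0 [ab b1]] := gw; have [c0 [cd d1]] := gw'.
have a1 : w.1 < 2 * pi by lra.
have c1 : w'.1 < 2 * pi by lra.
have b0 : 0 <= w.2 by lra.
have d0 : 0 <= w'.2 by lra.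
case: (set2_eq e) => -[/bpt_inj e1 /bpt_inj e2].
  by rewrite [w]surjective_pairing [w']surjective_pairing e1 // e2.
by move: ab; rewrite e1 // e2 // ltNge ltW.
Qed.

(** The affine side function vanishes at an interior point of w; if it vanished at an endpoint too,
    the two geodesics would coincide. *)
Lemma transverse_eside w w' : Geo w -> Geo w' -> transverse w w' ->
  eside (bpt w.1) w' * eside (bpt w.2) w' < 0.
Proof.
move=> gw gw' [ww' [z [[dz [t [_ zE]]] oz']]].
have t01 : 0 < t < 1 by apply: (chord_in_disk (n2_bpt w.1) (n2_bpt w.2)); rewrite -zE.
have [_ e] := (onGeoP _ gw').1 oz'.
move: e; rewrite zE eside_lerp; set A := eside (bpt w.1) w'; set B := eside (bpt w.2) w' => e.
have [t0 t1] := andP t01.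
have [A0|A0] := eqVneq A 0.
  exfalso; apply: ww'; have B0 : B = 0.
    by move: e; rewrite A0 mulr0 add0r => /eqP; rewrite mulf_eq0 gt_eqF //= => /eqP.
  have e1 := eside0_endpts gw' (n2_bpt _) A0; have e2 := eside0_endpts gw' (n2_bpt _) B0.
  apply: endpts_inj => //; move: e1 e2; rewrite /endpts /= => -[E1|E1] [E2|E2].
  - by case: (bpt_neq gw); rewrite E1 E2.
  - by rewrite E1 E2.
  - by rewrite E1 E2 setUC.
  - by case: (bpt_neq gw); rewrite E1 E2.
have a2 : 0 < A ^+ 2 by rewrite lt0r sqr_ge0 sqrf_eq0 A0.
have : (1 - t) * A ^+ 2 + t * (A * B) = 0 by rewrite -(mulr0 A) -e; ring.
by nra.
Qed.

(** Crossings are tested with [dt] because it is polynomial in the endpoints, whereas [eside]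
    depends on the order of the angles. *)
Lemma dt_lip (d : R) p q x p' q' x' : 0 <= d ->
  n2 p <= 1 -> n2 q <= 1 -> n2 x <= 1 -> n2 p' <= 1 -> n2 q' <= 1 -> n2 x' <= 1 ->
  n2 (psub p p') <= d ^+ 2 -> n2 (psub q q') <= d ^+ 2 -> n2 (psub x x') <= d ^+ 2 ->
  `|dt p q x - dt p' q' x'| <= 16 * d.
Proof.
move=> d0.
have crd z : n2 z <= 1 -> `|z.1| <= 1 /\ `|z.2| <= 1.
  by rewrite /n2 !ler_norml => h; have := sqr_ge0 z.1; have := sqr_ge0 z.2; split; apply/andP; split; nra.
have crd2 z z' : n2 (psub z z') <= d ^+ 2 -> `|z.1 - z'.1| <= d /\ `|z.2 - z'.2| <= d.
  rewrite /n2 /psub /= !ler_norml; set a := _ - _; set b := _ - _ => h.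
  by have := sqr_ge0 a; have := sqr_ge0 b; split; apply/andP; split; nra.
move=> /crd[p1 p2] /crd[q1 q2] /crd[x1 x2] /crd[p1' p2'] /crd[q1' q2'] /crd[x1' x2'].
move=> /crd2[a1 a2] /crd2[b1 b2] /crd2[c1 c2].
have prod (a b a' b' : R) : `|a| <= 2 -> `|b'| <= 2 -> `|a - a'| <= 2 * d -> `|b - b'| <= 2 * d ->
    `|a * b - a' * b'| <= 8 * d.
  move=> h1 h2 h3 h4; have -> : a * b - a' * b' = a * (b - b') + (a - a') * b' by ring.
  apply: le_trans (ler_normD _ _) _; rewrite !normrM.
  have := ler_pM (normr_ge0 _) (normr_ge0 _) h1 h4.
  have := ler_pM (normr_ge0 _) (normr_ge0 _) h3 h2; lra.
have sub2 (a b : R) : `|a| <= 1 -> `|b| <= 1 -> `|a - b| <= 2.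
  by move=> h1 h2; apply: le_trans (ler_normB _ _) _; lra.
have subd (a b a' b' : R) : `|a - a'| <= d -> `|b - b'| <= d -> `|a - b - (a' - b')| <= 2 * d.
  move=> h1 h2; have -> : a - b - (a' - b') = (a - a') - (b - b') by ring.
  by apply: le_trans (ler_normB _ _) _; lra.
rewrite /dt.
have -> : (q.1 - p.1) * (x.2 - p.2) - (q.2 - p.2) * (x.1 - p.1) -
  ((q'.1 - p'.1) * (x'.2 - p'.2) - (q'.2 - p'.2) * (x'.1 - p'.1)) =
  ((q.1 - p.1) * (x.2 - p.2) - (q'.1 - p'.1) * (x'.2 - p'.2)) -
  ((q.2 - p.2) * (x.1 - p.1) - (q'.2 - p'.2) * (x'.1 - p'.1)) by ring.
apply: le_trans (ler_normB _ _) _.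
have := prod _ _ _ _ (sub2 _ _ q1 p1) (sub2 _ _ x2' p2') (subd _ _ _ _ b1 a1) (subd _ _ _ _ c2 a2).
have := prod _ _ _ _ (sub2 _ _ q2 p2) (sub2 _ _ x1' p1') (subd _ _ _ _ b2 a2) (subd _ _ _ _ c1 a1).
lra.
Qed.

Lemma measurable_near_geo w (e : R) : measurable [set w' | Geo w' /\ near_geo w w' e].
Proof.
have mc : measurable_fun setT (cos : R -> R) by exact: continuous_measurable_fun (@continuous_cos R).
have ms : measurable_fun setT (sin : R -> R) by exact: continuous_measurable_fun (@continuous_sin R).
have md (f : R * R -> R) (u : pt R) : measurable_fun setT f ->
    measurable_fun setT (fun w' => n2 (psub (bpt (f w')) u)).
  move=> mf; rewrite /n2 /psub /bpt /=; apply: measurable_funD; apply: measurable_funX;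
  by apply: measurable_funB => //; exact: (measurableT_comp _ mf).
apply: measurableI; first exact: measurable_Geo.
by apply: measurableU; apply: measurableI; apply: mset_lt => //; apply: md.
Qed.

Lemma near_n2 (x y : R * R) (e : R) : 0 < e -> \forall s \near (x, y),
  n2 (psub s.1 x) < e /\ n2 (psub s.2 y) < e.
Proof.
move=> e0; have [c1 c2 c3 c4] := coord_cvg x y.
apply: filterI.
  have c : n2 (psub s.1 x) @[s --> (x, y)] --> (x.1 - x.1) ^+ 2 + (x.2 - x.2) ^+ 2.
    by apply: sq2_cvg; apply: cvgB => //; exact: cvg_cst.
  by move/cvgr_lt: c; apply; rewrite !subrr expr0n addr0.
have c : n2 (psub s.2 y) @[s --> (x, y)] --> (y.1 - y.1) ^+ 2 + (y.2 - y.2) ^+ 2.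
  by apply: sq2_cvg; apply: cvgB => //; exact: cvg_cst.
by move/cvgr_lt: c; apply; rewrite !subrr expr0n addr0.
Qed.

End Filling.

(** * Properness of the orbit map for filling currents *)

Section Properness.
Variable R : realType.
Variables (G : set 'M[R]_3) (r : R).
Hypothesis fG : fuchsian_surface_group G.
Hypothesis r1 : 1 / 2 <= r < 1.
Hypothesis cob : forall z, disk z -> exists2 g, G g & n2 (act g z) <= r.
Variable eta : {measure set (R * R) -> \bar R}.
Hypothesis ceta : is_current G eta.
Hypothesis feta : filling eta.
Implicit Types (g h k : 'M[R]_3) (p q x y z u : pt R) (s t a b c l : R).

Local Notation hE := (hh eta).

(** Some w in the support crosses the geodesic from x to y. All geodesics near w still separate
    points near x from points near y, and they have positive mass. *)
Lemma crossing_local x y : n2 x = 1 -> n2 y = 1 -> x <> y ->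
  exists2 e : R, 0 < e & \forall s \near ((x : R * R), (y : R * R)), disk s.1 -> disk s.2 ->
    e <= hE s.1 s.2.
Proof.
move=> x1 y1 xy; have [w0 gw0 ew0] := geo_ex x1 y1 xy.
have [w [[gw sw] tw]] := feta gw0.
have sgn : eside x w * eside y w < 0.
  have := transverse_eside gw0 gw tw.
  by case: (set2_eq ew0) => -[-> ->] //; rewrite mulrC.
have h0 := hsin_gt0 gw.
pose D u := dt (bpt w.1) (bpt w.2) u.
have Dn u : eside u w != 0 -> D u != 0.
  by move=> n; rewrite /D dt_eside !mulf_neq0 // ?pnatr_eq0 // gt_eqF.
have x0 : eside x w != 0 by apply/eqP => e; rewrite e mul0r ltxx in sgn.
have y0 : eside y w != 0 by apply/eqP => e; rewrite e mulr0 ltxx in sgn.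
have DD : D x * D y < 0.
  rewrite /D !dt_eside.
  have -> : 2 * hsin w * eside x w * (2 * hsin w * eside y w) =
    (2 * hsin w) ^+ 2 * (eside x w * eside y w) by ring.
  by rewrite pmulr_rlt0 // exprn_gt0 // mulr_gt0.
(* The divisor 17 beats the Lipschitz constant 16 of [dt_lip], so signs persist. *)
pose d := Num.min `|D x| `|D y| / 17.
have d0 : 0 < d by rewrite divr_gt0 // lt_min !normr_gt0 !Dn.
have dx : 16 * d < `|D x|.
  have : d * 17 <= `|D x| by rewrite /d mulfVK // ge_min lexx.
  lra.
have dy : 16 * d < `|D y|.
  have : d * 17 <= `|D y| by rewrite /d mulfVK // ge_min lexx orbT.
  lra.
have dd0 : 0 < d ^+ 2 by rewrite exprn_gt0.
pose A := [set w' | Geo w' /\ near_geo w w' (d ^+ 2)].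
have Apos : (0 < eta A)%E by exact: sw.
have [m m0 mA] : exists2 m : R, 0 < m & (m%:E <= eta A)%E.
  case: (eta A) Apos => [v|_|//]; first by rewrite lte_fin => v0; exists v.
  by exists 1 => //; exact: leey.
exists m => //.
apply: filterS (near_n2 x y dd0) => s [sx sy] ds1 ds2.
have sub : A `<=` hset s.1 s.2.
  move=> w' [gw' ng]; split=> //; left.
  have h0' := hsin_gt0 gw'.
  suff : dt (bpt w'.1) (bpt w'.2) s.1 * dt (bpt w'.1) (bpt w'.2) s.2 < 0.
    rewrite !dt_eside.
    have -> : 2 * hsin w' * eside s.1 w' * (2 * hsin w' * eside s.2 w') =
      (2 * hsin w') ^+ 2 * (eside s.1 w' * eside s.2 w') by ring.
    by rewrite pmulr_rlt0 // exprn_gt0 // mulr_gt0.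
  have sgnD (a b a' b' : R) : a * b < 0 -> 16 * d < `|a| -> 16 * d < `|b| ->
      `|a' - a| <= 16 * d -> `|b' - b| <= 16 * d -> a' * b' < 0.
    rewrite !ler_norml => ab ha hb /andP[h1 h2] /andP[h3 h4].
    have [ap|am] := leP 0 a.
      have bm : b <= 0 by rewrite leNgt; apply/negP => ?; nra.
      rewrite ger0_norm // in ha; rewrite ler0_norm // in hb.
      have a'0 : 0 < a' by lra.
      have b'0 : b' < 0 by lra.
      by rewrite pmulr_rlt0.
    have bp : 0 <= b by rewrite leNgt; apply/negP => ?; nra.
    rewrite ltr0_norm // in ha; rewrite ger0_norm // in hb.
    have a'0 : a' < 0 by lra.
    have b'0 : 0 < b' by lra.
    by rewrite nmulr_rlt0.
  have x1' : n2 x <= 1 by rewrite x1.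
  have y1' : n2 y <= 1 by rewrite y1.
  have bb := @n2_bpt_le R.
  case: ng => -[n1 n2'].
    apply: (sgnD _ _ _ _ DD dx dy); apply: dt_lip => //; try exact: ltW; exact: disk_le1.
  rewrite -(mulrNN (dt _ _ s.1)) -!dtC.
  apply: (sgnD _ _ _ _ DD dx dy); apply: dt_lip => //; try exact: ltW; exact: disk_le1.
rewrite -lee_fin /hh fineK; last exact: (hset_fin ceta).
apply: le_trans mA _; rewrite le_measure ?inE //; first exact: measurable_near_geo.
exact: measurable_hset.
Qed.

(** By compactness: near a pair with a point inside the disk, or with points too close together, the
    conditions fail; any other pair consists of distinct points of the circle. *)
Lemma crossing : exists2 e : R, 0 < e <= (1 - r) / 2 & forall x y, disk x -> disk y ->
  1 - e <= n2 x -> 1 - e <= n2 y -> 2 * (1 - r) <= n2 (psub x y) -> e <= hE x y.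
Proof.
have [r12 rlt1] := andP r1.
pose P (x y : R * R) (e : R) := disk x -> disk y ->
  1 - e <= n2 x -> 1 - e <= n2 y -> 2 * (1 - r) <= n2 (psub x y) -> e <= hE x y.
have anti x y a b : P x y a -> b <= a -> P x y b.
  by move=> Pa ba dx dy xb yb xy; apply: (le_trans ba); apply: Pa => //; lra.
have [|e e0 H] := @cball_cover _ P anti.
- move=> x y x1 y1; have [c1 c2 c3 c4] := coord_cvg x y.
  have cx1 : n2 s.1 @[s --> (x, y)] --> n2 x by exact: sq2_cvg.
  have cy1 : n2 s.2 @[s --> (x, y)] --> n2 y by exact: sq2_cvg.
  have cxy : n2 (psub s.1 s.2) @[s --> (x, y)] --> n2 (psub x y).
    by apply: sq2_cvg; apply: cvgB.
  have [xl|xg] := ltP (n2 x) 1.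
    exists ((1 - n2 x) / 2); first by lra.
    have : \forall s \near (x, y), n2 s.1 < 1 - (1 - n2 x) / 2 by move/cvgr_lt: cx1; apply; lra.
    by apply: filterS => s h _ _ _ _ h'; exfalso; lra.
  have [yl|yg] := ltP (n2 y) 1.
    exists ((1 - n2 y) / 2); first by lra.
    have : \forall s \near (x, y), n2 s.2 < 1 - (1 - n2 y) / 2 by move/cvgr_lt: cy1; apply; lra.
    by apply: filterS => s h _ _ _ _ _ h'; exfalso; lra.
  have [l|g] := ltP (n2 (psub x y)) (2 * (1 - r)).
    exists 1 => //.
    have : \forall s \near (x, y), n2 (psub s.1 s.2) < 2 * (1 - r) by move/cvgr_lt: cxy; apply.
    by apply: filterS => s h _ _ _ _ _ _ h'; exfalso; lra.
  have xy : x <> y.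
    move=> e; move: g; rewrite e /n2 /psub /= !subrr expr0n addr0 /=; lra.
  have x1' : n2 x = 1 by lra.
  have y1' : n2 y = 1 by lra.
  have [e e0 He] := crossing_local x1' y1' xy.
  by exists e => //; apply: filterS He => s h _ _ d1 d2 _ _ _; exact: h.
exists (Num.min e ((1 - r) / 2)).
  by rewrite lt_min e0 ge_min lexx orbT andbT /=; lra.
move=> x y dx dy; apply: (anti x y e) => //; first by apply: H; exact: disk_le1.
by rewrite ge_min lexx.
Qed.

Lemma lerp_level x y (v : R) : n2 x <= v -> v <= n2 y ->
  exists2 t, 0 <= t <= 1 & n2 (lerp x y t) = v.
Proof.
move=> xv vy; pose f (t : R) := n2 (lerp x y t).
have cf : {within `[0, 1], continuous f}.
  apply: continuous_subspaceT => t; rewrite /f /n2 /lerp /=.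
  apply: sq2_cvg; apply: cvgD; apply: cvgM; try exact: cvg_cst; try exact: cvg_id;
    by apply: cvgB; [exact: cvg_cst|exact: cvg_id].
have fv : Num.min (f 0) (f 1) <= v <= Num.max (f 0) (f 1).
  by rewrite /f lerp0 lerp1 ge_min xv /= le_max vy orbT.
have [t] := IVT ler01 cf fv; rewrite in_itv /= => t01 ft; by exists t.
Qed.

(** A long segment contains a point z far from both ends. Moving z into the ball sends both ends
    near the circle, and [crossing] charges e. In the induction, the part up to z costs e and the
    part beyond z reproduces the situation. *)
Lemma proper_radii : exists2 e : R, 0 < e & forall n : nat, exists2 sg : R, sg < 1 &
  forall x y, n2 x <= r -> disk y -> sg < n2 y -> n%:R * e <= hE x y.
Proof.
have [r12 rlt1] := andP r1.
have [e /andP[e0 er] cr] := crossing.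
have q0 : 0 < 1 - r by lra.
have [sg0 [sg01 sg0r cl1]] : exists sg, [/\ sg < 1, r <= sg &
    forall x y, n2 x <= r -> disk y -> sg < n2 y -> e <= hE x y].
  (* An element sending x into [n2 <= 1 - e] has squared size at most [Q1], too small to bring z, at
     level [s2], back to the ball. [Q2] does the same for y. *)
  pose Q1 := 4 / (e * (1 - r) ^+ 2).
  have D1 : 0 < e * (1 - r) ^+ 2 by rewrite mulr_gt0 // exprn_gt0.
  have Q10 : 0 < Q1 by rewrite divr_gt0.
  have Q1E : Q1 * (e * (1 - r) ^+ 2) = 4 by rewrite mulfVK // gt_eqF.
  pose s2 := 1 - (1 - r) / (8 * Q1).
  have Q14 : 4 <= Q1.
    have : e * (1 - r) ^+ 2 <= 1 by nra.
    nra.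
  have i2 : (1 - r) / (8 * Q1) <= (1 - r) / 8.
    have h : 0 <= (1 - r) * (Q1 - 1) by rewrite mulr_ge0 //; lra.
    rewrite ler_pdivrMr; last by rewrite mulr_gt0.
    have -> : (1 - r) / 8 * (8 * Q1) = (1 - r) * Q1 by field.
    by lra.
  have i20 : 0 < (1 - r) / (8 * Q1) by rewrite divr_gt0 // mulr_gt0.
  have s2r : r <= s2 by rewrite /s2; lra.
  have s21 : s2 < 1 by rewrite /s2; lra.
  pose Q2 := 4 / ((1 - r) * (1 - s2) ^+ 2).
  have D2 : 0 < (1 - r) * (1 - s2) ^+ 2 by rewrite mulr_gt0 // exprn_gt0 //; lra.
  have Q20 : 0 < Q2 by rewrite divr_gt0.
  have i30 : 0 < e / (8 * Q2) by rewrite divr_gt0 // mulr_gt0.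
  exists (Num.max s2 (1 - e / (8 * Q2))); split.
  - by rewrite gt_max s21 /=; lra.
  - by rewrite le_max s2r.
  move=> x y xr dy; rewrite gt_max => /andP[ys2 ys3].
  have dx : disk x by rewrite /disk /=; lra.
  have xs2 : n2 x <= s2 by lra.
  have [t t01 zE] := lerp_level xs2 (ltW ys2).
  have dz := disk_lerp t01 dx dy; have [g Gg gz] := cob dz; have sg := G_SO fG Gg.
  set z := lerp x y t in zE dz gz.
  have gx : 1 - e < n2 (act g x).
    rewrite ltNge; apply/negP => h.
    have e1 : 1 - e < 1 by lra.
    have cb := cx_bound sg xr h rlt1 e1.
    have cQ : cx g ^+ 2 <= Q1 by rewrite /Q1 ler_pdivlMr //; move: cb; rewrite (_ : 1 - (1 - e) = e) //; ring.
    have nb := n2_bound sg (disk_le1 dz) gz (ltW rlt1).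
    have E1 : 1 - n2 z = (1 - r) / (8 * Q1) by rewrite zE /s2; ring.
    rewrite E1 in nb.
    have : 4 * cx g ^+ 2 * ((1 - r) / (8 * Q1)) <= 4 * Q1 * ((1 - r) / (8 * Q1)).
      by apply: ler_wpM2r; [exact: ltW|rewrite ler_pM2l].
    have -> : 4 * Q1 * ((1 - r) / (8 * Q1)) = (1 - r) / 2 by field; rewrite gt_eqF.
    by lra.
  have gy : 1 - e < n2 (act g y).
    rewrite ltNge; apply/negP => h.
    have e1 : 1 - e <= 1 by lra.
    have zs : n2 z <= s2 by rewrite zE.
    have cb := cx_bound sg zs gz s21 rlt1.
    have cQ : cx g ^+ 2 <= Q2 by rewrite /Q2 ler_pdivlMr.
    have nb := n2_bound sg (disk_le1 dy) h e1.
    have c2 := sqr_ge0 (cx g).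
    have h1 : 1 - n2 y <= e / (8 * Q2) by lra.
    have h2 : 4 * cx g ^+ 2 * (1 - n2 y) <= 4 * Q2 * (e / (8 * Q2)).
      apply: ler_pM => //; [by rewrite mulr_ge0|by rewrite subr_ge0 disk_le1|by rewrite ler_pM2l].
    have E : 4 * Q2 * (e / (8 * Q2)) = e / 2 by field; rewrite gt_eqF.
    by rewrite E in h2; lra.
  have dgx := G_disk fG Gg dx; have dgy := G_disk fG Gg dy.
  rewrite -(hh_act fG ceta Gg dx dy); apply: cr => //; try exact: ltW.
  (* The image segment meets [n2 <= r] while its ends have [n2] at least 1 - e; as e <= (1 - r) / 2,
     its squared length is at least 2 (1 - r), as [crossing] requires. *)
  have [s s01 sE] := act_lerp_ex sg t01 (disk_le1 dx) (disk_le1 dy).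
  move: gz; rewrite /z sE n2_lerp; set N := n2 (psub _ _).
  have N0 : 0 <= N by exact: n2_ge0.
  have [s0 s1] := andP s01.
  have ss : s * (1 - s) <= 1 / 4 by have := sqr_ge0 (s - 1 / 2); nra.
  have ssN : s * (1 - s) * N <= 1 / 4 * N by rewrite ler_wpM2r.
  have lin : 1 - e <= (1 - s) * n2 (act g x) + s * n2 (act g y) by nra.
  by lra.
exists e => //; elim=> [|n [sn sn1 IH]].
  by exists 0 => // x y _ _ _; rewrite mul0r hh_ge0.
pose s' := (1 + sg0) / 2.
have s'1 : s' < 1 by rewrite /s'; lra.
have s's : sg0 < s' by rewrite /s'; lra.
pose Q := 4 / ((1 - r) * (1 - s') ^+ 2).
have D2 : 0 < (1 - r) * (1 - s') ^+ 2 by rewrite mulr_gt0 // exprn_gt0 //; lra.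
have Q0 : 0 < Q by rewrite divr_gt0.
have i30 : 0 < (1 - sn) / (8 * Q) by rewrite divr_gt0 ?subr_gt0 // mulr_gt0.
exists (Num.max s' (1 - (1 - sn) / (8 * Q))); first by rewrite gt_max s'1 /=; lra.
move=> x y xr dy; rewrite gt_max => /andP[ys' ys3].
have dx : disk x by rewrite /disk /=; lra.
have xs' : n2 x <= s' by lra.
have [t t01 zE] := lerp_level xs' (ltW ys').
have dz := disk_lerp t01 dx dy; have [g Gg gz] := cob dz; have sg := G_SO fG Gg.
rewrite (hh_add ceta dx dy t01); set z := lerp x y t in zE dz gz *.
have h1 : e <= hE x z by apply: cl1 => //; rewrite zE.
have gy : sn < n2 (act g y).
  rewrite ltNge; apply/negP => h.
  have zs : n2 z <= s' by rewrite zE.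
  have cb := cx_bound sg zs gz s'1 rlt1.
  have cQ : cx g ^+ 2 <= Q by rewrite /Q ler_pdivlMr.
  have nb := n2_bound sg (disk_le1 dy) h (ltW sn1).
  have c2 := sqr_ge0 (cx g).
  have h1' : 1 - n2 y <= (1 - sn) / (8 * Q) by lra.
  have h2 : 4 * cx g ^+ 2 * (1 - n2 y) <= 4 * Q * ((1 - sn) / (8 * Q)).
    apply: ler_pM => //; [by rewrite mulr_ge0|by rewrite subr_ge0 disk_le1|by rewrite ler_pM2l].
  have E : 4 * Q * ((1 - sn) / (8 * Q)) = (1 - sn) / 2 by field; rewrite gt_eqF.
  by rewrite E in h2; lra.
have h2 : n%:R * e <= hE z y.
  by rewrite -(hh_act fG ceta Gg dz dy); apply: IH => //; exact: G_disk fG _ _ Gg dy.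
by rewrite -natr1 mulrDl mul1r; lra.
Qed.

Lemma proper (D : R) : exists B : R, forall g, G g -> dd eta org (act g org) <= D -> cx g <= B.
Proof.
have [e e0 H] := proper_radii.
pose n := (Num.truncn (`|D| / e)).+1.
have nD : D < n%:R * e.
  rewrite -ltr_pdivrMr //.
  have q0 : 0 <= `|D| / e by rewrite divr_ge0 // ltW.
  have /andP[_ h] := truncn_itv q0; apply: le_lt_trans h.
  by rewrite ler_pM2r ?invr_gt0 // ler_norm.
have [sg sg1 Hs] := H n.
exists (1 - sg)^-1 => g Gg dD; have sG := G_SO fG Gg.
have do0 := @disk_org R; have dgo := G_disk fG Gg do0.
have ng : n2 (act g org) <= sg.
  rewrite leNgt; apply/negP => h.
  have o1 : n2 (@org R) <= r by rewrite n2_org; exact: rr0 r1.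
  have := Hs _ _ o1 dgo h; have := hh_le_dd ceta do0 dgo; lra.
have := n2_act_org sG; have c1 := cx_ge1 sG => e1.
rewrite -[_^-1]mul1r ler_pdivlMr ?subr_gt0 //.
have : (1 - sg) <= 1 - n2 (act g org) by lra.
have : cx g <= cx g ^+ 2 by nra.
have : 0 < 1 - sg by lra.
nra.
Qed.

End Properness.

(** * Cardinalities and critical exponents *)

Section Counting.
Variable R : realType.

(** Bounds are tested on duplicate-free lists, so that an infinite set satisfies none and needs no
    separate treatment. *)
Definition cnt_le (T : eqType) (A : set T) (v : R) : Prop :=
  forall s : seq T, uniq s -> (forall a, a \in s -> A a) -> (size s)%:R <= v.

Lemma ecardP (T : choiceType) (A : set T) (v : R) : (ecard R A <= v%:E)%E <-> cnt_le A v.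
Proof.
rewrite /ecard; case: pselect => [fin|inf].
  rewrite lee_fin; split=> [h s us sA|]; last first.
    by move/(_ (fset_set A)); apply=> // a; rewrite in_fset_set // inE.
  apply: le_trans h; rewrite ler_nat; apply: (uniq_leq_size us) => a /sA Aa.
  by rewrite in_fset_set // inE.
rewrite leye_eq; split=> // h; exfalso.
have [B BA nB] := infinite_set_fset (Num.truncn (`|v|)).+1 inf.
have := h B (fset_uniq B) BA; apply/negP; rewrite -ltNge.
apply: le_lt_trans (ler_norm v) _; have /andP[_ h2] := truncn_itv (normr_ge0 v).
by apply: lt_le_trans h2 _; rewrite ler_nat.
Qed.

Lemma ecard_ge0 (T : choiceType) (A : set T) : (0 <= ecard R A)%E.
Proof. by rewrite /ecard; case: pselect => // _; rewrite lee_fin. Qed.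

Lemma ecard_infinite (T : choiceType) (A : set T) : infinite_set A -> ecard R A = +oo%E.
Proof. by rewrite /ecard; case: pselect. Qed.

Lemma size_fibres (T U : eqType) (f : T -> U) (s : seq T) (k : nat) :
  (forall b, (size [seq a <- s | f a == b] <= k)%N) ->
  (size s <= k * size (undup (map f s)))%N.
Proof.
move=> fib.
have -> : size s = (\sum_(b <- undup (map f s)) count (fun a => f a == b) s)%N.
  rewrite -sum1_size.
  rewrite (eq_big_seq (fun a => \sum_(b <- undup (map f s)) (f a == b))%N); last first.
    move=> a sa; rewrite (bigD1_seq (f a)) ?undup_uniq ?mem_undup ?map_f //= eqxx big1 //.
    by move=> b; rewrite eq_sym => /negbTE ->.
  rewrite exchange_big /=; apply: eq_bigr => b _.
  by rewrite -sum1_count [RHS]big_mkcond /=; apply: eq_bigr => a _; case: eqP.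
elim: (undup _) => [|b l IH]; first by rewrite big_nil.
by rewrite big_cons mulnS leq_add // -size_filter.
Qed.

Implicit Types (N : R -> \bar R) (y M : R).

Lemma elog_le (v : \bar R) (t y : R) : 0 < t -> (0 <= v)%E ->
  (elog v * (t^-1)%:E <= y%:E)%E = (v <= (expR (y * t))%:E)%E.
Proof.
move=> t0; case: v => [v|_|//] /=; last first.
  by rewrite gt0_mulye ?lte_fin ?invr_gt0 // !leye_eq.
rewrite lee_fin => v0; case: eqP => [->|/eqP vn0].
  by rewrite gt0_mulNye ?lte_fin ?invr_gt0 // leNye lee_fin expR_ge0.
have vp : 0 < v by rewrite lt0r vn0.
rewrite -EFinM !lee_fin ler_pdivrMr // -ler_expR lnK //.
Qed.

Lemma crit_exp_lt N y : (forall t, 0 <= N t)%E -> (crit_exp N < y%:E)%E ->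
  exists2 M, 0 < M & forall t, M <= t -> (N t <= (expR (y * t))%:E)%E.
Proof.
move=> N0 /ereal_inf_lt[_ [M M0 <-] lt]; exists M => // t Mt.
have t0 : 0 < t by exact: lt_le_trans Mt.
rewrite -elog_le //; apply: le_trans (ltW lt); apply: ereal_sup_ubound; by exists t.
Qed.

Lemma crit_exp_le N y M : (forall t, 0 <= N t)%E ->
  (forall t, M <= t -> (N t <= (expR (y * t))%:E)%E) -> (crit_exp N <= y%:E)%E.
Proof.
move=> N0 H; pose M' := Num.max M 1.
have M'0 : 0 < M' by rewrite lt_max ltr01 orbT.
apply: le_trans (ereal_inf_lbound _) _; first by exists M'.
apply: ge_ereal_sup => _ [t /= tM <-].
have t0 : 0 < t by exact: lt_le_trans tM.
by rewrite elog_le //; apply: H; apply: le_trans tM; rewrite le_max lexx.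
Qed.

Lemma crit_exp_ge0 N M : (forall t, M <= t -> (1 <= N t)%E) -> (0 <= crit_exp N)%E.
Proof.
move=> H; apply: le_ereal_inf_tmp => _ [M' /= M'0 <-].
pose t := Num.max M M'.
have t0 : 0 < t by rewrite lt_max M'0 orbT.
apply: (@le_trans _ _ (elog (N t) * (t^-1)%:E)%E); last first.
  by apply: ereal_sup_ubound; exists t => //=; rewrite le_max lexx orbT.
have : (1 <= N t)%E by apply: H; rewrite le_max lexx.
case: (N t) => [v|_|//] /=; last by rewrite gt0_mulye ?lte_fin ?invr_gt0.
rewrite lee_fin => v1; rewrite gt_eqF; last exact: lt_le_trans v1.
by rewrite -EFinM lee_fin; apply: mulr_ge0; [exact: ln_ge0|rewrite invr_ge0 ltW].
Qed.

Lemma crit_exp_infty N M : (forall t, M <= t -> N t = +oo%E) -> crit_exp N = +oo%E.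
Proof.
move=> H; apply/eqP; rewrite -leye_eq; apply: le_ereal_inf_tmp => _ [M' /= M'0 <-].
pose t := Num.max M M'.
have t0 : 0 < t by rewrite lt_max M'0 orbT.
apply: (@le_trans _ _ (elog (N t) * (t^-1)%:E)%E); last first.
  by apply: ereal_sup_ubound; exists t => //=; rewrite le_max lexx orbT.
by rewrite H ?le_max ?lexx // gt0_mulye ?lte_fin ?invr_gt0.
Qed.

Lemma affine_le_exp (a b e : R) : 0 <= a -> 0 <= b -> 0 < e ->
  exists2 M, 1 <= M & forall t, M <= t -> a + b * t <= expR (e * t).
Proof.
move=> a0 b0 e0; exists (Num.max 1 (4 * (a + b) / e ^+ 2)); first by rewrite le_max lexx.
move=> t; rewrite ge_max => /andP[t1 ht].
have e2 : 0 < e ^+ 2 by rewrite exprn_gt0.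
rewrite ler_pdivrMr // in ht.
have -> : e * t = 2%:R * (e * t / 2) by field.
rewrite expRM_natl.
have h1 := expR_ge1Dx (e * t / 2).
have h2 : 0 <= 1 + e * t / 2 by nra.
have h3 : (1 + e * t / 2) ^+ 2 <= expR (e * t / 2) ^+ 2.
  by rewrite ler_pXn2r ?nnegrE // expR_ge0.
apply: le_trans h3; have h4 : a + b * t <= (a + b) * t by nra.
have h5 : 4 * (a + b) * t <= t * e ^+ 2 * t by rewrite ler_wpM2r //; lra.
nra.
Qed.

(** An affine change of radius multiplies the exponent by its slope, and a factor of linear growth
    is absorbed by an arbitrarily small exponential. Restricting to v >= 1 lets additive constants
    be absorbed in v. *)
Lemma crit_exp_compare N1 N2 (M a b c k y : R) :
  (forall t, 0 <= N1 t)%E -> (forall t, 0 <= N2 t)%E ->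
  0 <= a -> 0 <= b -> 0 < k -> 0 <= y ->
  (forall t v : R, M <= t -> 1 <= v -> (N2 (k * t + c)%R <= v%:E)%E ->
     (N1 t <= ((a + b * t) * v)%R%:E)%E) ->
  (crit_exp N2 < y%:E)%E -> (crit_exp N1 <= (k * y)%:E)%E.
Proof.
move=> N10 N20 a0 b0 k0 y0 H lt; have [M2 M20 H2] := crit_exp_lt N20 lt.
apply/lee_addgt0Pr => e e0; rewrite -EFinD.
pose K := expR (y * `|c|); have K0 : 0 < K := expR_gt0 _.
have [M3 M31 H3] := @affine_le_exp (a * K) (b * K) e (mulr_ge0 a0 (ltW K0)) (mulr_ge0 b0 (ltW K0)) e0.
apply: (@crit_exp_le _ _ (Num.max (Num.max M M3) ((M2 + `|c|) / k))) => // t.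
rewrite !ge_max => /andP[/andP[tM tM3] tc]; rewrite ler_pdivrMr // in tc.
have t1 : 1 <= t by lra.
have cc : - `|c| <= c by have := ler_norm (- c); rewrite normrN; lra.
have arg : M2 <= k * t + c by lra.
have arg0 : 0 <= k * t + c by lra.
have h2 := H2 _ arg.
have v1 : 1 <= expR (y * (k * t + c)) by rewrite -expR0 ler_expR mulr_ge0.
apply: le_trans (H t _ tM v1 h2) _; rewrite lee_fin.
have h4 : expR (y * (k * t + c)) <= expR (k * y * t) * K.
  rewrite /K -expRD ler_expR; have := ler_norm c; nra.
have ab : 0 <= a + b * t by nra.
apply: le_trans (ler_wpM2l ab h4) _.
have -> : expR ((k * y + e) * t) = expR (k * y * t) * expR (e * t) by rewrite mulrDl expRD.
have := H3 t tM3; have := expR_gt0 (k * y * t).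
set X := expR (k * y * t); set Y := expR (e * t) => X0 hY.
by rewrite mulrCA ler_pM2l // mulrC; lra.
Qed.

Lemma crit_exp_mono N1 N2 (M a b c : R) :
  (forall t, 0 <= N1 t)%E -> (forall t, 0 <= N2 t)%E -> 0 <= a -> 0 <= b ->
  (0 <= crit_exp N2)%E ->
  (forall t v : R, M <= t -> 1 <= v -> (N2 (t + c)%R <= v%:E)%E ->
     (N1 t <= ((a + b * t) * v)%R%:E)%E) ->
  (crit_exp N1 <= crit_exp N2)%E.
Proof.
move=> N10 N20 a0 b0; case E: (crit_exp N2) => [v|//|//] v0 H; last exact: leey.
rewrite lee_fin in v0; apply/lee_addgt0Pr => e e0; rewrite -EFinD -[v + e]mul1r.
have ve : 0 <= v + e by lra.
apply: (crit_exp_compare N10 N20 a0 b0 ltr01 ve (M := M) (c := c)).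
  by move=> t u; rewrite mul1r; exact: H.
by rewrite E lte_fin; lra.
Qed.

End Counting.

(** * Base points and representatives of conjugacy classes *)

Section Exponents.
Variable R : realType.
Variables (G : set 'M[R]_3) (r : R).
Hypothesis fG : fuchsian_surface_group G.
Hypothesis r1 : 1 / 2 <= r < 1.
Hypothesis cob : forall z, disk z -> exists2 g, G g & n2 (act g z) <= r.
Variable eta : {measure set (R * R) -> \bar R}.
Hypothesis ceta : is_current G eta.
Implicit Types (g h k b : 'M[R]_3) (p q x y z u o : pt R) (s t a c l : R).

Local Notation hE := (hh eta).
Local Notation dE := (dd eta).
Local Notation C := (cst r eta).

Lemma ecard_ge1 (T : choiceType) (A : set T) (x : T) : A x -> (1 <= ecard R A)%E.
Proof.
move=> Ax; have := ecard_ge0 R A; case E: (ecard R A) => [v|//|//] _; last exact: leey.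
have /ecardP H : (ecard R A <= v%:E)%E by rewrite E.
by have := H [:: x] isT; rewrite lee_fin; apply=> y; rewrite inE => /eqP ->.
Qed.

Lemma metric_set o t : disk o -> [set g | G g /\ (d_eta eta (act g o) o <= t%:E)%E] =
  [set g | G g /\ dE o (act g o) <= t].
Proof.
move=> do0; apply/seteqP; split=> g /= [Gg h]; split=> //; move: h;
by rewrite (d_etaE ceta) ?lee_fin 1?dd_sym //; exact: (G_disk fG Gg).
Qed.

Lemma delta_metric_ge0 o : disk o -> (0 <= delta_metric G o eta)%E.
Proof.
move=> do0; apply: (@crit_exp_ge0 _ _ 0) => t t0; rewrite metric_set //.
by apply: (@ecard_ge1 _ _ 1%:M); split; [exact: G_1|rewrite act1 dd_xx].
Qed.

Lemma delta_metric_base_le o o' : disk o -> disk o' ->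
  (delta_metric G o eta <= delta_metric G o' eta)%E.
Proof.
move=> do0 do1.
apply: (@crit_exp_mono _ _ _ 0 1 0 (2 * dE o o')) => //; try by move=> t; exact: ecard_ge0.
  exact: delta_metric_ge0.
move=> t v t0 v1; rewrite !metric_set // mul0r addr0 mul1r => /ecardP H; apply/ecardP => s us sA.
apply: H => // g /sA [Gg h]; split=> //.
have dgo := G_disk fG Gg do0; have dgo' := G_disk fG Gg do1.
have := dd_tri ceta do1 do0 dgo'; have := dd_tri ceta do0 dgo dgo'.
by rewrite (dd_act fG ceta Gg do0 do1) (dd_sym eta o' o); lra.
Qed.

Lemma delta_metric_base o o' : disk o -> disk o' -> delta_metric G o eta = delta_metric G o' eta.
Proof. by move=> d1 d2; apply/eqP; rewrite eq_le !delta_metric_base_le. Qed.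

Lemma invmx_mul g h : g \in unitmx -> h \in unitmx -> invmx (g *m h) = invmx h *m invmx g.
Proof.
move=> ug uh; have e : (invmx h *m invmx g) *m (g *m h) = 1%:M.
  by rewrite -mulmxA (mulmxA (invmx g)) mulVmx // mul1mx mulVmx.
by rewrite -[LHS]mul1mx -e mulmxK // unitmx_mul ug uh.
Qed.

Lemma conj_conj b h g : G b -> G h ->
  b *m (h *m g *m invmx h) *m invmx b = (b *m h) *m g *m invmx (b *m h).
Proof.
by move=> /(G_SO fG)/SO21_unit ub /(G_SO fG)/SO21_unit uh; rewrite invmx_mul // !mulmxA.
Qed.

Lemma conjclass_conj b g : G b -> conjclass G (b *m g *m invmx b) = conjclass G g.
Proof.
move=> Gb; have ub := SO21_unit (G_SO fG Gb); apply/seteqP; split=> _ [c' Gc <-].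
  by exists (c' *m b); [exact: G_M|rewrite conj_conj].
exists (c' *m invmx b); first by apply: G_M => //; exact: G_V.
rewrite conj_conj //; last by apply: G_M => //; exact: G_V.
by rewrite -(mulmxA c') mulVmx // mulmx1.
Qed.

Lemma conjclass_self g : conjclass G g g.
Proof. by exists 1%:M; [exact: G_1|rewrite mul1mx invmx1 mulmx1]. Qed.

(** Conjugation puts the base point of the axis in the ball; the displacement of the centre then
    exceeds the intersection number by at most 3 C. *)
Lemma conj_rep g t : G g -> g <> 1%:M -> (inter eta g <= t%:E)%E ->
  exists g', [/\ G g', dE org (act g' org) <= t + 3 * C & conjclass G g' = conjclass G g].
Proof.
move=> Gg g1; have [p [q [l hk]]] := hyperbolic fG r1 cob Gg g1.
rewrite (interE fG ceta Gg hk) lee_fin => it.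
have [[p1 q1 pq l1] _] := hk.
set x0 := axpt p q 1 in it; have d0 : disk x0 by exact: disk_axpt.
have [b Gb bx] := cob d0; have sb := G_SO fG Gb; have sg := G_SO fG Gg.
exists (b *m g *m invmx b); split; [exact: G_conj| |exact: conjclass_conj].
set g' := b *m g *m invmx b; have Gg' : G g' by exact: G_conj.
have dbx := G_disk fG Gb d0; have dg := G_disk fG Gg d0; have dgo := G_disk fG Gg' (@disk_org R).
have do0 := @disk_org R.
have e : act g' (act b x0) = act b (act g x0).
  rewrite /g' (act_mul (SO21_mul sb sg) (SO21_V sb) (disk_le1 dbx)) (actK sb (disk_le1 d0)).
  exact: (act_mul sb sg (disk_le1 d0)).
have near0 : dE org (act b x0) <= C.
  apply: (ball_dd r1 ceta); last exact: le_trans bx (ler' r1).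
  by rewrite n2_org; have := ler' r1; have := rr0 r1; lra.
have t1 := dd_tri ceta do0 dbx dgo; have t2 := dd_tri ceta dbx (G_disk fG Gg' dbx) dgo.
have e2 : dE (act b x0) (act g' (act b x0)) <= hE x0 (act g x0) + C.
  by rewrite e (dd_act fG ceta Gb d0 dg); exact: (dd_hh fG r1 cob ceta).
have e3 : dE (act g' (act b x0)) (act g' org) = dE org (act b x0).
  by rewrite (dd_act fG ceta Gg' dbx do0) dd_sym.
lra.
Qed.

Lemma delta_geod_le_metric : (delta_geod G eta <= delta_metric G org eta)%E.
Proof.
apply: (@crit_exp_mono _ _ _ 0 1 0 (3 * C)) => //; try by move=> t; exact: ecard_ge0.
  exact: (delta_metric_ge0 (@disk_org R)).
move=> t v t0 v1; rewrite !(metric_set _ (@disk_org R)) mul0r addr0 mul1r => /ecardP H.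
apply/ecardP => s us sA.
pose P (cl : set 'M[R]_3) := [set g' | [/\ G g', dE org (act g' org) <= t + 3 * C & conjclass G g' = cl]].
have Pex cl : cl \in s -> P cl (xget 1%:M (P cl)).
  move=> /sA [g [Gg [g1 ig]] <-]; apply: xgetPex; exact: conj_rep.
rewrite -(size_map (fun cl => xget 1%:M (P cl))); apply: H.
  rewrite map_inj_in_uniq // => c1 c2 /Pex [_ _ e1] /Pex [_ _ e2] e.
  by rewrite -e1 -e2 e.
by move=> _ /mapP[cl /Pex [Gc dc _] ->].
Qed.

(** The conjugator may be changed by an element commuting with k0. A translation along the axis of
    k0 makes the midpoint of the axis of k come from the fundamental segment of k0. *)
Lemma conj_normalize b k k0 p q l p' q' l' : G b -> G k0 -> hypdata k0 p q l ->
  k = b *m k0 *m invmx b -> hypdata k p' q' l' ->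
  exists b', [/\ G b', k = b' *m k0 *m invmx b' & exists2 s, 0 <= s <= 1 &
    act b' (lerp (axpt p q 1) (act k0 (axpt p q 1)) s) = lerp p' q' (1 / 2)].
Proof.
move=> Gb Gk0 h0 kE hk; have sb := G_SO fG Gb; have sk0 := G_SO fG Gk0; have sV := SO21_V sb.
have Gk : G k by rewrite kE; exact: G_conj.
have sk := G_SO fG Gk.
have [[p1 q1 pq l1] _] := h0; have [[p1' q1' pq' l1'] [kp' kq' _ _]] := hk.
have F0 := fixB_hypdata sk0 h0.
have pull u : n2 u = 1 -> act k u = u -> [set p; q] (act (invmx b) u).
  move=> u1 ku; have u1' : n2 u <= 1 by rewrite u1.
  rewrite -F0; split; first exact: circ_act.
  have -> : k0 = invmx b *m k *m b.
    have ub := SO21_unit sb.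
    by rewrite kE !mulmxA mulVmx // mul1mx -mulmxA mulVmx // mulmx1.
  rewrite act_mul // ?actVK // ?n2_act_le1 //; last exact: SO21_mul.
  by rewrite act_mul // ku.
set m := lerp p' q' (1 / 2).
have dm : disk m by rewrite /m -axpt1; exact: disk_axpt.
have p1'' : n2 p' <= 1 by rewrite p1'.
have q1'' : n2 q' <= 1 by rewrite q1'.
have half : 0 <= (1 / 2 : R) <= 1 by lra.
have [s s01 mE] := act_lerp_ex sV half p1'' q1''.
have dbm : disk (act (invmx b) m) by exact: disk_act.
have [tau tau0 tE] : exists2 tau, 0 < tau & act (invmx b) m = axpt p q tau.
  have conv sg : disk (lerp q p sg) -> exists2 tau, 0 < tau & lerp q p sg = axpt p q tau.
    move=> /(chord_in_disk q1 p1) /andP[s0 s1].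
    exists (sg / (1 - sg)); first by rewrite divr_gt0 // subr_gt0.
    by rewrite /axpt; congr lerp; field; rewrite !gt_eqF //; lra.
  have bpq : act (invmx b) p' <> act (invmx b) q' by move/(act_inj sV p1'' q1'').
  move: dbm; rewrite -/m in mE; rewrite mE.
  have [a1|a1] := pull _ p1' kp'; have [a2|a2] := pull _ q1' kq'; rewrite ?a1 ?a2.
  - by case: bpq; rewrite a1 a2.
  - by rewrite lerpC; exact: conv.
  - exact: conv.
  - by case: bpq; rewrite a1 a2.
have [j [Gj jk [w w01 wE]]] := axis_translate fG Gk0 h0 tau0.
have sj := G_SO fG Gj; have uj := SO21_unit sj.
exists (b *m invmx j); split.
- by apply: G_M => //; exact: G_V.
- rewrite kE -(conj_conj _ Gb (G_V fG Gj)); congr (_ *m _ *m _).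
  by rewrite invmxK -mulmxA -jk mulmxA mulVmx // mul1mx.
exists w => //; rewrite -wE -tE.
have dbm1 := disk_le1 dbm.
rewrite act_mul //; [|exact: SO21_V|by apply: n2_act_le1].
by rewrite actK // actVK // disk_le1.
Qed.

End Exponents.

(** * Counting elements and classes for a proper pseudo-metric *)

Section FillingExponents.
Variable R : realType.
Variables (G : set 'M[R]_3) (r : R).
Hypothesis fG : fuchsian_surface_group G.
Hypothesis r1 : 1 / 2 <= r < 1.
Hypothesis cob : forall z, disk z -> exists2 g, G g & n2 (act g z) <= r.
Variable eta : {measure set (R * R) -> \bar R}.
Hypothesis ceta : is_current G eta.
Implicit Types (g h k b : 'M[R]_3) (p q x y z u o : pt R) (s t a c l : R).

Local Notation hE := (hh eta).
Local Notation dE := (dd eta).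
Local Notation C := (cst r eta).

Lemma dd_orbit g h : G g -> G h ->
  dE org (act (g *m invmx h) org) = dE (act (invmx g) org) (act (invmx h) org).
Proof.
move=> Gg Gh; have sg := G_SO fG Gg; have GV := G_V fG Gh; have do0 := @disk_org R.
rewrite (act_mul sg (G_SO fG GV) org_le1).
rewrite -(dd_act fG ceta Gg (G_disk fG (G_V fG Gg) do0) (G_disk fG GV do0)) (actVK sg) //.
exact: org_le1.
Qed.

Lemma net_org g x : G g -> disk x -> n2 (act g x) <= r -> dE (act (invmx g) org) x <= C.
Proof.
by move=> Gg dx gx; apply: (net_dd fG r1 ceta) => //; [exact: G_V|rewrite invmxK].
Qed.

(** Rounding the ends of a short piece to orbit points turns it into a group element of bounded
    displacement. *)
Lemma step_dd g g' x y (Lm : R) : G g -> G g' -> disk x -> disk y ->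
  n2 (act g x) <= r -> n2 (act g' y) <= r -> hE x y <= Lm ->
  dE org (act (g *m invmx g') org) <= Lm + 3 * C.
Proof.
move=> Gg Gg' dx dy gx gy hxy; have do0 := @disk_org R.
have GV := G_V fG Gg; have GV' := G_V fG Gg'.
have d1 := G_disk fG GV do0; have d2 := G_disk fG GV' do0.
rewrite (dd_orbit Gg Gg').
have := net_org Gg dx gx; have := net_org Gg' dy gy; have := dd_hh fG r1 cob ceta dx dy.
have := dd_tri ceta d1 dx d2; have := dd_tri ceta dx dy d2.
rewrite (dd_sym eta y); lra.
Qed.

Fixpoint prods (A : seq 'M[R]_3) (n : nat) : seq 'M[R]_3 :=
  if n is n'.+1 then [seq g *m h | g <- A, h <- prods A n'] else [:: 1%:M].

Lemma size_prods A n : size (prods A n) = (size A ^ n)%N.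
Proof. by elim: n => // n IH; rewrite /= size_allpairs IH expnS. Qed.

(** With all division points rounded to orbit points, [g *m invmx g'] telescopes into n + 1 steps,
    each in A. *)
Lemma chain_prods (Lm : R) A n g g' x y :
  (forall h, G h -> dE org (act h org) <= Lm + 3 * C -> h \in A) ->
  disk x -> disk y -> chain eta Lm n x y -> G g -> G g' ->
  n2 (act g x) <= r -> n2 (act g' y) <= r -> g *m invmx g' \in prods A n.+1.
Proof.
move=> HA; elim: n g x => [|n IH] g x dx dy ch Gg Gg' gx gy.
  apply/allpairsP; exists (g *m invmx g', 1%:M); split=> //=; rewrite ?mem_head ?mulmx1 //.
  apply: HA; first by apply: G_M => //; exact: G_V.
  exact: (step_dd Gg Gg' dx dy).
have [s s01 [h1 ch']] := ch; have dz := disk_lerp s01 dx dy.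
have [k Gk kz] := cob dz; have uk := SO21_unit (G_SO fG Gk).
apply/allpairsP; exists (g *m invmx k, k *m invmx g'); split=> /=.
- apply: HA; first by apply: G_M => //; exact: G_V.
  exact: (step_dd Gg Gk dx dz).
- exact: (IH k (lerp x y s)).
- by rewrite -mulmxA (mulmxA (invmx k)) mulVmx // mul1mx.
Qed.

Lemma chain_cover (Lm : R) n x y : 0 <= Lm -> disk x -> disk y -> chain eta Lm n x y ->
  exists2 cs : seq 'M[R]_3, size cs = n.+1 & (forall g, g \in cs -> G g) /\
  forall t, 0 <= t <= 1 -> exists2 g, g \in cs & dE (act g org) (lerp x y t) <= Lm + 2 * C.
Proof.
move=> L0; elim: n x => [|n IH] x dx dy ch.
  have [g Gg gx] := cob dx; exists [:: invmx g] => //; split.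
    by move=> h; rewrite inE => /eqP ->; exact: G_V.
  move=> t t01; exists (invmx g); first by rewrite inE.
  have dz := disk_lerp t01 dx dy; have do0 := G_disk fG (G_V fG Gg) (@disk_org R).
  have := dd_tri ceta do0 dx dz; have := net_org Gg dx gx; have := dd_hh fG r1 cob ceta dx dz.
  have := hh_add ceta dx dy t01; have := hh_ge0 eta (lerp x y t) y; rewrite /= in ch; lra.
have [s s01 [h1 ch']] := ch; have dz := disk_lerp s01 dx dy.
have [cs scs [csG csP]] := IH _ dz dy ch'.
have [g Gg gx] := cob dx; exists (invmx g :: cs); first by rewrite /= scs.
split=> [h|t t01]; first by rewrite inE => /orP[/eqP ->|/csG //]; exact: G_V.
have [s0 s1] := andP s01; have [t0 t1] := andP t01.
have [ts|st] := leP t s.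
  exists (invmx g); first by rewrite mem_head.
  have dt := disk_lerp t01 dx dy; have do0 := G_disk fG (G_V fG Gg) (@disk_org R).
  have := dd_tri ceta do0 dx dt; have := net_org Gg dx gx; have := dd_hh fG r1 cob ceta dx dt.
  have := hh_sub ceta dx dy t0 ts s1; have := hh_ge0 eta (lerp x y t) (lerp x y s); lra.
have e : lerp x y t = lerp (lerp x y s) y ((t - s) / (1 - s)).
  have q0 : 1 - s != 0 by rewrite gt_eqF //; lra.
  by rewrite /lerp /=; congr (_, _); field.
have [|h hcs hd] := csP ((t - s) / (1 - s)).
  by apply/andP; split; [apply: divr_ge0; lra|rewrite ler_pdivrMr; lra].
by exists h; [rewrite inE hcs orbT|rewrite e].
Qed.

Section Proper.
Hypothesis prop : forall D : R, exists B : R, forall g, G g -> dE org (act g org) <= D -> cx g <= B.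

Lemma proper_seq (D : R) : exists A : seq 'M[R]_3, forall g, G g -> dE org (act g org) <= D -> g \in A.
Proof.
have [B HB] := prop D; have [A HA] := finite_cx fG B.
by exists A => g Gg gD; apply: HA => //; exact: HB.
Qed.

Lemma trunc_bound (t : R) : 0 <= t -> t <= (Num.truncn t).+1%:R * 1 /\ (Num.truncn t).+1%:R <= t + 1.
Proof.
move=> t0; have /andP[h1 h2] := truncn_itv t0; rewrite mulr1; split; first exact: ltW.
by rewrite -natr1; lra.
Qed.

(** At most |A|^(n+1) elements with n + 1 <= t + 1 <= 2t; bounding |A| by exp |A| gives the exponent
    2 |A|. *)
Lemma delta_metric_fin : exists2 v : R, 0 <= v & (delta_metric G org eta <= v%:E)%E.
Proof.
have C0 := cst_ge0 r eta; have do0 := @disk_org R.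
have [A HA] := proper_seq (1 + 2 * C + 3 * C).
pose K : R := (size A)%:R; have K0 : 0 <= K by exact: ler0n.
exists (2 * K); first by rewrite mulr_ge0.
apply: (@crit_exp_le _ _ _ 1) => [t|t t1]; first exact: ecard_ge0.
rewrite (metric_set fG ceta _ do0); apply/ecardP => s us sA.
have t0 : 0 <= t by lra.
have [b1 b2] := trunc_bound t0; set n := Num.truncn t in b1 b2.
have or : n2 (@org R) <= r by rewrite n2_org; exact: (rr0 r1).
have sub : {subset s <= prods A n.+1}.
  move=> g /sA [Gg dg]; have dgo := G_disk fG Gg do0.
  have ch : chain eta (1 + 2 * C) n org (act g org).
    apply: (breaking fG r1 cob ceta) => //.
    by apply: le_trans b1; apply: le_trans dg; exact: (hh_le_dd ceta).
  have := @chain_prods (1 + 2 * C) A n 1%:M (invmx g) org (act g org) HA do0 dgo ch (G_1 fG) (G_V fG Gg).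
  by rewrite act1 (actK (G_SO fG Gg) org_le1) invmxK mul1mx => /(_ or or).
have := uniq_leq_size us sub; rewrite size_prods => h.
apply: (@le_trans _ _ (K ^+ n.+1)); first by rewrite /K -natrX ler_nat.
have KK : K <= expR K by have := expR_ge1Dx K; lra.
apply: (@le_trans _ _ (expR K ^+ n.+1)); first by rewrite lerXn2r ?nnegrE ?expR_ge0.
rewrite -expRM_natl ler_expR; nra.
Qed.

(** A conjugate is determined by its normalised conjugator b. The midpoint of its axis is b z with z
    on the fundamental segment of k0, and z is near one of n + 1 net points g org; then b g lies in
    a finite set, and the pair of b g and g recovers b. *)
Lemma fibre_bound (rho : R) : rho < 1 -> exists K : nat, forall k0 p q l n (ks : seq 'M[R]_3),
  G k0 -> hypdata k0 p q l -> hE (axpt p q 1) (act k0 (axpt p q 1)) <= n.+1%:R * 1 -> uniq ks ->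
  (forall k, k \in ks -> (exists2 b, G b & k = b *m k0 *m invmx b) /\
     exists p' q' l', hypdata k p' q' l' /\ n2 (lerp p' q' (1 / 2)) <= rho) ->
  (size ks <= K * n.+1)%N.
Proof.
move=> rho1; have C0 := cst_ge0 r eta; have do0 := @disk_org R.
pose a := Num.max rho 0; have a1 : a < 1 by rewrite gt_max rho1 ltr01.
have [A HA] := proper_seq (mb eta a + (1 + 2 * C + 2 * C)).
exists (size A) => k0 p q l n ks Gk0 h0 hn uks H.
have [[p1 q1 pq l1] _] := h0.
set x0 := axpt p q 1 in hn *; have d0 : disk x0 by exact: disk_axpt.
have dk0 := G_disk fG Gk0 d0.
have ch : chain eta (1 + 2 * C) n x0 (act k0 x0) by exact: (breaking fG r1 cob ceta).
have Lm0 : 0 <= 1 + 2 * C by lra.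
have [cs scs [csG csP]] := chain_cover Lm0 d0 dk0 ch.
rewrite -scs -(size_allpairs (fun h g => (h *m invmx g) *m k0 *m invmx (h *m invmx g))).
apply: (uniq_leq_size uks) => k /H [[b Gb kE] [p' [q' [l' [hk mk]]]]].
have [b' [Gb' kE' [s s01 sE]]] := conj_normalize fG Gb Gk0 h0 kE hk.
have dz := disk_lerp s01 d0 dk0; set z := lerp _ _ s in sE dz.
have [g gcs gz] := csP s s01; have Gg := csG _ gcs; have dgo := G_disk fG Gg do0.
have Gbg : G (b' *m g) by exact: G_M.
have dm : disk (lerp p' q' (1 / 2)) by rewrite -sE; exact: (G_disk fG Gb').
apply/allpairsP; exists (b' *m g, g); split=> //=; last first.
  have -> : b' *m g *m invmx g = b' by rewrite -mulmxA mulmxV ?mulmx1 // (SO21_unit (G_SO fG Gg)).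
  exact: kE'.
apply: HA => //.
rewrite (act_mul (G_SO fG Gb') (G_SO fG Gg) org_le1).
apply: le_trans (dd_tri ceta do0 dm (G_disk fG Gb' dgo)) _; apply: lerD.
  by apply: (dd_le_mb ceta a1); rewrite ?n2_org /a le_max ?lexx ?orbT // mk.
by rewrite -sE (dd_act fG ceta Gb' dz dgo) dd_sym.
Qed.

Lemma nontrivial_ex : exists2 g, G g & g <> 1%:M.
Proof.
have e1 : n2 ((1, 0) : pt R) = 1 by rewrite /n2 /=; ring.
have [f Gf f1] := no_common_fixed fG r1 cob e1.
by exists f => // e; apply: f1; rewrite e act1.
Qed.

Lemma delta_geod_ge0 : (0 <= delta_geod G eta)%E.
Proof.
have [f Gf f1] := nontrivial_ex.
have [p [q [l hk]]] := hyperbolic fG r1 cob Gf f1.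
apply: (@crit_exp_ge0 _ _ (hE (axpt p q 1) (act f (axpt p q 1)))) => t it.
apply: (@ecard_ge1 _ _ _ (conjclass G f)); exists f => //; split=> //; split=> //.
by rewrite (interE fG ceta Gf hk) lee_fin.
Qed.

Lemma dd_cx_le (B : R) f : G f -> cx f <= B -> dE org (act f org) <= mb eta (1 - (B ^+ 2)^-1).
Proof.
move=> Gf fB; have sf := G_SO fG Gf; have c1 := cx_ge1 sf.
have B1 : 1 <= B by lra.
have B2 : 0 < B ^+ 2 by rewrite exprn_gt0 //; lra.
have iB : 0 < (B ^+ 2)^-1 by rewrite invr_gt0.
have iB1 : (B ^+ 2)^-1 <= 1 by rewrite invf_le1 //; nra.
apply: (dd_le_mb ceta); [lra|rewrite n2_org; lra|].
have e := n2_act_org sf; have c2 : 0 < cx f ^+ 2 by rewrite exprn_gt0 //; lra.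
have : (B ^+ 2)^-1 <= 1 - n2 (act f org).
  have -> : 1 - n2 (act f org) = (cx f ^+ 2)^-1 by apply: (mulfI (lt0r_neq0 c2)); rewrite e divff // lt0r_neq0.
  rewrite lef_pV2 ?posrE //; nra.
lra.
Qed.

(** Each large g is sent to the pair of its closing factor f and the class of g f. There are
    boundedly many f and, by [fibre_bound], at most linearly many g over each pair; the finitely
    many small g are counted apart. *)
Lemma delta_metric_le_geod : (delta_metric G org eta <= delta_geod G eta)%E.
Proof.
have do0 := @disk_org R.
have [c0 [B0 [rho [B00 rho1 cls]]]] := closing fG r1 cob.
have [K HK] := fibre_bound rho1.
have [S0 HS0] := finite_cx fG c0; have [FS HFS] := finite_cx fG B0.
pose D0 := mb eta (1 - (B0 ^+ 2)^-1); have D00 : 0 <= D0 by exact: mb_ge0.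
pose KF : R := (K * size FS)%:R; have KF0 : 0 <= KF by exact: ler0n.
(* The small elements, plus [KF] times the gap between t and the bound t + D0 + 1 on n + 1. *)
pose a : R := (size S0)%:R + KF * (D0 + 1).
have a0 : 0 <= a by rewrite addr_ge0 ?ler0n // mulr_ge0 //; lra.
apply: (@crit_exp_mono _ _ _ 0 a KF D0) => //; try by move=> t; exact: ecard_ge0.
  exact: delta_geod_ge0.
move=> t v t0 v1 /ecardP Hv; rewrite (metric_set fG ceta _ do0); apply/ecardP => s us sA.
pose P g := [set f | [/\ G f, cx f <= B0, g *m f <> 1%:M &
    forall p q l, hypdata (g *m f) p q l -> n2 (lerp p q (1 / 2)) <= rho]].
pose F g := xget 1%:M (P g).
have FP g : G g -> c0 <= cx g -> P g (F g) by move=> Gg cg; apply: xgetPex; exact: cls.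
pose s2 := [seq g <- s | c0 <= cx g].
have us2 : uniq s2 by rewrite filter_uniq.
have s2P g : g \in s2 -> [/\ G g, dE org (act g org) <= t & P g (F g)].
  by rewrite mem_filter => /andP[cg /sA [Gg dg]]; split=> //; exact: FP.
pose n := Num.truncn (t + D0).
have tD : 0 <= t + D0 by lra.
have [b1 b2] := trunc_bound tD; rewrite -/n in b1 b2.
have kP g : g \in s2 -> [/\ G (g *m F g), g *m F g <> 1%:M &
    dE org (act (g *m F g) org) <= t + D0].
  move=> /s2P [Gg dg [Gf cf kf _]]; split=> //; first exact: G_M.
  rewrite (act_mul (G_SO fG Gg) (G_SO fG Gf) org_le1).
  have dfo := G_disk fG Gf do0; have dgo := G_disk fG Gg do0.
  have := dd_tri ceta do0 dgo (G_disk fG Gg dfo); rewrite (dd_act fG ceta Gg do0 dfo).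
  by have := dd_cx_le Gf cf; rewrite -/D0; lra.
pose cl g := conjclass G (g *m F g).
pose phi g := (F g, cl g).
have fib fc : (size [seq g <- s2 | phi g == fc] <= K * n.+1)%N.
  case E: [seq g <- s2 | phi g == fc] => [//|g0 L].
  rewrite -E; have g0m : g0 \in [seq g <- s2 | phi g == fc] by rewrite E mem_head.
  move: g0m; rewrite mem_filter => /andP[/eqP phi0 g0s].
  have [Gk0 k01 dk0] := kP _ g0s.
  have [p [q [l h0]]] := hyperbolic fG r1 cob Gk0 k01.
  rewrite -(size_map (fun g => g *m F g0)).
  apply: (HK _ p q l n _ Gk0 h0).
  - apply: le_trans b1; apply: le_trans dk0.
    by apply: (inter_le_dd fG ceta Gk0 h0).
  - have [_ _ [Gf _ _ _]] := s2P _ g0s; have uf := SO21_unit (G_SO fG Gf).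
    rewrite map_inj_uniq ?filter_uniq // => g g' e.
    by rewrite -[g](mulmxK uf) e mulmxK.
  - move=> _ /mapP[g + ->]; rewrite mem_filter => /andP[/eqP phig gs].
    have [eF ec] : F g = F g0 /\ cl g = cl g0 by move: phig; rewrite -phi0 => -[].
    have -> : g *m F g0 = g *m F g by rewrite eF.
    have [Gk k1 _] := kP _ gs; split.
      have : conjclass G (g0 *m F g0) (g *m F g) by rewrite -/(cl g0) -ec; exact: conjclass_self.
      by move=> [b Gb e]; exists b.
    have [p' [q' [l' hk]]] := hyperbolic fG r1 cob Gk k1.
    exists p', q', l'; split=> //; have [_ _ [_ _ _ H]] := s2P _ gs; exact: H hk.
have h2 := size_fibres fib.
have h3 : (size (undup (map phi s2)) <= size FS * size (undup (map cl s2)))%N.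
  rewrite -(size_allpairs (fun (x : 'M[R]_3) (y : set 'M[R]_3) => (x, y))).
  apply: uniq_leq_size; first exact: undup_uniq.
  move=> fc; rewrite mem_undup => /mapP[g gs ->].
  apply/allpairsP; exists (F g, cl g); split=> //=.
    by have [_ _ [Gf cf _ _]] := s2P _ gs; exact: HFS.
  by rewrite mem_undup map_f.
have h4 : (size (undup (map cl s2)))%:R <= v.
  apply: Hv; first exact: undup_uniq.
  move=> c; rewrite mem_undup => /mapP[g gs ->]; have [Gk k1 dk] := kP _ gs.
  exists (g *m F g) => //; split=> //; split=> //.
  have [p [q [l hk]]] := hyperbolic fG r1 cob Gk k1.
  rewrite (interE fG ceta Gk hk) lee_fin; apply: le_trans dk.
  by apply: (inter_le_dd fG ceta Gk hk).
have h1 : (size [seq g <- s | ~~ (c0 <= cx g)%R] <= size S0)%N.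
  apply: uniq_leq_size; first by rewrite filter_uniq.
  move=> g; rewrite mem_filter -ltNge => /andP[cg /sA [Gg _]]; apply: HS0 => //; exact: ltW.
have sz : size s = (size s2 + size [seq g <- s | ~~ (c0 <= cx g)%R])%N.
  by rewrite !size_filter -(count_predC (fun g => c0 <= cx g)%R).
rewrite sz natrD.
have h5 : (size s2)%:R <= KF * n.+1%:R * v.
  have e1 : (size s2 <= K * size FS * n.+1 * size (undup (map cl s2)))%N.
    apply: leq_trans h2 _.
    have -> : (K * size FS * n.+1 * size (undup (map cl s2)) =
       (K * n.+1) * (size FS * size (undup (map cl s2))))%N by rewrite -!mulnA; congr muln; rewrite mulnCA.
    by rewrite leq_mul2l h3 orbT.
  apply: (@le_trans _ _ (K * size FS * n.+1 * size (undup (map cl s2)))%:R); first by rewrite ler_nat.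
  rewrite natrM [(_ * n.+1)%:R]natrM -/KF; apply: ler_wpM2l => //.
  by rewrite mulr_ge0 // ler0n.
have h6 : (size [seq g <- s | ~~ (c0 <= cx g)%R])%:R <= (size S0)%:R * v.
  apply: (@le_trans _ _ (size S0)%:R); first by rewrite ler_nat.
  by rewrite ler_peMr // ler0n.
have h7 : KF * n.+1%:R * v <= KF * (t + D0 + 1) * v.
  by apply: ler_wpM2r; [lra|apply: ler_wpM2l].
rewrite /a; lra.
Qed.

End Proper.
End FillingExponents.

(** * Geodesics that the support does not cross *)

Section NotFilling.
Variable R : realType.
Variables (G : set 'M[R]_3) (r : R).
Hypothesis fG : fuchsian_surface_group G.
Hypothesis r1 : 1 / 2 <= r < 1.
Hypothesis cob : forall z, disk z -> exists2 g, G g & n2 (act g z) <= r.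
Variable eta : {measure set (R * R) -> \bar R}.
Hypothesis ceta : is_current G eta.
Implicit Types (g h k b : 'M[R]_3) (p q x y z u o : pt R) (w : R * R) (s t a c l e : R).

Local Notation hE := (hh eta).
Local Notation dE := (dd eta).
Local Notation C := (cst r eta).

Lemma near_angle w e : 0 < e -> exists2 d : R, 0 < d & forall w', `|w'.1 - w.1| < d ->
  `|w'.2 - w.2| < d -> n2 (psub (bpt w'.1) (bpt w.1)) < e /\ n2 (psub (bpt w'.2) (bpt w.2)) < e.
Proof.
move=> e0.
have one a : exists2 d : R, 0 < d & forall b : R, `|b - a| < d -> n2 (psub (bpt b) (bpt a)) < e.
  have c : n2 (psub (bpt b) (bpt a)) @[b --> a] --> (cos a - cos a) ^+ 2 + (sin a - sin a) ^+ 2.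
    by apply: sq2_cvg; apply: cvgB; try exact: cvg_cst; [exact: continuous_cos|exact: continuous_sin].
  have : \forall b \near a, n2 (psub (bpt b) (bpt a)) < e.
    by move/cvgr_lt: c; apply; rewrite !subrr expr0n addr0.
  move=> /nbhs_ballP[d /= d0 H]; exists d => // b ba; apply: H.
  by rewrite /ball /= distrC.
have [d1 d10 H1] := one w.1; have [d2 d20 H2] := one w.2.
exists (Num.min d1 d2); first by rewrite lt_min d10 d20.
by move=> w'; rewrite !lt_min => /andP[a1 _] /andP[_ a2]; split; [exact: H1|exact: H2].
Qed.

Lemma ratr_dense a e : 0 < e -> exists q : rat, `|ratr q - a| < e.
Proof.
move=> e0; have ae : a < a + e by lra.
have [q] := rat_in_itvoo ae; rewrite in_itv /= => /andP[h1 h2].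
by exists q; rewrite ger0_norm; lra.
Qed.

(** A geodesic off the support lies in a rational box of measure zero, and there are countably many
    boxes. Only a null superset of the complement is produced, so its measurability is not at
    stake. *)
Lemma supp_full : exists B : set (R * R), [/\ measurable B, eta B = 0%E &
  forall w, Geo w -> ~ supp eta w -> B w].
Proof.
pose box (i : rat * rat * rat) : set (R * R) := [set w | Geo w /\
  (`|w.1 - ratr i.1.1| < ratr i.2 /\ `|w.2 - ratr i.1.2| < ratr i.2)].
have mbox i : measurable (box i).
  have mab (c : R) (f : R * R -> R) : measurable_fun setT f -> measurable [set w | `|f w - c| < ratr i.2].
    move=> mf; apply: mset_lt => //; apply: measurableT_comp; first exact: normr_measurable.
    by apply: measurable_funB.
  apply: measurableI; first exact: measurable_Geo.
  by apply: measurableI; apply: mab.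
pose B' i := if `[< eta (box i) = 0%E >] then box i else set0.
have mB' i : measurable (B' i) by rewrite /B'; case: asboolP.
have nB' i : eta (B' i) = 0%E by rewrite /B'; case: asboolP => // _; exact: measure0.
pose f (n : nat) := if choice.unpickle n is Some i then B' i else set0.
have mf n : measurable (f n) by rewrite /f; case: choice.unpickle.
exists (\bigcup_n f n); split; first exact: bigcup_measurable.
  apply/eqP; rewrite eq_le measure_ge0 andbT.
  apply: (le_trans (measure_sigma_subadditive _ mf _ _)) => //.
  - exact: bigcup_measurable.
  - by rewrite eseries0 // => n _ _; rewrite /f; case: choice.unpickle => [i|]; rewrite ?nB' ?measure0.
move=> w gw ns.
have [e e0 he] : exists2 e, 0 < e & eta [set w' | Geo w' /\ near_geo w w' e] = 0%E.
  apply: contrapT => H; apply: ns; split=> // e e0.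
  by rewrite lt0e measure_ge0 andbT; apply/eqP => h; apply: H; exists e.
have [d d0 Hd] := near_angle w e0.
have d4 : 0 < d / 4 by rewrite divr_gt0.
have [q1 hq1] := ratr_dense w.1 d4; have [q2 hq2] := ratr_dense w.2 d4.
have d20 : 0 < d / 8 by rewrite divr_gt0.
(* A radius above d / 4 makes the box contain w; one below d / 2 keeps the box within d of w. *)
have [q3 hq3] := ratr_dense (3 * d / 8) d20.
have /andP[q3l q3u] : d / 4 < ratr q3 < d / 2.
  by move: hq3; rewrite ltr_norml => /andP[? ?]; apply/andP; split; lra.
have bw : box (q1, q2, q3) w.
  split=> //=; split; rewrite distrC; [move: hq1|move: hq2]; lra.
have bn : eta (box (q1, q2, q3)) = 0%E.
  apply/eqP; rewrite eq_le measure_ge0 andbT -he le_measure ?inE //.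
    exact: measurable_near_geo.
  move=> w' [gw' /= [a1 a2]]; split=> //; left; apply: Hd.
    have := ler_distD (ratr q1) w'.1 w.1; lra.
  have := ler_distD (ratr q2) w'.2 w.2; lra.
move: (q1, q2, q3) bw bn => i bw bn; exists (choice.pickle i); first exact: I.
by rewrite /f choice.pickleK /B'; case: asboolP.
Qed.

(** A geodesic cutting the segment is transverse to w, hence off the support. *)
Lemma uncrossed w x y : Geo w -> (forall w', supp eta w' -> ~ transverse w w') ->
  disk x -> disk y -> eside x w = 0 -> eside y w = 0 -> dE x y = 0.
Proof.
move=> gw nt dx dy xw yw; have [B [mB B0 HB]] := supp_full.
rewrite /dd (_ : eta (dset x y) = 0%E) //.
apply/eqP; rewrite eq_le measure_ge0 andbT -B0 le_measure ?inE //; first exact: measurable_dset.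
move=> w' [gw' [xy n0]]; apply: HB => // sw; apply: (nt _ sw); split.
  by move=> e; rewrite -e in n0; exact: n0.
have [t t01 e] := cross_lerp xy n0; exists (lerp x y t).
have dl := disk_lerp t01 dx dy.
split; [apply/(onGeoP _ gw)|apply/(onGeoP _ gw')]; split=> //.
by rewrite eside_lerp xw yw !mulr0 addr0.
Qed.

(** Points of w are at distance 0 from each other; rounding two of them to orbit points costs C
    each. The quotient of the rounding elements is large when one point is near an end of w. *)
Lemma infinitely_many w : Geo w -> (forall w', supp eta w' -> ~ transverse w w') ->
  forall c0 : R, exists g, [/\ G g, c0 <= cx g & dE org (act g org) <= 2 * C].
Proof.
move=> gw nt c0; have do0 := @disk_org R; have [r12 rlt1] := andP r1.
pose p := bpt w.1; pose q := bpt w.2.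
have p1 : n2 p = 1 := n2_bpt _. have q1 : n2 q = 1 := n2_bpt _.
have pq : p <> q := bpt_neq gw.
have on tau : 0 < tau -> disk (axpt p q tau) /\ eside (axpt p q tau) w = 0.
  move=> t0; split; first exact: disk_axpt.
  by rewrite /axpt eside_lerp !(eside_end w).1 !(eside_end w).2 !mulr0 addr0.
have [d0 e0] := on 1 ltr01.
have [g0 Gg0 g0x] := cob d0; have sg0 := G_SO fG Gg0.
(* [Q] dominates c0 and [cx g0]: once [cx g1] is at least 4 Q^2, submultiplicativity makes the
   quotient at least 2 Q. *)
pose Q := 1 + `|c0| + cx g0.
have c0g := cx_ge1 sg0.
have Q1 : 1 <= Q by rewrite /Q; have := normr_ge0 c0; lra.
have Q0 : 0 < Q ^+ 4 by rewrite exprn_gt0 //; lra.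
have N4 : n2 (psub q p) <= 4.
  have [b1 _] := bil_bounds (n2_bpt_le w.2) (n2_bpt_le w.1).
  by have := n2_psub q p; rewrite !bilxx p1 q1 subrr !subr0 => ->; rewrite /p /q; lra.
(* A point of the geodesic so close to its endpoint that every group element
   bringing it back to the fundamental ball is large. *)
pose A := (1 - r) / (64 * (4 * Q ^+ 2) ^+ 2).
have A0 : 0 < A by rewrite divr_gt0 ?subr_gt0 // mulr_gt0 // exprn_gt0 // mulr_gt0 // exprn_gt0 //; lra.
have A1 : A < 1.
  rewrite ltr_pdivrMr; last by rewrite mulr_gt0 // exprn_gt0 // mulr_gt0 // exprn_gt0 //; lra.
  have : 1 <= (4 * Q ^+ 2) ^+ 2 by have : 1 <= 4 * Q ^+ 2; [nra|move=> ?; nra].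
  lra.
pose tau := A^-1.
have tau0 : 0 < tau by rewrite invr_gt0.
have [d1 e1] := on tau tau0.
have [g1 Gg1 g1x] := cob d1; have sg1 := G_SO fG Gg1.
have nx : 1 - n2 (axpt p q tau) <= 4 * A.
  rewrite /axpt n2_lerp p1 q1.
  have -> : tau / (1 + tau) = 1 / (1 + A) by rewrite /tau; field; rewrite !gt_eqF //; lra.
  have i1 : 1 / (1 + A) <= 1 by rewrite ler_pdivrMr; lra.
  have i0 : 0 < 1 / (1 + A) by rewrite divr_gt0; lra.
  have i2 : 1 - 1 / (1 + A) <= A.
    have -> : 1 - 1 / (1 + A) = A / (1 + A) by field; rewrite gt_eqF //; lra.
    by rewrite ler_pdivrMr; nra.
  set v := 1 / (1 + A) in i1 i0 i2 *.
  have : v * (1 - v) <= A by nra.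
  have := n2_ge0 (psub q p); set N := n2 _ in N4 * => N0 vA.
  have : v * (1 - v) * N <= A * 4 by apply: ler_pM => //; nra.
  by lra.
have big : 4 * Q ^+ 2 <= cx g1.
  rewrite leNgt; apply/negP => small.
  have := n2_bound sg1 (disk_le1 d1) g1x (ltW rlt1).
  have c1p := cx_gt0 sg1.
  have : cx g1 ^+ 2 <= (4 * Q ^+ 2) ^+ 2 by rewrite ler_pXn2r ?nnegrE ?ltW // mulr_gt0 // exprn_gt0 //; lra.
  have X0 : 0 < (4 * Q ^+ 2) ^+ 2 by rewrite exprn_gt0 // mulr_gt0 // exprn_gt0 //; lra.
  have AE : A * (64 * (4 * Q ^+ 2) ^+ 2) = 1 - r.
    by rewrite mulfVK // gt_eqF // mulr_gt0.
  move=> h1 h2.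
  have h3 : 4 * cx g1 ^+ 2 * (1 - n2 (axpt p q tau)) <= 4 * (4 * Q ^+ 2) ^+ 2 * (4 * A).
    apply: ler_pM => //; [by rewrite mulr_ge0 // sqr_ge0|by rewrite subr_ge0 disk_le1|by rewrite ler_pM2l].
  have : 4 * (4 * Q ^+ 2) ^+ 2 * (4 * A) = A * (64 * (4 * Q ^+ 2) ^+ 2) / 4 by field.
  by rewrite AE; lra.
have Gg : G (g0 *m invmx g1) by apply: G_M => //; exact: G_V.
exists (g0 *m invmx g1); split=> //.
  have sgk := G_SO fG Gg.
  have sub : cx g1 <= 2 * cx g0 * cx (g0 *m invmx g1).
    have e : invmx g1 = invmx g0 *m (g0 *m invmx g1).
      by rewrite mulmxA mulVmx ?mul1mx // (SO21_unit sg0).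
    by have := cx_submul (SO21_V sg0) sgk; rewrite -e !cxV.
  have kp := cx_gt0 sgk.
  have gQ : cx g0 <= Q by rewrite /Q; have := normr_ge0 c0; lra.
  have cQ : c0 <= Q by rewrite /Q; have := ler_norm c0; lra.
  have : 2 * cx g0 * cx (g0 *m invmx g1) <= 2 * Q * cx (g0 *m invmx g1).
    by rewrite ler_pM2r // ler_pM2l.
  nra.
have GV0 := G_V fG Gg0; have GV1 := G_V fG Gg1.
have do1 := G_disk fG GV0 do0; have do2 := G_disk fG GV1 do0.
rewrite (dd_orbit fG ceta Gg0 Gg1).
have := net_org fG r1 ceta Gg0 d0 g0x; have := net_org fG r1 ceta Gg1 d1 g1x.
have := uncrossed gw nt d0 d1 e0 e1.
have := dd_tri ceta do1 d0 do2; have := dd_tri ceta d0 d1 do2.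
rewrite (dd_sym eta (axpt p q tau)); lra.
Qed.

End NotFilling.

(** * Equality of the exponents and the finiteness criterion *)

Section Equality.
Variable R : realType.
Variables (G : set 'M[R]_3) (r : R).
Hypothesis fG : fuchsian_surface_group G.
Hypothesis r1 : 1 / 2 <= r < 1.
Hypothesis cob : forall z, disk z -> exists2 g, G g & n2 (act g z) <= r.
Variable eta : {measure set (R * R) -> \bar R}.
Hypothesis ceta : is_current G eta.
Implicit Types (g h k b : 'M[R]_3) (p q x y z u o : pt R) (w : R * R) (s t a c l e : R).

Local Notation hE := (hh eta).
Local Notation dE := (dd eta).
Local Notation C := (cst r eta).

Lemma finite_bound (T : eqType) (s : seq T) (P : T -> R -> Prop) :
  (forall i a c, P i a -> a <= c -> P i c) -> (forall i, i \in s -> exists B, P i B) ->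
  exists B, forall i, i \in s -> P i B.
Proof.
move=> mono; elim: s => [|i s IH] H; first by exists 0.
have [B HB] := IH (fun j js => H j (@mem_behead _ (i :: s) j js)).
have [B' HB'] := H i (mem_head _ _).
exists (Num.max B B') => j; rewrite inE => /orP[/eqP ->|js].
  by apply: mono HB' _; rewrite le_max lexx orbT.
by apply: mono (HB _ js) _; rewrite le_max lexx.
Qed.

(** The normalised conjugator carries a point of a fixed segment into a fixed ball, so [cx_bound]
    applies. This takes the place of [fibre_bound] when the pseudo-metric is not proper. *)
Lemma fibre_finite (rho : R) k0 : rho < 1 -> G k0 -> k0 <> 1%:M -> exists B, forall k,
  conjclass G k0 k -> (exists p' q' l', hypdata k p' q' l' /\ n2 (lerp p' q' (1 / 2)) <= rho) ->
  cx k <= B.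
Proof.
move=> rho1 Gk0 k01; have [p [q [l h0]]] := hyperbolic fG r1 cob Gk0 k01.
have sk0 := G_SO fG Gk0; have [[p1 q1 pq l1] _] := h0.
set x0 := axpt p q 1; have d0 : disk x0 by exact: disk_axpt.
have dk0 := G_disk fG Gk0 d0.
pose a := Num.max (n2 x0) (n2 (act k0 x0)); have a1 : a < 1 by rewrite gt_max d0 dk0.
pose D := (1 - rho) * (1 - a) ^+ 2.
have D0 : 0 < D by rewrite mulr_gt0 ?subr_gt0 // exprn_gt0 // subr_gt0.
pose Q := 4 / D; have Q0 : 0 < Q by rewrite divr_gt0.
exists (4 * Q * cx k0 * Q) => k [b Gb kE] [p' [q' [l' [hk mk]]]].
have [b' [Gb' kE' [s s01 sE]]] := conj_normalize fG Gb Gk0 h0 (esym kE) hk.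
have sb := G_SO fG Gb'; have sV := SO21_V sb.
have za : n2 (lerp x0 (act k0 x0) s) <= a by apply: n2_lerp_le => //; rewrite le_max lexx ?orbT.
rewrite -sE in mk.
have := cx_bound sb za mk a1 rho1; rewrite -/D => h.
have c1 := cx_ge1 sb; have c0 := cx_gt0 sk0.
have cQ : cx b' <= Q by rewrite /Q ler_pdivlMr //; nra.
rewrite kE'; apply: le_trans (cx_submul (SO21_mul sb sk0) sV) _; rewrite cxV //.
have h1 := cx_submul sb sk0.
apply: (@le_trans _ _ (2 * (2 * cx b' * cx k0) * cx b')).
  by rewrite ler_pM2r ?cx_gt0 // ler_pM2l.
have h2 : cx b' * cx k0 <= Q * cx k0 by rewrite ler_pM2r.
have h3 : cx b' * cx k0 * cx b' <= Q * cx k0 * Q.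
  by apply: ler_pM => //; [rewrite mulr_ge0 // ltW // cx_gt0|exact: ltW (cx_gt0 sb)].
lra.
Qed.

(** For classes, [closing] makes the axes of arbitrarily large elements of bounded displacement meet
    a fixed ball. Were there finitely many classes, [fibre_finite] would bound the sizes. *)
Lemma not_filling_infty : ~ filling eta ->
  delta_metric G org eta = +oo%E /\ delta_geod G eta = +oo%E.
Proof.
move=> nf; have do0 := @disk_org R.
have [w gw nt] : exists2 w, Geo w & forall w', supp eta w' -> ~ transverse w w'.
  apply: contrapT => H; apply: nf => w gw; apply: contrapT => H'; apply: H.
  by exists w => // w' sw tw; apply: H'; exists w'.
have many := infinitely_many fG r1 cob ceta gw nt.
split.
  apply: (@crit_exp_infty _ _ (2 * C)) => t tC.
  rewrite (metric_set fG ceta _ do0); apply: ecard_infinite => /finite_seqP[s sE].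
  have [||B HB] := @finite_bound _ s (fun g B => cx g <= B).
  - by move=> g a c; exact: le_trans.
  - by move=> g _; exists (cx g).
  have [g [Gg cg dg]] := many (B + 1).
  have : g \in s by have : [set` s] g; [rewrite -sE; split=> //; exact: le_trans tC|].
  by move=> /HB; lra.
have [c0 [B0 [rho [B00 rho1 cls]]]] := closing fG r1 cob.
pose D0 := mb eta (1 - (B0 ^+ 2)^-1).
apply: (@crit_exp_infty _ _ (2 * C + D0)) => t tC.
apply: ecard_infinite => /finite_seqP[s sE].
have [||B HB] := @finite_bound _ s (fun cl B => forall k, G k -> k <> 1%:M -> conjclass G k = cl ->
  (exists p' q' l', hypdata k p' q' l' /\ n2 (lerp p' q' (1 / 2)) <= rho) -> cx k <= B).
- by move=> cl a c H ac k Gk k1 kc hk; apply: le_trans ac; exact: H.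
- move=> cl _; have [[k0 [Gk0 k01 k0c]]|none] := pselect (exists k0, [/\ G k0, k0 <> 1%:M & conjclass G k0 = cl]).
    have [B HB] := fibre_finite rho1 Gk0 k01; exists B => k Gk k1 kc hk; apply: HB => //.
    by rewrite k0c -kc; exact: (conjclass_self fG).
  by exists 0 => k Gk k1 kc _; case: none; exists k.
have [g [Gg cg dg]] := many (Num.max c0 (2 * B0 * B + 1)).
rewrite ge_max in cg; have /andP[cg0 cgB] := cg.
have [f [Gf cf kf hf]] := cls g Gg cg0.
have Gk : G (g *m f) by exact: G_M.
have [p [q [l hk]]] := hyperbolic fG r1 cob Gk kf.
have sg := G_SO fG Gg; have sf := G_SO fG Gf.
have dk : dE org (act (g *m f) org) <= t.
  rewrite (act_mul sg sf org_le1).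
  have dfo := G_disk fG Gf do0; have dgo := G_disk fG Gg do0.
  have := dd_tri ceta do0 dgo (G_disk fG Gg dfo); rewrite (dd_act fG ceta Gg do0 dfo).
  by have := dd_cx_le fG ceta Gf cf; rewrite -/D0; lra.
have cls_s : conjclass G (g *m f) \in s.
  have : [set` s] (conjclass G (g *m f)); last by [].
  rewrite -sE; exists (g *m f) => //; split=> //; split=> //.
  rewrite (interE fG ceta Gk hk) lee_fin; apply: le_trans dk.
  by apply: (inter_le_dd fG ceta Gk hk).
have ck : cx (g *m f) <= B.
  by apply: (HB _ cls_s) => //; exists p, q, l; split=> //; exact: hf hk.
have e : g = (g *m f) *m invmx f by rewrite mulmxK // (SO21_unit sf).
have := cx_submul (G_SO fG Gk) (SO21_V sf); rewrite -e cxV // => h.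
have c1 := cx_ge1 sf; have c2 := cx_ge1 (G_SO fG Gk).
have : 2 * cx (g *m f) * cx f <= 2 * B * B0 by apply: ler_pM => //; lra.
lra.
Qed.

Lemma delta_eq : delta_metric G org eta = delta_geod G eta /\
  (delta_metric G org eta \is a fin_num <-> filling eta).
Proof.
have [fl|nf] := pselect (filling eta); last first.
  by have [-> ->] := not_filling_infty nf; split=> //; split.
have pr := proper fG r1 cob ceta fl; split.
  apply/eqP; rewrite eq_le (delta_metric_le_geod fG r1 cob ceta pr).
  exact: (delta_geod_le_metric fG r1 cob ceta).
split=> // _; have [v v0 h] := delta_metric_fin fG r1 cob ceta pr.
rewrite ge0_fin_numE; last exact: (delta_metric_ge0 fG ceta (@disk_org R)).
by apply: le_lt_trans h _; exact: ltry.
Qed.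

End Equality.

(** * Continuous cut-off functions on the space of geodesics *)

Section TestFunctions.
Variable R : realType.
Implicit Types (g h k : 'M[R]_3) (p q x y z u o : pt R) (w : R * R) (s t a b c l e : R).

(** Truncation to the interval from 0 to 1, by absolute values so that continuity is immediate. *)
Definition clamp (t : R) : R := (1 + `|t| - `|t - 1|) / 2.

Lemma clamp_ge0 t : 0 <= clamp t.
Proof.
rewrite /clamp; have := ler_norm (t - 1); have := ler_normB t 1; rewrite normr1; have := ler_normB t 1.
by have := ler_distD 0 t 1; rewrite subr0 sub0r normrN normr1; lra.
Qed.

Lemma clamp_le1 t : clamp t <= 1.
Proof.
rewrite /clamp; have : `|t| <= `|t - 1| + 1.
  by have := ler_normD (t - 1) 1; rewrite subrK normr1.
lra.
Qed.

Lemma clamp1 t : 1 <= t -> clamp t = 1.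
Proof. by move=> t1; rewrite /clamp !ger0_norm; lra. Qed.

Lemma clamp0 t : t <= 0 -> clamp t = 0.
Proof. by move=> t1; rewrite /clamp !ler0_norm; lra. Qed.

(** A side function changes sign when an angle turns by 2 pi; the product of two does not, so it is
    a function of the geodesic. *)
Definition cutfun (al be : R) x y (a b : R) : R :=
  clamp (al - be * (eside x (a, b) * eside y (a, b))).

Lemma eside_continuous x : continuous (eside x : R * R -> R).
Proof.
move=> w; rewrite /eside.
have c1 : (v.2 - v.1) / 2 @[v --> w] --> (w.2 - w.1) / 2.
  by apply: cvgM; [apply: cvgB; [exact: cvg_snd|exact: cvg_fst]|exact: cvg_cst].
have c2 : (v.1 + v.2) / 2 @[v --> w] --> (w.1 + w.2) / 2.
  by apply: cvgM; [apply: cvgD; [exact: cvg_fst|exact: cvg_snd]|exact: cvg_cst].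
apply: cvgB; first apply: cvgB.
- by apply: cvg_comp c1 _; exact: continuous_cos.
- by apply: cvgM; [exact: cvg_cst|apply: cvg_comp c2 _; exact: continuous_cos].
- by apply: cvgM; [exact: cvg_cst|apply: cvg_comp c2 _; exact: continuous_sin].
Qed.

Lemma eside_sym x a b : eside x (a, b) = eside x (b, a).
Proof.
rewrite /eside /= -(cosN ((b - a) / 2)) [in RHS](addrC b).
by have -> : - ((b - a) / 2) = (a - b) / 2 by field.
Qed.

Lemma eside_period x a b : eside x (a + 2 * pi, b) = - eside x (a, b).
Proof.
rewrite /eside /=.
have -> : (b - (a + 2 * pi)) / 2 = (b - a) / 2 - pi by field.
have -> : (a + 2 * pi + b) / 2 = (a + b) / 2 + pi by field.
have cB t : cos (t - pi) = - cos t by rewrite -[in RHS](subrK pi t) cosDpi opprK.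
by rewrite cB cosDpi sinDpi; ring.
Qed.

Lemma cutfun_test al be x y e : 0 < e ->
  (forall a b, n2 (psub (bpt a) (bpt b)) < e -> al <= be * (eside x (a, b) * eside y (a, b))) ->
  test_fun (cutfun al be x y).
Proof.
move=> e0 H; split.
- move=> w; rewrite /cutfun.
  rewrite (_ : (fun v : R * R => _) = fun v => clamp (al - be * (eside x v * eside y v))); last first.
    by apply/funext => v; rewrite -surjective_pairing.
  have c : (al - be * (eside x v * eside y v)) @[v --> w] --> al - be * (eside x w * eside y w).
    apply: cvgB; first exact: cvg_cst.
    by apply: cvgM; [exact: cvg_cst|apply: cvgM; exact: eside_continuous].
  rewrite /clamp; apply: cvgM; last exact: cvg_cst.
  apply: cvgB; first by apply: cvgD; [exact: cvg_cst|exact: cvg_norm].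
  by apply: cvg_norm; apply: cvgB => //; exact: cvg_cst.
- by move=> a b; rewrite /cutfun !(eside_sym _ a b).
- by move=> a b; rewrite /cutfun !eside_period mulrNN.
- by exists e => // a b h; rewrite /cutfun clamp0 // subr_le0; exact: H.
Qed.

Lemma measurable_cutfun al be x y : measurable_fun setT (fun w => cutfun al be x y w.1 w.2).
Proof.
rewrite /cutfun (_ : (fun w : R * R => _) = fun w => clamp (al - be * (eside x w * eside y w))); last first.
  by apply/funext => v; rewrite -surjective_pairing.
have m : measurable_fun setT (fun w => al - be * (eside x w * eside y w)).
  by apply: measurable_funB => //; apply: measurable_funM => //; apply: measurable_funM; exact: measurable_eside.
rewrite /clamp; apply: measurable_funM => //; apply: measurable_funB.
  apply: measurable_funD => //; apply: measurableT_comp => //; exact: normr_measurable.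
by apply: measurableT_comp; [exact: normr_measurable|apply: measurable_funB].
Qed.

Section Integrals.
Variable nu : {measure set (R * R) -> \bar R}.

Lemma pair_int_ge al be x y A : measurable A -> A `<=` @Geo R ->
  (forall w, A w -> be * (eside x w * eside y w) <= al - 1) ->
  (nu A <= pair_int nu (cutfun al be x y))%E.
Proof.
move=> mA AG H; rewrite -{1}(setIidl AG) -integral_indic //; last exact: measurable_Geo.
apply: ge0_le_integral => //; first exact: measurable_Geo.
- by apply/measurable_EFinP; apply: measurable_funTS; exact: measurable_indic.
- by apply/measurable_EFinP; apply: measurable_funTS; exact: measurable_cutfun.
move=> w _; rewrite lee_fin indicE; case: (boolP (w \in A)) => [|_]; last exact: clamp_ge0.
rewrite inE => /H h; rewrite /cutfun -surjective_pairing clamp1 //; lra.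
Qed.

Lemma pair_int_le al be x y A : measurable A -> A `<=` @Geo R ->
  (forall w, Geo w -> ~ A w -> al <= be * (eside x w * eside y w)) ->
  (pair_int nu (cutfun al be x y) <= nu A)%E.
Proof.
move=> mA AG H; rewrite -{1}(setIidl AG) -integral_indic //; last exact: measurable_Geo.
apply: ge0_le_integral => //; first exact: measurable_Geo.
- by move=> w _; rewrite lee_fin; exact: clamp_ge0.
- by apply/measurable_EFinP; apply: measurable_funTS; exact: measurable_cutfun.
- by apply/measurable_EFinP; apply: measurable_funTS; exact: measurable_indic.
move=> w gw; rewrite lee_fin indicE; case: (boolP (w \in A)) => [_|]; first exact: clamp_le1.
by rewrite notin_setE => /(H _ gw) h; rewrite /cutfun -surjective_pairing clamp0 // subr_le0.
Qed.

End Integrals.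

(** A short chord is close to the circle, so two points of a smaller disk lie well inside on the
    same side of it. *)
Lemma diag_bound x y c : 0 < c -> n2 x <= 1 - c -> n2 y <= 1 - c -> forall a b,
  n2 (psub (bpt a) (bpt b)) < 2 * c -> c ^+ 2 / 16 <= eside x (a, b) * eside y (a, b).
Proof.
move=> c0 xc yc a b; rewrite chord_cos; set C := eside org (a, b) => hC.
have C2 : 1 - c / 2 < C ^+ 2 by lra.
pose al := cos ((a + b) / 2); pose be := sin ((a + b) / 2).
have C1 : C ^+ 2 <= 1.
  by rewrite /C /eside /= !mul0r !subr0; have := cos2Dsin2 ((b - a) / 2); have := sqr_ge0 (sin ((b - a) / 2)); lra.
have eE u : eside u (a, b) = C - (u.1 * al + u.2 * be).
  by rewrite /C /eside /= /al /be; ring.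
have dot u : n2 u <= 1 - c -> (u.1 * al + u.2 * be) ^+ 2 <= 1 - c.
  move=> uc; apply: le_trans (cauchy2 _ _ _ _) _.
  by rewrite /al /be cos2Dsin2 mulr1.
rewrite !eE; have := dot _ xc; have := dot _ yc.
set X := _ + x.2 * be; set Y := _ + y.2 * be => Y2 X2.
have key (D Z : R) : 0 <= D -> D ^+ 2 = C ^+ 2 -> Z ^+ 2 <= 1 - c -> c / 4 <= D - Z.
  move=> D0 DC Z2; have D1 : D <= 1 by nra.
  have Z1 : Z <= 1 by nra.
  rewrite leNgt; apply/negP => h.
  have [DZ|DZ] := leP 0 (D + Z); last by nra.
  have : (D - Z) * (D + Z) <= c / 4 * 2 by nra.
  have : (D - Z) * (D + Z) = D ^+ 2 - Z ^+ 2 by ring.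
  lra.
have fin (A B : R) : c / 4 <= A -> c / 4 <= B -> c ^+ 2 / 16 <= A * B.
  move=> h1 h2; have c4 : 0 <= c / 4 by lra.
  have := ler_pM c4 c4 h1 h2; have -> : c / 4 * (c / 4) = c ^+ 2 / 16 by field.
  by [].
have [Cp|Cm] := leP 0 C; first by apply: fin; apply: key.
have -> : (C - X) * (C - Y) = (- C - - X) * (- C - - Y) by ring.
by apply: fin; apply: key; rewrite ?sqrrN //; lra.
Qed.

End TestFunctions.

(** * Comparison of two nearby currents *)

Section Continuity.
Variable R : realType.
Variables (G : set 'M[R]_3) (r : R).
Hypothesis fG : fuchsian_surface_group G.
Hypothesis r1 : 1 / 2 <= r < 1.
Hypothesis cob : forall z, disk z -> exists2 g, G g & n2 (act g z) <= r.
Implicit Types (g h k : 'M[R]_3) (p q x y z u o : pt R) (w : R * R) (s t a b c l e : R)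
  (nu eta : {measure set (R * R) -> \bar R}).

(* The translate by [g] of the geodesics meeting the fundamental ball. *)
Definition tset g : set (R * R) := [set w | Geo w /\ eside (act g org) w ^+ 2 <=
  r * (vc (invmx g) (bpt w.1) * vc (invmx g) (bpt w.2) * vc (invmx g) (act g org) ^+ 2)].

Lemma measurable_tset g : measurable (tset g).
Proof.
have mc : measurable_fun setT (cos : R -> R) by exact: continuous_measurable_fun (@continuous_cos R).
have ms : measurable_fun setT (sin : R -> R) by exact: continuous_measurable_fun (@continuous_sin R).
have mv (f : R * R -> R) : measurable_fun setT f -> measurable_fun setT (fun w => vc (invmx g) (bpt (f w))).
  move=> mf; rewrite /vc /bpt /=; apply: measurable_funD => //; apply: measurable_funD;
  by apply: measurable_funM => //; exact: (measurableT_comp _ mf).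
apply: measurableI; first exact: measurable_Geo.
apply: mset_le; first by apply: measurable_funX; exact: measurable_eside.
apply: measurable_funM => //; apply: measurable_funM => //.
by apply: measurable_funM; apply: mv.
Qed.

Lemma tset_measure g nu : is_current G nu -> G g -> nu (tset g) = nu (bset r).
Proof.
move=> cnu Gg; have sg := G_SO fG Gg; have GV := G_V fG Gg; have sV := SO21_V sg.
have [_ _ inv] := cnu; have <- := inv _ _ GV (measurable_bset r) (fun w hw => hw.1).
have x1 : n2 (act g org) <= 1 := n2_act_le1 sg org_le1.
have P0 w : 0 < vc (invmx g) (bpt w.1) * vc (invmx g) (bpt w.2) * vc (invmx g) (act g org) ^+ 2.
  by rewrite !mulr_gt0 ?exprn_gt0 // vc_gt0 // n2_bpt_le.
have sq w w' : Geo w -> gact (invmx g) w w' -> eside (act g org) w ^+ 2 =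
  eside org w' ^+ 2 * (vc (invmx g) (bpt w.1) * vc (invmx g) (bpt w.2) * vc (invmx g) (act g org) ^+ 2).
  by move=> gw ww'; rewrite (gact_eside_sqr sV gw ww' x1) actK // org_le1.
congr (nu _); apply/seteqP; split=> w.
  move=> [gw h]; split=> //; have [w' ww'] := gact_ex sV gw; exists w' => //.
  by split; [exact: ww'.1|move: h; rewrite (sq _ _ gw ww') ler_pM2r].
by move=> [gw [w' [gw' h] ww']]; split=> //; rewrite (sq _ _ gw ww') ler_pM2r.
Qed.

(** Width of the transition zone: the first bound makes [cutphi g] vanish on short chords, the
    second confines it to geodesics cutting the segment or meeting the balls [bset r] and [tset g]
    at its ends. *)
Definition cuteps g : R := Num.min ((1 - n2 (act g org)) ^+ 2 / 16) (r / (2 * cx g ^+ 2)).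
Definition cutphi g := cutfun 1 (cuteps g)^-1 org (act g org).

Lemma cuteps_gt0 g : SO21p g -> 0 < cuteps g.
Proof.
move=> sg; have d := disk_act sg (@disk_org R); have c0 := cx_gt0 sg; have [r12 _] := andP r1.
rewrite lt_min !divr_gt0 ?mulr_gt0 ?exprn_gt0 ?subr_gt0 //; lra.
Qed.

Lemma cutphi_test g : SO21p g -> test_fun (cutphi g).
Proof.
move=> sg; have e0 := cuteps_gt0 sg; have d := disk_act sg (@disk_org R).
have c0 : 0 < 1 - n2 (act g org) by rewrite subr_gt0.
apply: (@cutfun_test _ _ _ _ _ (2 * (1 - n2 (act g org)))); first by rewrite mulr_gt0.
move=> a b h; rewrite mulrC ler_pdivlMr // mul1r.
apply: (@le_trans _ _ ((1 - n2 (act g org)) ^+ 2 / 16)); first by rewrite ge_min lexx.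
apply: diag_bound h => //; first by rewrite n2_org subKr n2_ge0.
by rewrite subKr.
Qed.

Lemma cutphi_bounds g nu : is_current G nu -> G g ->
  ((dd nu org (act g org))%:E <= pair_int nu (cutphi g))%E /\
  (pair_int nu (cutphi g) <= (dd nu org (act g org) + 2 * mb nu r)%:E)%E.
Proof.
move=> cnu Gg; have sg := G_SO fG Gg; have e0 := cuteps_gt0 sg; have do0 := @disk_org R.
have dg := G_disk fG Gg do0; have [r12 rlt1] := andP r1; have sV := SO21_V sg.
have c0 := cx_gt0 sg.
split.
  rewrite /dd fineK; last exact: (dset_fin cnu).
  apply: pair_int_ge; [exact: measurable_dset|by move=> w []|].
  by move=> w [_ [h _]]; rewrite subrr pmulr_rle0 // invr_gt0.
have fb : nu (bset r) \is a fin_num by rewrite (sub_bset_fin cnu (a := r)) //; exact: measurable_bset.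
have m1 := @measurable_dset R org (act g org); have m2 := @measurable_bset R r; have m3 := measurable_tset g.
apply: (@le_trans _ _ (nu (dset org (act g org) `|` bset r `|` tset g))).
  apply: pair_int_le; first by apply: measurableU => //; apply: measurableU.
    by move=> w [[[]|[]]|[]].
  move=> w gw nU; rewrite mulrC ler_pdivlMr // mul1r.
  set A := eside org w; set B := eside (act g org) w.
  have Ar : r < A ^+ 2 by rewrite ltNge; apply/negP => h; apply: nU; left; right.
  have AB : 0 < A * B.
    rewrite ltNge; apply/negP => h; apply: nU; left; left; split=> //; split=> // -[A0 _].
    by move: Ar; rewrite /A A0 expr0n /=; lra.
  (* The factor comes from [vc_geV] at both endpoints of w and from [vcVK] at the centre. *)
  have Br : r <= B ^+ 2 * (4 * cx g ^+ 4).
    have : r * (vc (invmx g) (bpt w.1) * vc (invmx g) (bpt w.2) * vc (invmx g) (act g org) ^+ 2) < B ^+ 2.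
      by rewrite ltNge; apply/negP => h; apply: nU; right.
    have := vc_geV sV (n2_bpt_le w.1); have := vc_geV sV (n2_bpt_le w.2); rewrite !cxV //.
    have := vcVK sg org_le1; rewrite vc_org.
    set V1 := vc _ (bpt w.1); set V2 := vc _ (bpt w.2); set V3 := vc _ (act g org).
    set c := cx g in c0 * => h3 h2 h1 hB.
    have hP : 1 <= V1 * V2 * V3 ^+ 2 * (4 * c ^+ 4).
      have -> : V1 * V2 * V3 ^+ 2 * (4 * c ^+ 4) = (2 * c * V1) * (2 * c * V2) * (V3 * c) ^+ 2 by ring.
      by rewrite h3 expr1n mulr1; apply: le_trans (ler_pM ler01 ler01 h1 h2); rewrite mulr1.
    have c4 : 0 < 4 * c ^+ 4 by rewrite mulr_gt0 // exprn_gt0.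
    have h4 : r * (V1 * V2 * V3 ^+ 2) * (4 * c ^+ 4) <= B ^+ 2 * (4 * c ^+ 4).
      by rewrite ler_pM2r // ltW.
    apply: le_trans h4; rewrite -mulrA ler_peMr //; lra.
  apply: (@le_trans _ _ (r / (2 * cx g ^+ 2))); first by rewrite ge_min lexx orbT.
  have c2 : 0 < 2 * cx g ^+ 2 by rewrite mulr_gt0 // exprn_gt0.
  rewrite ler_pdivrMr // -(@ler_pXn2r _ 2) ?nnegrE //; [|lra|by rewrite mulr_ge0 // ltW].
  have -> : (A * B * (2 * cx g ^+ 2)) ^+ 2 = A ^+ 2 * (B ^+ 2 * (4 * cx g ^+ 4)) by ring.
  rewrite expr2; apply: ler_pM => //; [lra|lra|exact: ltW].
have q1 := measureU2 nu m1 m2; have q2 := measureU2 nu (measurableU _ _ m1 m2) m3.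
have q3 : (nu (dset org (act g org) `|` bset r `|` tset g) <=
    nu (dset org (act g org)) + nu (bset r) + nu (tset g))%E.
  by apply: (le_trans q2); exact: leeD q1 (lexx _).
apply: (le_trans q3); rewrite (tset_measure cnu Gg).
have -> : nu (dset org (act g org)) = (dd nu org (act g org))%:E by rewrite /dd fineK // (dset_fin cnu).
have -> : nu (bset r) = (mb nu r)%:E by rewrite /mb fineK.
by rewrite -!EFinD lee_fin; lra.
Qed.

Local Notation r' := ((1 + r) / 2).
Local Notation r'' := ((1 + r') / 2).
(** Equal to 1 on [bset r'] and 0 off [bset r'']: it bounds the rounding constant of a nearby
    current by a mass of eta. *)
Definition cutchi := cutfun (1 + r' / (r'' - r')) (r'' - r')^-1 (@org R) org.

Lemma radii_lt : r' < r'' /\ r'' < 1.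
Proof. by have [? ?] := andP r1; split; lra. Qed.

Lemma cutchi_test : test_fun cutchi.
Proof.
have [h1 h2] := radii_lt; have d0 : 0 < r'' - r' by lra.
apply: (@cutfun_test _ _ _ _ _ (4 * (1 - r''))); first by rewrite mulr_gt0 // subr_gt0.
move=> a b; rewrite chord_cos -expr2 => h.
rewrite [X in _ <= X]mulrC ler_pdivlMr // mulrDl mul1r mulfVK ?gt_eqF //; lra.
Qed.

Lemma cutchi_bounds nu : is_current G nu ->
  ((mb nu r')%:E <= pair_int nu cutchi)%E /\ (pair_int nu cutchi <= (mb nu r'')%:E)%E.
Proof.
move=> cnu; have [h1 h2] := radii_lt; have d0 : 0 < r'' - r' by lra.
have fb a : a < 1 -> nu (bset a) \is a fin_num.
  by move=> a1; rewrite (sub_bset_fin cnu (a := a)) //; exact: measurable_bset.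
split; rewrite /mb fineK; try (by apply: fb; lra).
  apply: pair_int_ge; [exact: measurable_bset|by move=> w []|].
  move=> w [_ h]; rewrite addrAC subrr add0r mulrC ler_pM2r ?invr_gt0 //.
apply: pair_int_le; [exact: measurable_bset|by move=> w []|].
move=> w gw nb; rewrite [X in _ <= X]mulrC ler_pdivlMr // mulrDl mul1r mulfVK ?gt_eqF // -expr2.
have : r'' < eside org w ^+ 2 by rewrite ltNge; apply/negP => h; apply: nb.
lra.
Qed.

Lemma close_fine (X Y : \bar R) (c d c' d' : R) : (c%:E <= X)%E -> (X <= d%:E)%E ->
  (c'%:E <= Y)%E -> (Y <= d'%:E)%E -> (`|X - Y| < 1%:E)%E -> c <= d' + 1 /\ c' <= d + 1.
Proof.
case: X => [X|//|//]; case: Y => [Y|//|//]; rewrite !lee_fin => h1 h2 h3 h4.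
by rewrite -EFinB abse_EFin lte_fin ltr_norml => /andP[h5 h6]; split; lra.
Qed.

Section TwoCurrents.
Variables eta eta' : {measure set (R * R) -> \bar R}.
Hypothesis ceta : is_current G eta.
Hypothesis ceta' : is_current G eta'.
Variables (A : seq 'M[R]_3) (L : R).
Hypothesis L0 : 0 < L.
Local Notation C1 := (mb eta r'' + 1).
Hypothesis AP : forall g, G g -> dd eta org (act g org) <= L + 2 * C1 + 3 * C1 -> g \in A.
Hypothesis closeA : forall g, g \in A -> G g ->
  (`|pair_int eta' (cutphi g) - pair_int eta (cutphi g)| < 1%:E)%E.
Hypothesis closeC : (`|pair_int eta' cutchi - pair_int eta cutchi| < 1%:E)%E.

Lemma cst_le : cst r eta <= C1 /\ cst r eta' <= C1.
Proof.
have [h1 h2] := radii_lt.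
have [a1 a2] := cutchi_bounds ceta; have [b1 b2] := cutchi_bounds ceta'.
split; last by have [] := close_fine b1 b2 a1 a2 closeC.
by have := mb_le ceta (ltW h1) h2; rewrite /cst; lra.
Qed.

Local Notation C4 := (8 * C1 + 1).

(** Rounded to orbit points, the segment becomes one of the finitely many steps of A. Rounding costs
    3 C1 and 2 C1, the test function 2 C1 + 1; [C4] covers the sum. *)
Lemma step_close x y : disk x -> disk y -> hh eta x y <= L + 2 * cst r eta ->
  hh eta' x y <= hh eta x y + C4 /\ hh eta x y <= hh eta' x y + C4.
Proof.
move=> dx dy hL; have [k1 k2] := cst_le.
have [g Gg gx] := cob dx; have [h Gh hy] := cob dy.
have Gk : G (g *m invmx h) by apply: G_M => //; exact: G_V.
have kA : g *m invmx h \in A.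
  apply: AP => //; apply: le_trans (step_dd fG r1 cob ceta Gg Gh dx dy gx hy hL) _; lra.
have [a1 a2] := cutphi_bounds ceta Gk; have [b1 b2] := cutphi_bounds ceta' Gk.
have [c1 c2] := close_fine b1 b2 a1 a2 (closeA kA Gk).
have mr nu : is_current G nu -> mb nu r <= cst r nu.
  by move=> cnu; apply: (mb_le cnu); [exact: ler' r1|exact: r'1 r1].
have m1 := mr _ ceta; have m2 := mr _ ceta'.
have both nu : is_current G nu ->
    dd nu org (act (g *m invmx h) org) <= hh nu x y + 3 * cst r nu /\
    hh nu x y <= dd nu org (act (g *m invmx h) org) + 2 * cst r nu.
  move=> cnu; split; first exact: (step_dd fG r1 cob cnu Gg Gh dx dy gx hy).
  have do0 := @disk_org R.
  have GVg := G_V fG Gg; have GVh := G_V fG Gh.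
  have d1 := G_disk fG GVg do0; have d2 := G_disk fG GVh do0.
  rewrite (dd_orbit fG cnu Gg Gh).
  have := net_org fG r1 cnu Gg dx gx; have := net_org fG r1 cnu Gh dy hy.
  have := hh_le_dd cnu dx dy; have := dd_tri cnu dx d1 dy; have := dd_tri cnu d1 d2 dy.
  rewrite (dd_sym nu x (act (invmx g) org)); lra.
have [e1 e2] := both _ ceta; have [e3 e4] := both _ ceta'.
split; lra.
Qed.

Lemma chain_close n x y : disk x -> disk y -> chain eta (L + 2 * cst r eta) n x y ->
  hh eta' x y <= hh eta x y + n.+1%:R * C4 /\ hh eta x y <= hh eta' x y + n.+1%:R * C4.
Proof.
move=> + dy; elim: n x => [|n IH] x dx; first by rewrite mul1r; exact: step_close.
move=> [s s01 [h1 ch]]; have dz := disk_lerp s01 dx dy.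
have [a1 a2] := step_close dx dz h1; have [b1 b2] := IH _ dz ch.
rewrite (hh_add ceta dx dy s01) (hh_add ceta' dx dy s01) -natr1 mulrDl mul1r; split; lra.
Qed.

(** At most h / L + 1 pieces, each with an error C4 independent of L: the relative error is C4 /
    L. *)
Lemma orbit_close g : G g -> let d := dd eta org (act g org) in let d' := dd eta' org (act g org) in
  d' <= (1 + C4 / L) * d + (C4 + C1) /\ (1 - C4 / L) * d <= d' + (C4 + C1).
Proof.
move=> Gg d d'; have do0 := @disk_org R; have dg := G_disk fG Gg do0.
have [k1 k2] := cst_le; have C10 : 0 <= mb eta r'' := mb_ge0 _ _.
set h := hh eta org (act g org); set h' := hh eta' org (act g org).
have h0 : 0 <= h := hh_ge0 _ _ _.
have hL0 : 0 <= h / L by rewrite divr_ge0 // ltW.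
have [t1 t2] := trunc_bound hL0; set n := Num.truncn _ in t1 t2.
have hn : h <= n.+1%:R * L by move: t1; rewrite mulr1 ler_pdivrMr.
have ch := breaking fG r1 cob ceta do0 dg (ltW L0) hn.
have [a1 a2] := chain_close do0 dg ch; rewrite -/h -/h' in a1 a2.
have C40 : 0 <= C4 by lra.
have nC : n.+1%:R * C4 <= (h / L + 1) * C4 by rewrite ler_wpM2r.
have e : (h / L + 1) * C4 = C4 / L * h + C4 by field; rewrite gt_eqF.
have hd := hh_le_dd ceta do0 dg; have hd' := hh_le_dd ceta' do0 dg.
have dh := dd_hh fG r1 cob ceta do0 dg; have dh' := dd_hh fG r1 cob ceta' do0 dg.
have K0 : 0 <= C4 / L by rewrite divr_ge0 // ltW.
have Kd : C4 / L * h <= C4 / L * d by rewrite ler_wpM2l.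
rewrite e in nC; set K := C4 / L in K0 Kd nC *; rewrite -/h -/d in hd dh; rewrite -/h' -/d' in hd' dh'.
split; lra.
Qed.

Lemma delta_close (K : R) : K = C4 / L -> K <= 1 / 2 -> forall y : R, 0 <= y ->
  ((delta_metric G org eta < y%:E)%E -> (delta_metric G org eta' <= ((1 - K)^-1 * y)%:E)%E) /\
  ((delta_metric G org eta' < y%:E)%E -> (delta_metric G org eta <= ((1 + K) * y)%:E)%E).
Proof.
move=> KE K2 y y0; have do0 := @disk_org R; have C10 : 0 <= mb eta r'' := mb_ge0 _ _.
have K0 : 0 <= K by rewrite KE divr_ge0 ?(ltW L0) //; lra.
have q0 : 0 < 1 - K by lra.
split.
  apply: (@crit_exp_compare _ _ _ 0 1 0 ((1 - K)^-1 * (C4 + C1))) => //;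
    try (by move=> t; exact: ecard_ge0); first by rewrite invr_gt0.
  move=> t v t0 v1; rewrite !(metric_set fG _ _ do0) // mul0r addr0 mul1r => /ecardP H; apply/ecardP => s us sA.
  apply: H => // g /sA [Gg h]; split=> //.
  have [_] := orbit_close Gg; rewrite -KE => h2.
  by rewrite -mulrDr mulrC ler_pdivlMr //; lra.
apply: (@crit_exp_compare _ _ _ 0 1 0 (C4 + C1)) => //;
  try (by move=> t; exact: ecard_ge0); first by lra.
move=> t v t0 v1; rewrite !(metric_set fG _ _ do0) // mul0r addr0 mul1r => /ecardP H; apply/ecardP => s us sA.
apply: H => // g /sA [Gg h]; split=> //.
have [h2 _] := orbit_close Gg; rewrite -KE in h2.
by apply: le_trans h2 _; rewrite lerD2r ler_wpM2l //; lra.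
Qed.

End TwoCurrents.

End Continuity.

Theorem mainTheorem9 (R : realType) (G : set 'M[R]_3) (o : pt R) :
  fuchsian_surface_group G -> disk o ->
  (forall eta : {measure set (R * R) -> \bar R}, is_current G eta ->
     delta_metric G o eta = delta_geod G eta /\
     (delta_metric G o eta \is a fin_num <-> filling eta)) /\
  (forall eta : {measure set (R * R) -> \bar R},
     is_current G eta -> filling eta ->
     forall eps : R, 0 < eps ->
       exists (k : nat) (fs : 'I_k -> R -> R -> R), exists2 dlt : R, 0 < dlt &
         (forall i, test_fun (fs i)) /\
         forall eta' : {measure set (R * R) -> \bar R},
           is_current G eta' -> filling eta' ->
           (forall i, (`| pair_int eta' (fs i) - pair_int eta (fs i) | < dlt%:E)%E) ->
           (`| delta_metric G o eta' - delta_metric G o eta | < eps%:E)%E).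
Proof.
move=> fG do0; have dorg := @disk_org R.
have [r r1 cob] : exists2 r : R, 1 / 2 <= r < 1 &
    forall z, disk z -> exists2 g, G g & n2 (act g z) <= r.
  have [_ [_ [r r1 H] _]] := fG; exists (Num.max r (1 / 2)).
    by rewrite le_max lexx orbT gt_max r1 /=; lra.
  by move=> z /H [g Gg gz]; exists g => //; rewrite le_max gz.
split=> [eta ceta|eta ceta feta eps eps0].
  by rewrite (delta_metric_base fG ceta do0 dorg); exact: (delta_eq fG r1 cob ceta).
have [_ fin] := delta_eq fG r1 cob ceta.
have [v vE] : exists v, delta_metric G org eta = v%:E.
  by exists (fine (delta_metric G org eta)); rewrite fineK //; apply/fin.
have v0 : 0 <= v by rewrite -lee_fin -vE; exact: (delta_metric_ge0 fG ceta dorg).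
pose C1 := mb eta ((1 + (1 + r) / 2) / 2) + 1; pose C4 := 8 * C1 + 1.
have C10 : 0 <= mb eta ((1 + (1 + r) / 2) / 2) := mb_ge0 _ _.
have C40 : 0 < C4 by rewrite /C4 /C1; lra.
(* Slopes 1 - K and 1 + K with K <= 1/2 change v by at most 2 K v, which is below eps. *)
pose K := Num.min (1 / 2) (eps / (4 * (v + 1))).
have D0 : 0 < 4 * (v + 1) by lra.
have K0 : 0 < K by rewrite lt_min; apply/andP; split; [lra|exact: divr_gt0].
have K2 : K <= 1 / 2 by rewrite ge_min lexx.
have Ke : K * (4 * (v + 1)) <= eps by rewrite -ler_pdivlMr // ge_min lexx orbT.
pose L := C4 / K; have L0 : 0 < L by rewrite divr_gt0.
have KE : K = C4 / L by rewrite /L invf_div mulrC divfK // gt_eqF.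
have [A0 A0P] := proper_seq fG (proper fG r1 cob ceta feta) (L + 2 * C1 + 3 * C1).
pose A := [seq g <- A0 | `[< G g >]].
have AG g : g \in A -> G g by rewrite mem_filter => /andP[/asboolP].
have AP g : G g -> dd eta org (act g org) <= L + 2 * C1 + 3 * C1 -> g \in A.
  by move=> Gg h; rewrite mem_filter A0P // andbT; apply/asboolP.
(* One test function for each step in A; the last index carries [cutchi]. *)
exists (size A).+1, (fun i : 'I_(size A).+1 => if (i < size A)%N then cutphi r (nth 1%:M A i) else cutchi r).
(* Tolerance 1 suffices, since each piece may contribute a bounded error; eps enters through L,
   hence through A. *)
exists 1 => //; split.
  move=> i; case: ifP => iA; last exact: (cutchi_test r1).
  by apply: (cutphi_test r1); apply: (G_SO fG); apply: AG; exact: mem_nth.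
move=> eta' ceta' _ cl.
have closeA g : g \in A -> G g -> (`|pair_int eta' (cutphi r g) - pair_int eta (cutphi r g)| < 1%:E)%E.
  move=> gA _; have ig : (index g A < (size A).+1)%N by rewrite ltnS index_size.
  by have := cl (Ordinal ig); rewrite /= index_mem gA nth_index.
have closeC : (`|pair_int eta' (cutchi r) - pair_int eta (cutchi r)| < 1%:E)%E.
  by have := cl ord_max; rewrite /= ltnn.
have close := delta_close fG r1 cob ceta ceta' L0 AP closeA closeC KE K2.
rewrite !(delta_metric_base fG _ do0 dorg) // vE.
have d0 := delta_metric_ge0 fG ceta' dorg.
have q0 : 0 < 1 - K by lra.
(* [close] needs a number strictly above the exponent, hence the detour through an arbitrary e >
   0. *)
have up : (delta_metric G org eta' <= ((1 - K)^-1 * v)%:E)%E.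
  apply/lee_addgt0Pr => e e0; rewrite -EFinD.
  have ve : 0 <= v + (1 - K) * e by rewrite addr_ge0 // mulr_ge0 ?ltW.
  have [h _] := close _ ve.
  have -> : (1 - K)^-1 * v + e = (1 - K)^-1 * (v + (1 - K) * e) by field; rewrite gt_eqF.
  by apply: h; rewrite vE lte_fin ltrDl mulr_gt0.
move: d0 up close; case: (delta_metric G org eta') => [v'|//|//]; rewrite !lee_fin => v'0 up close.
have lo : v <= (1 + K) * v'.
  rewrite -lee_fin; apply/lee_addgt0Pr => e e0; rewrite -EFinD.
  have K1 : 0 < 1 + K by lra.
  have ve : 0 <= v' + e / (1 + K) by rewrite addr_ge0 // divr_ge0 ?ltW.
  have [_ h] := close _ ve; rewrite -vE.
  have -> : (1 + K) * v' + e = (1 + K) * (v' + e / (1 + K)) by field; rewrite gt_eqF.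
  by apply: h; rewrite lte_fin ltrDl divr_gt0.
rewrite mulrC ler_pdivlMr // in up.
rewrite -EFinB abse_EFin lte_fin ltr_norml; apply/andP; split; nra.
Qed.
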